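(* Let $k$ be a field and let $R=k[\![x,y,z,w]\!]/(y^3-xz,\ yz-xw,\ x^4-yw,\ z^2-y^2w,\ x^3y^2-zw,\ x^3z-w^2)\cong k[\![t^5,t^6,t^{13},t^{14}]\!]$ (with $x,y,z,w$ corresponding to $t^5,t^6,t^{13},t^{14}$), with maximal ideal $\mathfrak m=(x,y,z,w)$, and let $I=(x^2,xy,y^2)$, which is a canonical ideal for $R$. Then $\mathfrak m\operatorname{Ext}^i_R(I,R)=0$ for all $i>0$, but $\operatorname{tr}_R(I)=\mathfrak c_R=(x^2,xy,y^2,z,w)$. In particular, $R$ is not nearly Gorenstein.
   Context: A canonical ideal is an ideal isomorphic to the canonical module $\omega_R$. $\operatorname{tr}_R(M)=\langle f(u)\mid u\in M,f\in\operatorname{Hom}_R(M,R)\rangle$. $\mathfrak c_R=(R:_{\overline R}\overline R)$ is the conductor, where $\overline R$ is the integral closure of $R$ (here $\overline R=k[\![t]\!]$). $R$ is nearly Gorenstein if $\operatorname{tr}_R(\omega_R)\supseteq\mathfrak m$. *)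

(* Defs.v *)
From HB Require Import structures.
From mathcomp Require Import all_boot all_order all_algebra.
From mathcomp Require Import generic_quotient ring_quotient.
From mathcomp Require Import boolp functions.
From mathcomp.multinomials Require Import freeg.

Set Implicit Arguments.
Unset Strict Implicit.
Unset Printing Implicit Defensive.

Import GRing.Theory.
Local Open Scope ring_scope.
Local Open Scope quotient_scope.

(* A[[t]]; a power series is represented by its sequence of coefficients. *)
Record series (A : Type) := Series { coefs : nat -> A }.

Section SeriesRing.
Variable A : nzRingType.
Implicit Types f g h : series A.

HB.instance Definition _ := [isNew for @coefs A].
HB.instance Definition _ := [Choice of series A by <:].

Lemma seriesP f g : coefs f =1 coefs g -> f = g.
Proof. by move=> fg; apply: val_inj; apply: funext. Qed.

Definition series0 : series A := Series (fun=> 0).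
Definition series1 : series A := Series (fun n => (n == 0)%:R).
Definition series_opp f := Series (fun n => - coefs f n).
Definition series_add f g := Series (fun n => coefs f n + coefs g n).
Definition series_mul f g :=
  Series (fun n => \sum_(i < n.+1) coefs f i * coefs g (n - i)).

Fact series_addA : associative series_add.
Proof. by move=> f g h; apply: seriesP => n /=; rewrite addrA. Qed.
Fact series_addC : commutative series_add.
Proof. by move=> f g; apply: seriesP => n /=; rewrite addrC. Qed.
Fact series_add0 : left_id series0 series_add.
Proof. by move=> f; apply: seriesP => n /=; rewrite add0r. Qed.
Fact series_addN : left_inverse series0 series_opp series_add.
Proof. by move=> f; apply: seriesP => n /=; rewrite addNr. Qed.

HB.instance Definition _ := GRing.isZmodule.Build (series A)
  series_addA series_addC series_add0 series_addN.

(* Truncation, used to transport the ring axioms from {poly A}. *)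
Definition trunc n f : {poly A} := \poly_(i < n) coefs f i.

Fact coef_trunc_mul f g n i : (i < n)%N ->
  (trunc n f * trunc n g)`_i = coefs (series_mul f g) i.
Proof.
move=> lin; rewrite coefM /=; apply: eq_bigr => j _.
rewrite !coef_poly (leq_ltn_trans _ lin) ?(leq_ltn_trans (leq_subr _ _) lin) //.
by rewrite -ltnS.
Qed.

Fact series_mulA : associative series_mul.
Proof.
move=> f g h; apply: seriesP => n; rewrite /=.
transitivity (trunc n.+1 f * (trunc n.+1 g * trunc n.+1 h))`_n.
  rewrite coefM; apply: eq_bigr => i _.
  rewrite coef_trunc_mul ?ltnS ?leq_subr // coef_poly.
  by have -> : (i < n.+1)%N by [].
rewrite mulrA coefM; apply: eq_bigr => i _.
by rewrite coef_trunc_mul // coef_poly ltnS leq_subr.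
Qed.
Fact series_mul1l : left_id series1 series_mul.
Proof.
move=> f; apply: seriesP => n /=.
by rewrite big_ord_recl /= subn0 mul1r big1 ?addr0 // => i _; rewrite mul0r.
Qed.
Fact series_mul1r : right_id series1 series_mul.
Proof.
move=> f; apply: seriesP => n /=.
rewrite big_ord_recr /= subnn mulr1 big1 ?add0r // => i _.
by rewrite subn_eq0 leqNgt ltn_ord mulr0.
Qed.
Fact series_mulDl : left_distributive series_mul series_add.
Proof.
move=> f g h; apply: seriesP => n /=; rewrite -big_split /=.
by apply: eq_bigr => i _; rewrite mulrDl.
Qed.
Fact series_mulDr : right_distributive series_mul series_add.
Proof.
move=> f g h; apply: seriesP => n /=; rewrite -big_split /=.
by apply: eq_bigr => i _; rewrite mulrDr.
Qed.
Fact series_1_neq0 : series1 != 0.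
Proof. by apply/eqP => /(congr1 (fun f => coefs f 0)) /eqP; rewrite oner_eq0. Qed.

HB.instance Definition _ := GRing.Zmodule_isNzRing.Build (series A)
  series_mulA series_mul1l series_mul1r series_mulDl series_mulDr series_1_neq0.

Lemma coefs0 n : coefs (0 : series A) n = 0. Proof. by []. Qed.
Lemma coefs1 n : coefs (1 : series A) n = (n == 0)%:R. Proof. by []. Qed.
Lemma coefsN f n : coefs (- f) n = - coefs f n. Proof. by []. Qed.
Lemma coefsD f g n : coefs (f + g) n = coefs f n + coefs g n. Proof. by []. Qed.
Lemma coefsM f g n :
  coefs (f * g) n = \sum_(i < n.+1) coefs f i * coefs g (n - i).
Proof. by []. Qed.

Definition serC (a : A) : series A := Series (fun n => if n is 0 then a else 0).
Definition serX : series A := Series (fun n => (n == 1)%:R).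

Lemma coefs_Xn n i : coefs (serX ^+ n) i = (i == n)%:R.
Proof.
elim: n i => [|n IHn] i; first by [].
rewrite exprS coefsM; case: i => [|i].
  by rewrite big_ord_recl big_ord0 mul0r addr0.
rewrite big_ord_recl mul0r add0r big_ord_recl mul1r /= subSS subn0 IHn eqSS.
by rewrite big1 ?addr0 // => j _; rewrite mul0r.
Qed.

End SeriesRing.

Section SeriesComRing.
Variable A : comNzRingType.

Fact series_mulC : commutative (@series_mul A).
Proof.
move=> f g; apply: seriesP => n; rewrite -!(coef_trunc_mul _ _ (ltnSn n)).
by rewrite mulrC.
Qed.

HB.instance Definition _ :=
  GRing.PzRing_hasCommutativeMul.Build (series A) series_mulC.

End SeriesComRing.

Section SeriesUnit.
Variable A : comUnitRingType.
Implicit Types f g : series A.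

Definition series_unit : pred (series A) := fun f => coefs f 0 \is a GRing.unit.

(* The first n coefficients of f^-1, for f in series_unit. *)
Fixpoint inv_seq f n : seq A :=
  if n is m.+1 then
    rcons (inv_seq f m) ((coefs f 0)^-1 *
      ((m == 0)%:R - \sum_(i < m) (inv_seq f m)`_i * coefs f (m - i)))
  else [::].

Definition series_inv f :=
  if series_unit f then Series (fun n => (inv_seq f n.+1)`_n) else f.

Lemma size_inv_seq f n : size (inv_seq f n) = n.
Proof. by elim: n => //= n IHn; rewrite size_rcons IHn. Qed.

Lemma nth_inv_seq f n i : (i < n)%N -> (inv_seq f n)`_i = (inv_seq f i.+1)`_i.
Proof.
elim: n => // n IHn; rewrite ltnS leq_eqVlt => /predU1P[-> //|lin].
by rewrite -(IHn lin) [LHS]nth_rcons size_inv_seq lin.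
Qed.

Lemma coefs_series_inv f n : series_unit f ->
  coefs (series_inv f) n = (coefs f 0)^-1 *
    ((n == 0)%:R - \sum_(i < n) coefs (series_inv f) i * coefs f (n - i)).
Proof.
move=> uf; rewrite /series_inv uf /= nth_rcons size_inv_seq ltnn eqxx.
congr (_ * (_ - _)); apply: eq_bigr => i _; congr (_ * _).
by rewrite (nth_inv_seq f (ltn_ord i)).
Qed.

Fact series_mulVr : {in series_unit, left_inverse 1 series_inv *%R}.
Proof.
move=> f uf; apply: seriesP => n; rewrite coefsM big_ord_recr /= subnn.
rewrite (coefs_series_inv n uf) mulrC mulrA divrr ?mul1r //.
by rewrite addrC subrK.
Qed.
Fact series_unitP f g : g * f = 1 -> series_unit f.
Proof.
move=> /(congr1 (fun h => coefs h 0)); rewrite coefsM big_ord_recl big_ord0.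
rewrite addr0 /= => gf1; apply/unitrPr; exists (coefs g 0).
by rewrite mulrC.
Qed.
Fact series_inv_out : {in [predC series_unit], series_inv =1 id}.
Proof. by move=> f /negPf; rewrite /series_inv /in_mem /= => ->. Qed.

HB.instance Definition _ := GRing.ComNzRing_hasMulInverse.Build (series A)
  series_mulVr series_unitP series_inv_out.

End SeriesUnit.

Section SeriesDomain.
Variable A : idomainType.

Fact series_domain : GRing.integral_domain_axiom (series A).
Proof.
have low (f : series A) : f != 0 ->
    exists2 m, coefs f m != 0 & forall i, (i < m)%N -> coefs f i = 0.
  move=> f0; have ex : exists n, coefs f n != 0.
    apply: contrapT => no; case/eqP: f0; apply: seriesP => n.
    by apply/eqP; apply/negPn/negP => fn; apply: no; exists n.
  exists (ex_minn ex); case: ex_minnP => // m _ min i lim.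
  by apply/eqP; apply: contraLR lim => /min; rewrite -leqNgt.
move=> f g fg0; apply/norP => -[/low[m fm fmin] /low[n gn gmin]].
move/(congr1 (fun h => coefs h (m + n))): fg0; rewrite coefsM => /eqP.
have lm : (m < (m + n).+1)%N by rewrite ltnS leq_addr.
rewrite (bigD1 (Ordinal lm)) //= big1 => [|i ne].
  by rewrite addr0 addKn mulf_eq0 (negPf fm) (negPf gn).
have [lim|lmi|eim] := ltngtP i m; first by rewrite fmin ?mul0r.
  rewrite gmin ?mulr0 // ltn_subLR; last by rewrite -ltnS.
  by rewrite ltn_add2r.
by case/eqP: ne; apply: val_inj.
Qed.

HB.instance Definition _ :=
  GRing.ComUnitRing_isIntegral.Build (series A) series_domain.

End SeriesDomain.

(* Predicates on modules are made boolean by the classical [< _ >]. *)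

Section Span.
Variables (R : nzRingType) (V : lmodType R) (A : {pred V}).

Definition linspan : {pred V} := [pred v | `[< exists s : seq (R * V),
  all (fun au => au.2 \in A) s /\ v = \sum_(au <- s) au.1 *: au.2 >]].

Fact span_submod_closed : submod_closed linspan.
Proof.
split=> [|a u v /asboolP[s [sA ->]] /asboolP[t [tA ->]]]; apply/asboolP.
  by exists [::]; rewrite big_nil.
exists ([seq (a * au.1, au.2) | au <- s] ++ t); split.
  rewrite all_cat tA andbT all_map.
  by apply: sub_all sA => au.
rewrite big_cat big_map scaler_sumr /=; congr (_ + _).
by apply: eq_bigr => i _; rewrite scalerA.
Qed.

HB.instance Definition _ := GRing.isSubmodClosed.Build R V linspan
  span_submod_closed.

End Span.

Notation ideal A := (@linspan _ (GRing.regular _) (mem A)).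

Section Submodule.
Variables (R : nzRingType) (V : lmodType R) (S : submodClosed V).

Record submod := Submod { submod_val : V; _ : submod_val \in S }.

HB.instance Definition _ := [isSub for submod_val].
HB.instance Definition _ := [Choice of submod by <:].
HB.instance Definition _ := [SubChoice_isSubLmodule of submod by <:].

Definition quot_pred : {pred V} := S.

HB.instance Definition _ := GRing.isZmodClosed.Build V quot_pred
  (GRing.submod_closedB (submodClosedP S)).

Definition quotmod := Quotient.quot quot_pred.

HB.instance Definition _ := GRing.Zmodule.on quotmod.

Definition quot_proj (v : V) : quotmod := \pi_(Quotient.quot quot_pred) v.

Definition quot_scale (a : R) (q : quotmod) : quotmod :=
  quot_proj (a *: repr (q : Quotient.quot quot_pred)).

Fact quot_projK (q : quotmod) :
  quot_proj (repr (q : Quotient.quot quot_pred)) = q.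
Proof. exact: reprK. Qed.
Fact quot_projD u v : quot_proj (u + v) = quot_proj u + quot_proj v.
Proof. exact: (raddfD (\pi_(Quotient.quot quot_pred))). Qed.
Fact quot_scale_proj a v : quot_scale a (quot_proj v) = quot_proj (a *: v).
Proof.
apply/eqP; rewrite -Quotient.idealrBE -scalerBr; apply: (@rpredZ _ _ S).
by rewrite -[_ \in S]/(_ \in quot_pred) Quotient.idealrBE reprK.
Qed.

Fact quot_scaleA a b q : quot_scale a (quot_scale b q) = quot_scale (a * b) q.
Proof. by rewrite -[q]quot_projK !quot_scale_proj scalerA. Qed.
Fact quot_scale1 : left_id 1 quot_scale.
Proof. by move=> q; rewrite -[q]quot_projK quot_scale_proj scale1r. Qed.
Fact quot_scaleDr : right_distributive quot_scale +%R.
Proof.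
move=> a p q; rewrite -[p]quot_projK -[q]quot_projK -quot_projD.
by rewrite !quot_scale_proj scalerDr quot_projD.
Qed.
Fact quot_scaleDl q : {morph quot_scale^~ q : a b / a + b}.
Proof.
by move=> a b; rewrite -[q]quot_projK !quot_scale_proj scalerDl quot_projD.
Qed.

HB.instance Definition _ := GRing.Zmodule_isLmodule.Build R quotmod
  quot_scaleA quot_scale1 quot_scaleDr quot_scaleDl.

End Submodule.

Section Subquotient.
Variables (R : nzRingType) (V : lmodType R) (Z B : submodClosed V).

Definition restrict : {pred submod Z} := [pred z | val z \in B].

Fact restrict_submod_closed : submod_closed restrict.
Proof.
split=> [|a u v uB vB]; rewrite inE; first by rewrite raddf0 rpred0.
by rewrite linearP rpredD // rpredZ.
Qed.

HB.instance Definition _ := GRing.isSubmodClosed.Build R (submod Z) restrict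
  restrict_submod_closed.

(* Z / (Z :&: B) *)
Definition subquot : lmodType R := quotmod restrict.

End Subquotient.

Section Kernel.
Variables (R : nzRingType) (U V : lmodType R) (f : {linear U -> V}).

Definition kernel : {pred U} := [pred u | f u == 0].

Fact kernel_submod_closed : submod_closed kernel.
Proof.
split=> [|a u v /eqP fu /eqP fv]; rewrite inE ?raddf0 //.
by rewrite linearP fu fv scaler0 addr0.
Qed.

HB.instance Definition _ := GRing.isSubmodClosed.Build R U kernel
  kernel_submod_closed.

End Kernel.

Section FreeCover.
Variables (R : nzRingType) (M : lmodType R).

Definition free_cover : lmodType R := {freeg M / R}.

Definition augment : free_cover -> M := @fglift R M M id.

Fact augment_linear : linear augment.
Proof.
move=> a D E.
have addA : additive augment by exact: lift_is_additive.
pose aug : {additive {freeg M / R} -> M} := HB.pack augment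
  (GRing.isZmodMorphism.Build {freeg M / R} M augment addA).
have -> : augment = aug by [].
rewrite raddfD; congr (_ + _).
rewrite [a *: D]/(fgscale a D) /fgscale raddf_sum.
have -> : aug D = \sum_(x <- dom D) aug << coeff x D *g x >>.
  by rewrite -raddf_sum freeg_sumE.
rewrite scaler_sumr; apply: eq_bigr => x _.
by rewrite /aug /= /augment !liftU scalerA.
Qed.

HB.instance Definition _ := GRing.isLinear.Build R free_cover M *:%R augment
  augment_linear.

End FreeCover.

Section Ext.
Variables (R : comNzRingType) (M : lmodType R).

(* The standard free resolution ... -> F_1 -> F_0 -> M -> 0, in which F_n is
   free on the elements of the n-th syzygy module. *)
Fixpoint syzygy (n : nat) : lmodType R :=
  if n is n'.+1 then submod (kernel (@augment R (syzygy n'))) else M.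

Definition resol (n : nat) : lmodType R := free_cover (syzygy n).

Definition resol_diff (n : nat) (e : resol n.+1) : resol n :=
  submod_val (augment e).

Variables (N : lmodType R) (i : nat).

(* Hom(F_i, N) is the set of linear maps in the module F_i -> N of all maps. *)
Definition cocycle : {pred resol i -> N} := [pred f : resol i -> N |
  `[< linear f /\ forall e, f (resol_diff e) = 0 >]].

Definition coboundary : {pred resol i -> N} :=
  match i return {pred resol i -> N} with
  | 0 => [pred f : resol 0 -> N | f == 0]
  | j.+1 => [pred f : resol j.+1 -> N |
      `[< exists g : {linear resol j -> N}, forall e, f e = g (resol_diff e) >]]
  end.

Fact cocycle_submod_closed : submod_closed cocycle.
Proof.
split=> [|a f g /asboolP[fl f0] /asboolP[gl g0]]; apply/asboolP.
  by split=> // b u v; rewrite /= [LHS]/(0 : N) scaler0 addr0.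
split=> [b u v|e] /=; last first.
  by rewrite -[LHS]/(a *: f _ + g _) f0 g0 scaler0 addr0.
rewrite -[LHS]/(a *: f _ + g _) -[(_ + _) u]/(a *: f u + g u).
rewrite -[(_ + _) v]/(a *: f v + g v) fl gl !scalerDr !scalerA.
by rewrite (mulrC b) addrACA.
Qed.

Fact coboundary_submod_closed : submod_closed coboundary.
Proof.
rewrite /coboundary; case: i => [|j].
  split=> [|a f g /eqP -> /eqP ->]; rewrite inE //.
  by rewrite scaler0 addr0.
split=> [|a f g /asboolP[f' fE] /asboolP[g' gE]]; apply/asboolP.
  by exists (\0 : {linear resol j -> N}).
have lin : linear (fun e => a *: f' e + g' e).
  move=> b u v /=; rewrite (linearP f') (linearP g') !scalerDr !scalerA.
  by rewrite (mulrC b) addrACA.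
pose h : {linear resol j -> N} := HB.pack (fun e => a *: f' e + g' e)
  (GRing.isLinear.Build R (resol j) N *:%R _ lin).
exists h => e /=.
by rewrite -fE -gE.
Qed.

HB.instance Definition _ := GRing.isSubmodClosed.Build R (resol i -> N) cocycle
  cocycle_submod_closed.
HB.instance Definition _ := GRing.isSubmodClosed.Build R (resol i -> N)
  coboundary coboundary_submod_closed.

Definition Ext : lmodType R := subquot cocycle coboundary.

End Ext.

Section LocalAlgebra.
Variable R : comNzRingType.

Definition maximal_ideal (J : {pred R}) : Prop :=
  idealr_closed J /\
  forall J' : {pred R}, idealr_closed J' -> {subset J <= J'} -> J' =i J.

Definition prime_ideal (J : {pred R}) : Prop :=
  idealr_closed J /\ prime_idealr_closed J.

Definition prime_chain (d : nat) (p : nat -> {pred R}) : Prop :=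
  (forall i, (i <= d)%N -> prime_ideal (p i)) /\
  (forall i, (i < d)%N ->
     {subset p i <= p i.+1} /\ ~ {subset p i.+1 <= p i}).

Definition krull_dim (d : nat) : Prop :=
  (exists p, prime_chain d p) /\ ~ (exists p, prime_chain d.+1 p).

Definition finitely_generated (M : lmodType R) : Prop :=
  exists s : seq M, forall u : M, u \in linspan (mem s).

(* (s) M *)
Definition ideal_mul (M : lmodType R) (s : seq R) : {pred M} :=
  linspan [pred v : M | `[< exists2 a, a \in s & exists u : M, v = a *: u >]].

Arguments ideal_mul : clear implicits.

Definition regular_seq (M : lmodType R) (s : seq R) : Prop :=
  (exists u : M, u \notin ideal_mul M s) /\
  (forall (i : nat) (u : M), (i < size s)%N ->
     s`_i *: u \in ideal_mul M (take i s) -> u \in ideal_mul M (take i s)).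

Definition injective_module (E : lmodType R) : Prop :=
  forall (U V : lmodType R) (h : {linear U -> V}) (f : {linear U -> E}),
    injective h -> exists g : {linear V -> E}, forall u, g (h u) = f u.

(* There is an exact sequence 0 -> M -> E_0 -> ... -> E_n -> 0 with all E_i
   injective; it is padded by zero modules. *)
Definition finite_inj_dim (M : lmodType R) : Prop :=
  exists (n : nat) (E : nat -> lmodType R) (h : {linear M -> E 0})
      (d : forall i, {linear E i -> E i.+1}),
    [/\ forall i, injective_module (E i),
        forall i, (n < i)%N -> forall e : E i, e = 0,
        injective h,
        forall e, d 0 e = 0 <-> exists u, e = h u &
        forall i e, d i.+1 e = 0 <-> exists e', e = d i e'].

Definition trace (M : lmodType R) : {pred R} :=
  ideal [pred a : R | `[< exists (f : {linear M -> R^o}) (u : M), a = f u >]].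

(* m stands for the maximal ideal of R, which is meant to be local. *)
Variable m : submodClosed R^o.

Definition depth (M : lmodType R) (d : nat) : Prop :=
  (exists s, [/\ {subset s <= m}, regular_seq M s & size s = d]) /\
  (forall s, {subset s <= m} -> regular_seq M s -> (size s <= d)%N).

Definition residue_field : lmodType R := quotmod m.

(* Bruns--Herzog, Definition 3.3.1: over a Cohen--Macaulay local ring, a
   canonical module is a maximal Cohen--Macaulay module of type 1 and of finite
   injective dimension. For M of depth d the type is the dimension of
   Ext^d(R/m, M) over R/m. *)
Definition canonical_module (C : lmodType R) : Prop :=
  exists d : nat,
    [/\ krull_dim d, depth R^o d, finitely_generated C /\ depth C d,
        exists f : {linear residue_field -> Ext residue_field C d}, bijective f
      & finite_inj_dim C].

Definition canonical_ideal (I : submodClosed R^o) : Prop :=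
  exists2 C : lmodType R, canonical_module C &
    exists f : {linear C -> submod I}, bijective f.

(* Canonical modules are unique up to isomorphism, so which one is used for
   omega_R does not matter; the first clause asks that omega_R exist. *)
Definition nearly_gorenstein : Prop :=
  (exists C, canonical_module C) /\
  (forall C, canonical_module C -> {subset m <= trace C}).

End LocalAlgebra.

Local Notation tofrac := (@FracField.tofrac _).

(* The conductor (R : R') in the integral closure R' of the domain R in its
   fraction field; it is contained in R because 1 is in R'. *)
Definition conductor (R : idomainType) : {pred R} := [pred a : R |
  `[< forall q : {fraction R}, integralOver tofrac q ->
      exists b : R, tofrac a * q = tofrac b >]].

Arguments conductor : clear implicits.

Definition in_semigroup (s : seq nat) (n : nat) : Prop :=
  exists c : nat -> nat, n = (\sum_(i < size s) c i * nth 0 s i)%N.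

Section SemigroupRing.
Variables (k : fieldType) (s : seq nat).

Definition sgring_pred : {pred series k} := [pred f : series k |
  `[< forall n, coefs f n != 0 -> in_semigroup s n >]].

Fact in_semigroup0 : in_semigroup s 0.
Proof. by exists (fun=> 0); rewrite big1. Qed.
Fact in_semigroupD p q :
  in_semigroup s p -> in_semigroup s q -> in_semigroup s (p + q).
Proof.
move=> [c ->] [d ->]; exists (fun i => c i + d i)%N.
by rewrite -big_split; apply: eq_bigr => i _; rewrite mulnDl.
Qed.
Fact in_semigroup_nth i : in_semigroup s (nth 0%N s i).
Proof.
have [lis|leq] := ltnP i (size s); last first.
  by rewrite nth_default //; exact: in_semigroup0.
exists (fun j => (j == i : nat)); rewrite (bigD1 (Ordinal lis)) //= eqxx mul1n.
by rewrite big1 ?addn0 // => j; rewrite -val_eqE /= => /negPf ->.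
Qed.

Fact sgring_divring_closed : divring_closed sgring_pred.
Proof.
have mulS f g : f \in sgring_pred -> g \in sgring_pred -> f * g \in sgring_pred.
  move=> /asboolP fS /asboolP gS; apply/asboolP => n.
  rewrite coefsM => fg0; apply: contrapT => nS; case/eqP: fg0.
  apply: big1 => i _; apply/eqP; apply: contra_notT nS.
  rewrite mulf_eq0 negb_or => /andP[/fS fi /gS gi].
  have -> : n = (i + (n - i))%N by rewrite subnKC // -ltnS.
  exact: in_semigroupD.
split=> [|f g /asboolP fS /asboolP gS|f g fS gS].
- apply/asboolP => n; rewrite coefs1; case: n => [_|n]; last by rewrite eqxx.
  exact: in_semigroup0.
- apply/asboolP => n; rewrite coefsD coefsN.
  have [->|/fS //] := eqVneq (coefs f n) 0.
  by rewrite add0r oppr_eq0 => /gS.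
apply: mulS => //; have [ug|nug] := boolP (series_unit g); last first.
  by rewrite -[g^-1]/(series_inv g) /series_inv (negPf nug).
move/asboolP: gS => gS; apply/asboolP; elim/ltn_ind => n IHn.
rewrite -[g^-1]/(series_inv g) coefs_series_inv //.
case: n IHn => [|n] IHn; first by move=> _; exact: in_semigroup0.
rewrite sub0r => nz; apply: contrapT => nS; case/eqP: nz.
rewrite big1 ?oppr0 ?mulr0 // => i _; apply/eqP; apply: contra_notT nS.
rewrite mulf_eq0 negb_or => /andP[/(IHn i (ltn_ord i)) gi /gS gni].
have -> : n.+1 = (i + (n.+1 - i))%N by rewrite subnKC // ltnW.
exact: in_semigroupD.
Qed.

HB.instance Definition _ := GRing.isDivringClosed.Build (series k) sgring_pred
  sgring_divring_closed.

(* k[[t^s_1, ..., t^s_r]]: the power series with exponents in the semigroup. *)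
Record sgring := Sgring { sgring_val : series k; _ : sgring_val \in sgring_pred }.

HB.instance Definition _ := [isSub for sgring_val].
HB.instance Definition _ := [Choice of sgring by <:].
HB.instance Definition _ := [SubChoice_isSubIntegralDomain of sgring by <:].

Fact sgring_Xn n : in_semigroup s n -> serX k ^+ n \in sgring_pred.
Proof.
move=> sn; apply/asboolP => i; rewrite coefs_Xn.
by have [->|_] := eqVneq i n; rewrite ?eqxx.
Qed.

Definition sgring_gen (i : nat) : sgring :=
  Sgring (sgring_Xn (in_semigroup_nth i)).

Fact sgring_serC (c : k) : serC c \in sgring_pred.
Proof.
apply/asboolP => -[_|n]; last by rewrite eqxx.
exact: in_semigroup0.
Qed.

Definition sgring_const (c : k) : sgring := Sgring (sgring_serC c).

End SemigroupRing.

Section Presentation.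
Variable k : fieldType.

(* k[[x, y, z, w]], as k[[x]][[y]][[z]][[w]]. *)
Definition series4 := series (series (series (series k))).

HB.instance Definition _ := GRing.ComNzRing.on series4.

Definition const4 (c : k) : series4 := serC (serC (serC (serC c))).
Definition x4 : series4 := serC (serC (serC (serX _))).
Definition y4 : series4 := serC (serC (serX _)).
Definition z4 : series4 := serC (serX _).
Definition w4 : series4 := serX _.

Definition relators : seq series4 := [::
  y4 ^+ 3 - x4 * z4; y4 * z4 - x4 * w4; x4 ^+ 4 - y4 * w4;
  z4 ^+ 2 - y4 ^+ 2 * w4; x4 ^+ 3 * y4 ^+ 2 - z4 * w4;
  x4 ^+ 3 * z4 - w4 ^+ 2].

Definition relations : {pred series4} := ideal relators.

Definition const_term (f : series4) : k :=
  coefs (coefs (coefs (coefs f 0) 0) 0) 0.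

Fact const_termD f g : const_term (f + g) = const_term f + const_term g.
Proof. by []. Qed.
Fact const_termN f : const_term (- f) = - const_term f.
Proof. by []. Qed.
Fact const_termM f g : const_term (f * g) = const_term f * const_term g.
Proof. by rewrite /const_term !(coefsM, big_ord_recl, big_ord0, addr0). Qed.
Fact const_termX f n : const_term (f ^+ n.+1) = const_term f * const_term (f ^+ n).
Proof. by rewrite exprS const_termM. Qed.

Fact const_term_relators : {in relators, forall r, const_term r = 0}.
Proof.
have ex : const_term x4 = 0 by [].
have ey : const_term y4 = 0 by [].
have ez : const_term z4 = 0 by [].
have ew : const_term w4 = 0 by [].
move: ex ey ez ew; rewrite /relators.
move: x4 y4 z4 w4 => x y z w ex ey ez ew r; rewrite !inE.
by move=> /or4P[/eqP->|/eqP->|/eqP->|/or3P[]/eqP->];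
  rewrite const_termD const_termN ?(const_termM, const_termX) ?ex ?ey ?ez ?ew
          !(mul0r, mulr0, subr0).
Qed.

Fact relations_idealr_closed : idealr_closed relations.
Proof.
have [r0 rD] := @span_submod_closed _ series4^o (mem relators).
split=> //; apply/negP => /asboolP[l [lA /(congr1 const_term)]].
rewrite (big_morph const_term const_termD (erefl : const_term 0 = 0)).
rewrite big1_seq => [/eqP|au /andP[_ /(allP lA) aur]].
  by rewrite (_ : const_term 1 = 1) ?oner_eq0.
rewrite -[au.1 *: au.2]/(au.1 * au.2) const_termM.
by rewrite (const_term_relators aur) mulr0.
Qed.

HB.instance Definition _ := isIdealr.Build series4 relations
  relations_idealr_closed.

Definition presented := Quotient.quot relations.

HB.instance Definition _ := GRing.ComNzRing.on presented.

Definition presented_proj (f : series4) : presented :=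
  \pi_(Quotient.quot relations) f.

End Presentation.

(* Main.v *)
(* In exponents of t, R is spanned by 0, 5, 6 and all n >= 10; the conductor is
   t^10 k[[t]] and I = (t^10, t^11, t^12) has the exponents 10, 11, 12, 15, 16,
   17, 18 and all n >= 20.

   The syzygies (p, q, r) of the three generators of I are the solutions of
   p + q t + r t^2 = 0. They form a free module of rank two over the ring
   B = k + t^5 k[[t]] = (m : m). As m B lies in R, multiplication by a in m on
   them factors through a free R-module. This property is inherited by higher
   syzygies, so m kills Ext^i(I, -) for i >= 2. For i = 1, a h is extended
   explicitly for every h from the syzygies to R.

   The residue pairing (f, q) |-> coefficient of t^19 in f q identifies
   k((t)) / I with the continuous dual of R, which is injective by Baer's
   criterion; hence I has injective dimension one. Its type is one because t^19
   spans the socle of k((t)) / I.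

   A homomorphism from I to R is multiplication by p / t^10 with p, t p, t^2 p in
   R, which forces p into t^10 k[[t]]; so the trace of I is the conductor.

   The relators are homogeneous for the weights 5, 6, 13, 14, and modulo them a
   monomial is determined by its weight. So the homogeneous parts of a series in
   the kernel of evaluation are in the ideal, and these infinitely many
   memberships can be summed. *)

From HB Require Import structures.
From mathcomp Require Import all_boot all_order all_algebra.
From mathcomp Require Import generic_quotient ring_quotient.
From mathcomp Require Import boolp functions.
From mathcomp Require classical_sets.
From mathcomp.multinomials Require Import freeg.
From mathcomp Require Import zify ring.
Require Import Defs.

Set Implicit Arguments.
Unset Strict Implicit.
Unset Printing Implicit Defensive.

Import GRing.Theory.
Local Open Scope ring_scope.
Local Open Scope quotient_scope.

(** * Power series *)

(** The constant 19 is 9 + 10, where 9 is the largest gap: n is an exponent of I exactly when 19 - n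
    is not in the semigroup. So I is the orthogonal of R for the pairing given by the coefficient of
    t^19.

    [Ext] is computed from covers that are free on all elements of a module, so its first syzygies
    are much larger than the relations among a few generators. The maps [rho] and [cyc_rho] subtract
    from an element of F_0 its rewriting over chosen generators; this reduces every extension
    problem to those relations.

    A factorisation of a through a free module on the first syzygies extends maps defined on the
    second syzygies, and says nothing about Ext^1. There the target R enters: a homomorphism to R
    takes the two basic syzygies into m, and elements of m^2 have no t^13 or t^14, which leaves few
    coefficients to correct by hand. *)

Section LinearSpan.
Variables (R : nzRingType) (V : lmodType R).

Lemma mem_linspan (A : {pred V}) v : v \in A -> v \in linspan A.
Proof.
move=> vA; apply/asboolP; exists [:: (1, v)].
by rewrite /= vA big_seq1 scale1r.
Qed.

Lemma linspan_ind (A : {pred V}) (P : V -> Prop) :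
  P 0 -> (forall a u v, u \in A -> P v -> P (a *: u + v)) ->
  forall v, v \in linspan A -> P v.
Proof.
move=> P0 PD v /asboolP[s [sA ->]]; elim: s sA => [|[a u] s IHs] /=.
  by rewrite big_nil.
by case/andP=> uA /IHs Ps; rewrite big_cons; apply: PD.
Qed.

Lemma linspan_seqP (s : seq V) v :
  v \in linspan (mem s) ->
  exists c : nat -> R, v = \sum_(i < size s) c i *: nth 0 s i.
Proof.
move=> /asboolP[t []]; elim: t v => [|[a u] t IHt] v /=.
  move=> _; rewrite big_nil => ->; exists (fun=> 0).
  by rewrite big1 // => i _; rewrite scale0r.
case/andP=> us /IHt{}IHt; rewrite big_cons /= => ->.
have [c ->] := IHt _ erefl.
(* A generator that occurs several times in [s] is credited to its first occurrence. *)
exists (fun i => (if i == index u s then a else 0) + c i).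
under eq_bigr do rewrite scalerDl.
rewrite big_split /=; congr (_ + _).
have lt_us : (index u s < size s)%N by rewrite index_mem.
rewrite (bigD1 (Ordinal lt_us)) //= eqxx nth_index // big1 ?addr0 // => i.
by rewrite -val_eqE /= => /negPf ->; rewrite scale0r.
Qed.

End LinearSpan.

Section SeriesMonomials.
Variable A : comNzRingType.
Implicit Types f g : series A.

Lemma coefsMXn f n i :
  coefs (serX A ^+ n * f) i = if (n <= i)%N then coefs f (i - n) else 0.
Proof.
rewrite coefsM; case: leqP => ni.
  rewrite (bigD1 (Ordinal (ni : n < i.+1)%N)) //= coefs_Xn eqxx mul1r.
  rewrite big1 ?addr0 // => j; rewrite -val_eqE /= => /negPf.
  by rewrite coefs_Xn => ->; rewrite mul0r.
apply: big1 => j _; rewrite coefs_Xn.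
by case: eqP => [jn|]; rewrite ?mul0r //; have := ltn_ord j; lia.
Qed.

Lemma coefs_sum I (r : seq I) (P : pred I) (F : I -> series A) n :
  coefs (\sum_(i <- r | P i) F i) n = \sum_(i <- r | P i) coefs (F i) n.
Proof. by rewrite (big_morph (fun f => coefs f n) (id1:=0) (op1:=+%R)). Qed.

Lemma coefsCM (a : A) f i : coefs (serC a * f) i = a * coefs f i.
Proof.
by rewrite coefsM big_ord_recl subn0 big1 ?addr0 // => j _; rewrite mul0r.
Qed.

Definition shift n f : series A := Series (fun i => coefs f (i + n)).

Lemma coefs_shift n f i : coefs (shift n f) i = coefs f (i + n).
Proof. by []. Qed.

Lemma shiftK n f : (forall i, (i < n)%N -> coefs f i = 0) ->
  serX A ^+ n * shift n f = f.
Proof.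
move=> f0; apply: seriesP => i; rewrite coefsMXn; case: leqP => ni.
  by rewrite /= subnK.
by rewrite f0.
Qed.

Fact serC_is_zmod_morphism : zmod_morphism (@serC A).
Proof. by move=> a b; apply: seriesP => -[|n] //=; rewrite [RHS]subr0. Qed.
Fact serC_is_monoid_morphism : monoid_morphism (@serC A).
Proof.
split=> [|a b]; first by apply: seriesP => -[|n].
by apply: seriesP => -[|n]; rewrite coefsCM //= mulr0.
Qed.
HB.instance Definition _ := GRing.isZmodMorphism.Build A (series A) (@serC A)
  serC_is_zmod_morphism.
HB.instance Definition _ := GRing.isMonoidMorphism.Build A (series A) (@serC A)
  serC_is_monoid_morphism.

(** The series f(X^d). *)
Definition expand d f : series A :=
  Series (fun i => if (d %| i)%N then coefs f (i %/ d) else 0).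

End SeriesMonomials.

Section SeriesSubst.
Variables (A B : comNzRingType) (g : {rmorphism A -> series B}) (d : nat).

(* sum_i g(f_i) X^((d+1)i); the exponent is positive, so the sum converges
   whether or not g is continuous. *)
Definition subst (f : series A) : series B := Series (fun n =>
  \sum_(i < n.+1) coefs (serX B ^+ (d.+1 * i) * g (coefs f i)) n).

Lemma coefs_subst f n : coefs (subst f) n =
  \sum_(i < n.+1) coefs (serX B ^+ (d.+1 * i) * g (coefs f i)) n.
Proof. by []. Qed.

(** Beyond i = n the power X^((d+1) i) has order above n, so the truncated sum already is the
    evaluation of the polynomial. Through truncation [subst] then inherits multiplicativity from
    evaluation. *)
Lemma coefs_subst_poly (p : {poly A}) n :
  coefs (map_poly g p).[serX B ^+ d.+1] n =
  \sum_(i < n.+1) coefs (serX B ^+ (d.+1 * i) * g p`_i) n.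
Proof.
rewrite (@horner_coef_wide _ (maxn n.+1 (size p))); last first.
  by rewrite (leq_trans (size_poly _ _)) // leq_maxr.
rewrite coefs_sum (big_ord_widen _ (fun i =>
   coefs (serX B ^+ (d.+1 * i) * g p`_i) n) (leq_maxl n.+1 (size p))).
rewrite [RHS]big_mkcond; apply: eq_bigr => i _.
rewrite coef_map mulrC -exprM; case: ltnP => // ni.
by rewrite coefsMXn; case: leqP => //; nia.
Qed.

Fact subst_is_zmod_morphism : zmod_morphism subst.
Proof.
move=> f h; apply: seriesP => n; rewrite coefsD coefsN !coefs_subst -sumrB.
apply: eq_bigr => i _.
by rewrite coefsD coefsN rmorphB mulrBr coefsD coefsN.
Qed.

Fact subst_is_monoid_morphism : monoid_morphism subst.
Proof.
have substE f N n : (n < N)%N ->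
    coefs (subst f) n = coefs (map_poly g (trunc N f)).[serX B ^+ d.+1] n.
  move=> nN; rewrite coefs_subst_poly; apply: eq_bigr => i _.
  by rewrite coef_poly (leq_trans _ nN).
split=> [|f h].
  apply: seriesP => n; rewrite (substE _ n.+1) //.
  rewrite (_ : trunc _ _ = 1) ?rmorph1 ?hornerC //.
  apply/polyP => i; rewrite coef_poly coef1 coefs1.
  by case: i => [|i] //=; case: ifP.
apply: seriesP => n; rewrite [LHS](substE _ n.+1) // coefs_subst_poly.
transitivity (coefs (map_poly g (trunc n.+1 f * trunc n.+1 h)).[serX B ^+ d.+1] n).
  rewrite coefs_subst_poly; apply: eq_bigr => i _.
  by rewrite coef_poly ltn_ord coef_trunc_mul.
rewrite rmorphM /= hornerM !coefsM; apply: eq_bigr => i _.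
by rewrite -!substE // ltnS leq_subr.
Qed.

HB.instance Definition _ := GRing.isZmodMorphism.Build (series A) (series B)
  subst subst_is_zmod_morphism.
HB.instance Definition _ := GRing.isMonoidMorphism.Build (series A) (series B)
  subst subst_is_monoid_morphism.

Lemma subst_serC a : subst (serC a) = g a.
Proof.
apply: seriesP => n; rewrite coefs_subst big_ord_recl muln0 expr0 mul1r.
rewrite big1 ?addr0 // => i _.
by rewrite (_ : coefs (serC a) _ = 0) // rmorph0 mulr0.
Qed.

Lemma subst_serX : subst (serX A) = serX B ^+ d.+1.
Proof.
apply: seriesP => n; transitivity (coefs (map_poly g 'X).[serX B ^+ d.+1] n).
  rewrite coefs_subst_poly; apply: eq_bigr => i _.
  by rewrite coefX.
by rewrite map_polyX hornerX.
Qed.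

End SeriesSubst.

(** * The semigroup ring *)

Definition gaps : seq nat := [:: 1; 2; 3; 4; 7; 8; 9]%N.

Lemma in_semigroup_sum a b c d :
  in_semigroup [:: 5; 6; 13; 14]%N (5 * a + 6 * b + 13 * c + 14 * d)%N.
Proof.
exists (fun i => nth 0 [:: a; b; c; d] i)%N.
by rewrite !big_ord_recl big_ord0 /=; lia.
Qed.

Lemma in_semigroupP n :
  reflect (in_semigroup [:: 5; 6; 13; 14]%N n) (n \notin gaps).
Proof.
apply: (iffP idP) => [|[c ->]]; last first.
  rewrite !big_ord_recl big_ord0 /= !inE.
  by move: (c _) (c _) (c _) (c _) => a1 a2 a3 a4; lia.
rewrite !inE => ngap.
have [q [r [nE r5]]] : exists q r, n = (5 * q + r)%N /\ (r < 5)%N.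
  by exists (n %/ 5)%N, (n %% 5)%N; lia.
(* The least elements of the semigroup in the classes 0, 1, 2, 3, 4 modulo 5 are 0, 6, 12, 13, 14;
   the rest of n is a multiple of 5. *)
case: r nE r5 => [|[|[|[|[|//]]]]] nE _.
- have -> : n = (5 * q + 6 * 0 + 13 * 0 + 14 * 0)%N by lia.
  exact: in_semigroup_sum.
- have -> : n = (5 * q.-1 + 6 * 1 + 13 * 0 + 14 * 0)%N by lia.
  exact: in_semigroup_sum.
- have -> : n = (5 * q.-2 + 6 * 2 + 13 * 0 + 14 * 0)%N by lia.
  exact: in_semigroup_sum.
- have -> : n = (5 * q.-2 + 6 * 0 + 13 * 1 + 14 * 0)%N by lia.
  exact: in_semigroup_sum.
- have -> : n = (5 * q.-2 + 6 * 0 + 13 * 0 + 14 * 1)%N by lia.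
  exact: in_semigroup_sum.
Qed.

(* The interface of k[[t^5, t^6, t^13, t^14]]: a domain embedded by ser onto the
   series whose support avoids the gaps. Reasoning through it keeps the ring
   operations of the subtype sgring folded. *)
Record model (k : fieldType) := Model {
  carrier :> idomainType;
  ser : {rmorphism carrier -> series k};
  ser_inj : injective ser;
  ser_gap : forall f n, n \in gaps -> coefs (ser f) n = 0;
  unser : series k -> carrier;
  unserK : forall h, (forall n, n \in gaps -> coefs h n = 0) ->
    ser (unser h) = h;
  gx : carrier; ser_x : ser gx = serX k ^+ 5;
  gy : carrier; ser_y : ser gy = serX k ^+ 6;
  gz : carrier; ser_z : ser gz = serX k ^+ 13;
  gw : carrier; ser_w : ser gw = serX k ^+ 14
}.

Section TheRing.
Variables (k : fieldType) (R : model k).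
Local Notation x := (gx R).
Local Notation y := (gy R).
Local Notation z := (gz R).
Local Notation w := (gw R).
Local Notation cf f n := (coefs (ser R f) n).
Implicit Types (f g : R) (h : series k).

Lemma cf_eqP f g : (forall n, cf f n = cf g n) -> f = g.
Proof. by move=> fg; apply: ser_inj; apply: seriesP. Qed.

Lemma cfM f g n :
  cf (f * g) n = \sum_(i < n.+1) cf f i * cf g (n - i).
Proof. by rewrite rmorphM coefsM. Qed.
Lemma cfD f g n : cf (f + g) n = cf f n + cf g n.
Proof. by rewrite rmorphD. Qed.
Lemma cfB f g n : cf (f - g) n = cf f n - cf g n.
Proof. by rewrite rmorphB. Qed.
Lemma cf0 n : cf (0 : R) n = 0. Proof. by rewrite rmorph0. Qed.
Lemma cf1 n : cf (1 : R) n = (n == 0)%:R. Proof. by rewrite rmorph1. Qed.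

Definition scal c : R := unser R (serC c).

Lemma ser_scal c : ser R (scal c) = serC c.
Proof. by apply: unserK => -[|n]. Qed.
Lemma cfZ c f n : cf (scal c * f) n = c * cf f n.
Proof. by rewrite rmorphM ser_scal coefsCM. Qed.

Lemma ser_xx : ser R (x ^+ 2) = serX k ^+ 10.
Proof. by rewrite rmorphXn ser_x -exprM. Qed.
Lemma ser_xy : ser R (x * y) = serX k ^+ 11.
Proof. by rewrite rmorphM ser_x ser_y -exprD. Qed.
Lemma ser_yy : ser R (y ^+ 2) = serX k ^+ 12.
Proof. by rewrite rmorphXn ser_y -exprM. Qed.

Lemma cf_xM f n : cf (x * f) n = if (5 <= n)%N then cf f (n - 5) else 0.
Proof. by rewrite rmorphM ser_x coefsMXn. Qed.
Lemma cf_yM f n : cf (y * f) n = if (6 <= n)%N then cf f (n - 6) else 0.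
Proof. by rewrite rmorphM ser_y coefsMXn. Qed.
Lemma cf_zM f n : cf (z * f) n = if (13 <= n)%N then cf f (n - 13) else 0.
Proof. by rewrite rmorphM ser_z coefsMXn. Qed.
Lemma cf_wM f n : cf (w * f) n = if (14 <= n)%N then cf f (n - 14) else 0.
Proof. by rewrite rmorphM ser_w coefsMXn. Qed.
Lemma cf_xxM f n : cf (x ^+ 2 * f) n = if (10 <= n)%N then cf f (n - 10) else 0.
Proof. by rewrite rmorphM ser_xx coefsMXn. Qed.
Lemma cf_xyM f n : cf (x * y * f) n = if (11 <= n)%N then cf f (n - 11) else 0.
Proof. by rewrite rmorphM ser_xy coefsMXn. Qed.
Lemma cf_yyM f n : cf (y ^+ 2 * f) n = if (12 <= n)%N then cf f (n - 12) else 0.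
Proof. by rewrite rmorphM ser_yy coefsMXn. Qed.

Lemma gens_rel : [/\ y ^+ 3 = x * z, y * z = x * w, y * w = x ^+ 4,
  z ^+ 2 = y ^+ 2 * w & z * w = x ^+ 3 * y ^+ 2 /\ w ^+ 2 = x ^+ 3 * z].
Proof.
have px n : ser R (x ^+ n) = serX k ^+ (5 * n) by rewrite rmorphXn ser_x -exprM.
have py n : ser R (y ^+ n) = serX k ^+ (6 * n) by rewrite rmorphXn ser_y -exprM.
pose E := (ser_x R, ser_y R, ser_z R, ser_w R).
split; [| | | |split]; apply: (@ser_inj _ R).
- by rewrite py rmorphM !E -exprD; congr (_ ^+ _).
- by rewrite !rmorphM !E -[LHS]exprD -[RHS]exprD; congr (_ ^+ _).
- by rewrite rmorphM px !E -exprD; congr (_ ^+ _).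
- by rewrite [z ^+ 2]expr2 [LHS]rmorphM [RHS]rmorphM py !E -[LHS]exprD -[RHS]exprD; congr (_ ^+ _).
- by rewrite [LHS]rmorphM [RHS]rmorphM px py !E -[LHS]exprD -[RHS]exprD; congr (_ ^+ _).
- by rewrite [w ^+ 2]expr2 [LHS]rmorphM [RHS]rmorphM px !E -[LHS]exprD -[RHS]exprD; congr (_ ^+ _).
Qed.

(** The inclusion of k[[x]] into R, with x = t^5. *)
Definition emb h : R := unser R (expand 5 h).

Lemma cf_emb h n : cf (emb h) n = if (5 %| n)%N then coefs h (n %/ 5) else 0.
Proof.
rewrite unserK // => {}n; rewrite !inE /=.
by case: ifP => // /dvdnP[q ->]; lia.
Qed.

Definition slice e f : series k := Series (fun i => cf f (5 * i + e)).

Lemma coefs_slice e f i : coefs (slice e f) i = cf f (5 * i + e).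
Proof. by []. Qed.

(** R is free over k[[x]] on 1, y, y^2, z, w, since their exponents are the least elements of the
    semigroup in the five classes modulo 5. *)
Lemma decompose f : f = emb (slice 0 f) + y * emb (slice 6 f) +
  y ^+ 2 * emb (slice 12 f) + z * emb (slice 13 f) + w * emb (slice 14 f).
Proof.
apply: cf_eqP => n; rewrite !cfD cf_yyM cf_yM cf_zM cf_wM !cf_emb !coefs_slice.
have ifE (e : nat) : (if (e <= n)%N then
    if (5 %| n - e)%N then cf f (5 * ((n - e) %/ 5) + e) else 0 else 0) =
  if (e <= n)%N && (n %% 5 == e %% 5)%N then cf f n else 0.
  case: leqP => //= en; rewrite (eqn_mod_dvd _ en); case: ifP => // d5.
  by rewrite mulnC divnK // subnK.
have {ifE} := (ifE 0, ifE 6, ifE 12, ifE 13, ifE 14); rewrite subn0 leq0n.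
case=> [[[[-> ->] ->] ->] ->]; rewrite /=.
have [ng|] := boolP (n \in gaps).
  by rewrite (ser_gap _ ng) !if_same !addr0.
rewrite !inE => ng.
have : (n %% 5 < 5)%N by rewrite ltn_pmod.
have : (n = 5 * (n %/ 5) + n %% 5)%N by lia.
by case: (n %% 5)%N => [|[|[|[|[|//]]]]] nE _ /=;
   rewrite ?andbF ?andbT ?(addr0, add0r) //; case: leqP => //; lia.
Qed.

Lemma emb_shift h : coefs h 0 = 0 -> emb h = x * emb (shift 1 h).
Proof.
move=> h0; apply: cf_eqP => n; rewrite cf_xM !cf_emb.
have [n5|n5] := ltnP n 5.
  by case: ifP => // /dvdnP[q nE]; rewrite (_ : n %/ 5 = 0)%N //; lia.
rewrite dvdn_subl //; case: ifP => // /dvdnP[q nE].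
by rewrite [RHS]/(coefs h _); congr coefs; lia.
Qed.

End TheRing.

(** * Membership in m, I and the conductor ideal by coefficients *)

Section Ideals.
Variables (k : fieldType) (R : model k).
Local Notation x := (gx R).
Local Notation y := (gy R).
Local Notation z := (gz R).
Local Notation w := (gw R).
Local Notation cf f n := (coefs (ser R f) n).
Local Notation m := (ideal [:: x; y; z; w]).
Local Notation I := (ideal [:: x ^+ 2; x * y; y ^+ 2]).
Local Notation C := (ideal [:: x ^+ 2; x * y; y ^+ 2; z; w]).
Implicit Types (f : R) (h : series k).

Definition high h : R := unser R (serX k ^+ 10 * h).

Lemma ser_high h : ser R (high h) = serX k ^+ 10 * h.
Proof.
by apply: unserK => n; rewrite !inE coefsMXn; case: leqP => //; lia.
Qed.

Lemma cf_high h n : cf (high h) n = if (10 <= n)%N then coefs h (n - 10) else 0.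
Proof. by rewrite ser_high coefsMXn. Qed.

Lemma ideal_mulr (A : {pred R}) a f : f \in ideal A -> a * f \in ideal A.
Proof. exact: (@rpredZ _ _ (ideal A)). Qed.
Lemma ideal_mull (A : {pred R}) a f : f \in ideal A -> f * a \in ideal A.
Proof. by rewrite mulrC; apply: ideal_mulr. Qed.
Lemma ideal_addr (A : {pred R}) f g :
  f \in ideal A -> g \in ideal A -> f + g \in ideal A.
Proof. exact: (@rpredD _ (ideal A)). Qed.

Lemma mem_m f : (f \in m) = (cf f 0 == 0).
Proof.
apply/idP/eqP => [|f0].
  elim/linspan_ind: f / => [|a u v]; [exact: cf0|]; rewrite !inE => uA v0.
  rewrite cfD v0 addr0 [a *: u](@mulrC R).
  by case/or4P: uA => /eqP ->; rewrite ?cf_xM ?cf_yM ?cf_zM ?cf_wM.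
rewrite (decompose f) emb_shift ?coefs_slice //.
by do ?apply: ideal_addr; apply: ideal_mull; rewrite ?expr2;
  do ?[apply: ideal_mull]; apply: mem_linspan; rewrite !inE eqxx ?orbT.
Qed.

Lemma gx_in_m : x \in m.
Proof. by apply: mem_linspan; rewrite !inE eqxx. Qed.

Lemma mem_C f :
  f \in C <-> forall n, (n < 10)%N -> cf f n = 0.
Proof.
split=> [|f0].
  elim/linspan_ind: f / => [n _|a u v]; [exact: cf0|]; rewrite !inE => uA v0 n n10.
  rewrite cfD v0 // addr0 [a *: u](@mulrC R).
  case/or4P: uA => [||| /orP[]] /eqP ->;
    rewrite ?cf_xxM ?cf_xyM ?cf_yyM ?cf_zM ?cf_wM; case: leqP => //; lia.
rewrite (decompose f) emb_shift ?coefs_slice ?f0 //.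
rewrite emb_shift ?coefs_shift ?coefs_slice ?f0 // [emb _ (slice 6 f)]emb_shift ?coefs_slice ?f0 //.
rewrite !mulrA -expr2 [y * x]mulrC.
by do ?apply: ideal_addr; apply: ideal_mull;
  apply: mem_linspan; rewrite !inE eqxx ?orbT.
Qed.

(** Each vanishing coefficient allows one more factor x to be pulled out of a coordinate over
    k[[x]]. Without t^13, t^14 and t^19 only multiples of z x = y^3 and w x^2 = y^4 remain in the
    last two coordinates, and these are in I. *)
Lemma mem_I f : f \in I <->
  (forall n, (n < 10)%N || (n \in [:: 13; 14; 19]%N) -> cf f n = 0).
Proof.
split=> [|f0].
  elim/linspan_ind: f / => [n _|a u v]; [exact: cf0|]; rewrite !inE => uA v0 n n10.
  rewrite cfD v0 // addr0 [a *: u](@mulrC R).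
  case/or3P: uA => /eqP ->; rewrite ?cf_xxM ?cf_xyM ?cf_yyM;
    case: leqP => // le; apply: ser_gap; move: n10; rewrite !inE; lia.
rewrite (decompose f) emb_shift ?coefs_slice ?f0 //.
rewrite emb_shift ?coefs_shift ?coefs_slice ?f0 // [emb _ (slice 6 f)]emb_shift ?coefs_slice ?f0 //.
rewrite [emb _ (slice 13 f)]emb_shift ?coefs_slice ?f0 //.
rewrite [emb _ (slice 14 f)]emb_shift ?coefs_slice ?f0 //.
rewrite [emb _ (shift 1 (slice 14 f))]emb_shift ?coefs_shift ?coefs_slice ?f0 //.
have [yyy yz _ _ _] := gens_rel R.
have zx : z * x = y ^+ 2 * y by rewrite mulrC -yyy exprSr.
have wxx : w * x * x = y ^+ 2 * y ^+ 2.
  by rewrite [w * x]mulrC -yz -mulrA zx expr2; ring.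
rewrite [z * _]mulrA zx [w * _]mulrA [w * x * _]mulrA wxx.
move: (emb R _) (emb R _) (emb R _) (emb R _) (emb R _) => e d c b a.
have -> : x * (x * a) + y * (x * b) + y ^+ 2 * c + y ^+ 2 * y * d +
    y ^+ 2 * y ^+ 2 * e =
    x ^+ 2 * a + x * y * b + y ^+ 2 * (c + y * d + y ^+ 2 * e) by ring.
by do ?apply: ideal_addr; apply: ideal_mull;
  apply: mem_linspan; rewrite !inE eqxx ?orbT.
Qed.

End Ideals.

(** * Free covers and Ext *)

Section LinearMaps.
Variables (R : nzRingType) (U V : lmodType R) (f : U -> V).

Fact linear_key : unit. Proof. exact: tt. Qed.
(** Locked, so that conversion never unfolds the packed map; [mk_linearE] is the way in. *)
Definition mk_linear (lin_f : linear f) : {linear U -> V} :=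
  locked_with linear_key
    (HB.pack f (GRing.isLinear.Build R U V *:%R f lin_f) : {linear U -> V}).

Lemma mk_linearE (lin_f : linear f) u : mk_linear lin_f u = f u.
Proof. by rewrite /mk_linear unlock. Qed.

End LinearMaps.

Section LinearCombination.
Variables (R : comNzRingType) (U V : lmodType R) (f g : U -> V).

Lemma linear_add : linear f -> linear g -> linear (fun u => f u + g u).
Proof. by move=> lf lg a u v; rewrite lf lg scalerDr addrACA. Qed.

Lemma linear_scale b : linear f -> linear (fun u => b *: f u).
Proof. by move=> lf a u v; rewrite lf scalerDr !scalerA mulrC. Qed.

Lemma linear_scalel (b : U -> R^o) (v : V) :
  linear b -> linear (fun u => (b u : R) *: v).
Proof. by move=> lb a u u'; rewrite lb scalerDl -scalerA. Qed.

End LinearCombination.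

Section FreeLift.
Variables (R : nzRingType) (M : lmodType R).

Definition fgen (u : M) : free_cover M := << u >>.

Lemma fgenZ c (u : M) : << c *g u >> = c *: fgen u.
Proof.
by apply/eqP/freeg_eqP => v; rewrite coeffZ !coeffU mul1r.
Qed.

Lemma augment_fgen u : augment (fgen u) = u.
Proof. by rewrite /augment liftU scale1r. Qed.

Lemma free_cover_eq (N : lmodType R) (f g : {linear free_cover M -> N}) :
  (forall u, f (fgen u) = g (fgen u)) -> f =1 g.
Proof.
move=> fg D; rewrite -[D]freeg_sumE !linear_sum; apply: eq_bigr => u _.
by rewrite fgenZ !linearZ fg.
Qed.

Section Lift.
Variables (N : lmodType R) (phi : M -> N).

Definition flift_fun : free_cover M -> N := @fglift R N M phi.

Fact flift_linear : linear flift_fun.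
Proof.
move=> a D E.
have addA : additive flift_fun by exact: lift_is_additive.
pose aug : {additive {freeg M / R} -> N} := HB.pack flift_fun
  (GRing.isZmodMorphism.Build {freeg M / R} N flift_fun addA).
have -> : flift_fun = aug by [].
rewrite raddfD; congr (_ + _).
rewrite [a *: D]/(fgscale a D) /fgscale raddf_sum.
have -> : aug D = \sum_(x <- dom D) aug << coeff x D *g x >>.
  by rewrite -raddf_sum freeg_sumE.
rewrite scaler_sumr; apply: eq_bigr => x _.
by rewrite /aug /= /flift_fun !liftU scalerA.
Qed.

Definition flift := mk_linear flift_linear.

Lemma flift_fgen u : flift (fgen u) = phi u.
Proof. by rewrite mk_linearE /flift_fun liftU scale1r. Qed.

End Lift.

Lemma free_cover_projective (N P : lmodType R) (f : {linear free_cover M -> N})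
    (p : {linear P -> N}) :
  (forall u, exists v, p v = f (fgen u)) ->
  exists g : {linear free_cover M -> P}, forall e, p (g e) = f e.
Proof.
move=> p_surj; have [s sE] := choice p_surj.
exists (flift s) => e.
rewrite -[LHS]/((p \o flift s) e).
by apply: free_cover_eq => u; rewrite /= flift_fgen.
Qed.

End FreeLift.

Section QuotientModule.
Variables (R : nzRingType) (V : lmodType R) (S : submodClosed V).

Lemma quot_proj0 : quot_proj S 0 = 0.
Proof. exact: (raddf0 (\pi_(Quotient.quot (quot_pred S)))). Qed.

Lemma quot_proj_eq u v : quot_proj S u = quot_proj S v <-> u - v \in S.
Proof.
rewrite -[u - v \in S]/(u - v \in quot_pred S) Quotient.idealrBE.
by split=> [/eqP //|uv]; apply/eqP.
Qed.

Lemma quot_proj_eq0 u : quot_proj S u = 0 <-> u \in S.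
Proof. by rewrite -quot_proj0 quot_proj_eq subr0. Qed.

Lemma quot_proj_linear : linear (quot_proj S).
Proof.
by move=> a u v; rewrite quot_projD -quot_scale_proj.
Qed.

End QuotientModule.

Section Annihilator.
Variables (R : comNzRingType) (M : lmodType R).

Lemma augment_surj (N : lmodType R) (u : N) : exists e, augment e = u.
Proof. by exists (fgen u); rewrite augment_fgen. Qed.

Lemma resol_diffP (i : nat) (e : resol M i) :
  augment e = 0 -> exists d, e = resol_diff d.
Proof.
move=> e0; have eK : e \in kernel (@augment R (syzygy M i)) by apply/eqP.
by exists (fgen (Submod eK)); rewrite /resol_diff augment_fgen.
Qed.

(** A cocycle vanishes on the image of the differential, which is the kernel of [augment], so it
    descends along [augment]. The section [fgen] is not linear, but its composition with the cocycle
    is. *)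
Lemma cocycle_factor (N : lmodType R) (i : nat) (f : resol M i -> N) :
  f \in @cocycle R M N i ->
  exists h : {linear syzygy M i -> N}, forall e, f e = h (augment e).
Proof.
move=> /asboolP[f_lin f0].
have fE e e' : augment e = augment e' -> f e = f e'.
  move=> ee'; have [|d dE] := @resol_diffP i (e - e').
    by rewrite linearB /= ee' subrr.
  by rewrite -[e](subrK e') dE -[resol_diff d]scale1r f_lin f0 scaler0 add0r.
have h_lin : linear (fun u => f (fgen u)).
  move=> a u v; rewrite -f_lin; apply: fE.
  by rewrite linearP /= !augment_fgen.
exists (mk_linear h_lin) => e; rewrite mk_linearE.
by apply: fE; rewrite augment_fgen.
Qed.

Lemma ext_annihilated (N : lmodType R) (j : nat) (a : R) :
  (forall h : {linear syzygy M j.+1 -> N}, exists g : {linear resol M j -> N},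
     forall z, g (submod_val z) = a *: h z) ->
  forall e : Ext M N j.+1, a *: e = 0.
Proof.
move=> ext e; rewrite -[e]quot_projK; move: (repr _) => f.
have [h fE] := cocycle_factor (valP f); have [g gE] := ext h.
rewrite -[LHS]/(quot_scale _ _) quot_scale_proj.
apply/quot_proj_eq0; apply/asboolP; exists g => d.
rewrite [RHS]gE -fE.
by [].
Qed.

End Annihilator.

(** * Annihilation inherited by higher syzygies *)

Section Contracts.
Variables (R : comNzRingType) (a : R).
Local Notation syz Z := (submod (kernel (@augment R Z))).

(* Multiplication by a on the first syzygy module of Z factors through F_0. *)
Definition contracts (Z : lmodType R) : Prop :=
  exists theta : {linear free_cover Z -> syz Z},
    forall z : syz Z, theta (submod_val z) = a *: z.

(** If multiplication by a on the syzygies of Z factors as [augment \o s], then e |-> a e - s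
    (augment e) lands in the next syzygies, and on these it is multiplication by a because [augment]
    vanishes there. *)
Lemma contracts_syz (Z : lmodType R) : 
  (exists s : {linear syz Z -> free_cover (syz Z)},
    forall z, augment (s z) = a *: z) -> contracts (syz Z).
Proof.
move=> [s sE]; pose aug : {linear _ -> _} := @augment R (syz Z).
have dK (e : free_cover (syz Z)) : a *: e - s (augment e) \in kernel aug.
  by apply/eqP; rewrite linearB linearZ /= sE subrr.
have lin : linear (fun e => Submod (dK e)).
  move=> b u v; apply: val_inj => /=.
  rewrite (linearP aug) /= (linearP s) !scalerDr scalerN !scalerA (mulrC a).
  by rewrite opprD addrACA.
exists (mk_linear lin) => z; apply: val_inj; rewrite mk_linearE /=.
case: z => e eK /=; have /eqP -> : augment e == 0 by [].
by rewrite linear0 subr0.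
Qed.

(** As F_0 is free, theta lifts to the free cover of the syzygies; the restriction of the lift to
    the syzygies factors multiplication by a through a free module. *)
Lemma contractsS (Z : lmodType R) : contracts Z -> contracts (syz Z).
Proof.
move=> [th thE]; apply: contracts_syz.
have [s sE] := free_cover_projective (f := th) (p := @augment R (syz Z))
  (fun u => augment_surj (th (fgen u))).
have lin : linear (fun z : syz Z => s (submod_val z)).
  by move=> b u v; rewrite -(linearP s).
by exists (mk_linear lin) => z; rewrite mk_linearE sE thE.
Qed.

Lemma contracts_syzygy (M : lmodType R) (j : nat) :
  contracts (syz M) -> contracts (syzygy M j.+1).
Proof. by move=> cM; elim: j => [//|j /contractsS]. Qed.

Lemma ext_contracts (M N : lmodType R) (j : nat) :
  contracts (syzygy M j) -> forall e : Ext M N j.+1, a *: e = 0.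
Proof.
move=> [th thE]; apply: ext_annihilated => h; exists (h \o th) => z.
by rewrite /= thE linearZ.
Qed.

End Contracts.

(** * Ext^i(I, R) is killed by m *)

Section ExtCanonical.
Variables (k : fieldType) (R : model k).
Local Notation x := (gx R).
Local Notation y := (gy R).
Local Notation z := (gz R).
Local Notation w := (gw R).
Local Notation cf f n := (coefs (ser R f) n).
Local Notation m := (ideal [:: x; y; z; w]).
Implicit Types (f g a p q r u v : R).

Lemma gx_neq0 : x != 0.
Proof.
apply/eqP => /(congr1 (fun f => cf f 5)) /eqP.
by rewrite ser_x coefs_Xn cf0 oner_eq0.
Qed.
Lemma gy_neq0 : y != 0.
Proof.
apply/eqP => /(congr1 (fun f => cf f 6)) /eqP.
by rewrite ser_y coefs_Xn cf0 oner_eq0.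
Qed.

(** Reduces the vanishing of a coefficient of a product to arithmetic of exponents, which [lia]
    decides for explicit P and Q. *)
Lemma cf_mul0 f g (P Q : pred nat) n :
  (forall i, P i -> cf f i = 0) -> (forall i, Q i -> cf g i = 0) ->
  (forall i, (i <= n)%N -> P i || Q (n - i)%N) -> cf (f * g) n = 0.
Proof.
move=> fP gQ PQ; rewrite cfM big1 // => i _.
by case/orP: (PQ i (ltn_ord i)) => [/fP|/gQ] ->; rewrite ?mul0r ?mulr0.
Qed.

Lemma div_x f : (forall n, (n < 5)%N || (n - 5 \in gaps)%N -> cf f n = 0) ->
  exists g, f = x * g.
Proof.
move=> f0; exists (unser R (shift 5 (ser R f))); apply: (@ser_inj _ R).
rewrite rmorphM ser_x unserK => [|n ng]; last first.
  by rewrite coefs_shift f0 // addnK ng orbT.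
by rewrite shiftK // => i i5; rewrite f0 ?i5.
Qed.

Lemma div_y f : (forall n, (n < 6)%N || (n - 6 \in gaps)%N -> cf f n = 0) ->
  exists g, f = y * g.
Proof.
move=> f0; exists (unser R (shift 6 (ser R f))); apply: (@ser_inj _ R).
rewrite rmorphM ser_y unserK => [|n ng]; last first.
  by rewrite coefs_shift f0 // addnK ng orbT.
by rewrite shiftK // => i i6; rewrite f0 ?i6.
Qed.

(** The exponents missing from m: the gaps together with 0. *)
Definition m_zeros : pred nat := fun i => (i < 5)%N || (7 <= i < 10)%N.

Lemma cf_m f : f \in m -> forall i, m_zeros i -> cf f i = 0.
Proof.
rewrite mem_m => /eqP f0 [|i] iz //.
by apply: ser_gap; move: iz; rewrite /m_zeros !inE; lia.
Qed.

Lemma rel_coef p q r : p * x ^+ 2 + q * (x * y) + r * y ^+ 2 = 0 ->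
  forall n, cf p n.+2 + cf q n.+1 + cf r n = 0.
Proof.
move=> /(congr1 (fun f => cf f _)) rel n; have {rel} := rel (n + 12)%N.
rewrite !cfD ![_ * x ^+ 2]mulrC [q * _]mulrC [r * _]mulrC.
rewrite cf_xxM cf_xyM cf_yyM cf0.
have [-> -> ->] : [/\ (10 <= n + 12)%N, (11 <= n + 12)%N & (12 <= n + 12)%N].
  by split; lia.
have -> : (n + 12 - 10 = n.+2)%N by lia.
have -> : (n + 12 - 11 = n.+1)%N by lia.
by have -> : (n + 12 - 12 = n)%N by lia.
Qed.

(* a (p, q, r) is a combination of the syzygies (-y, x, 0) and (0, y, -x) of
   (x^2, xy, y^2); the factor a is needed because only the ring k + t^5 k[[t]]
   expresses all syzygies by these two. *)
Lemma syzygy_coef a p q r : a \in m ->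
  p * x ^+ 2 + q * (x * y) + r * y ^+ 2 = 0 ->
  exists b1 b2, [/\ a * p = - (b1 * y), a * q = b1 * x + b2 * y &
                    a * r = - (b2 * x)].
Proof.
move=> am rel; have rc := rel_coef rel.
have gap0 f n : (n \in gaps) -> cf f n = 0 by apply: ser_gap.
(* Besides the gaps, r must vanish at 0 and 6, and p at 0, 5 and 10. In the relation the other two
   terms then sit at gaps, except for p at 0: there they lie below the orders of xy and y^2. *)
have r0 : cf r 0 = 0 by have := rc 0%N; rewrite (gap0 p) // (gap0 q) // !add0r.
have r6 : cf r 6 = 0 by have := rc 6%N; rewrite (gap0 p) // (gap0 q) // !add0r.

have p0 : cf p 0 = 0.
  move/(congr1 (fun f => cf f 10)): rel; rewrite !cfD ![_ * x ^+ 2]mulrC.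
  by rewrite [q * _]mulrC [r * _]mulrC cf_xxM cf_xyM cf_yyM cf0 !addr0.
have p_zero i : ((i < 6) || (7 <= i < 11))%N -> cf p i = 0.
  case: i => [|[|[|[|[|[|[|[|[|[|[|i]]]]]]]]]]] // _; do ?exact: gap0; last first.
  - by have := rc 8%N; rewrite (gap0 q) // (gap0 r) // !addr0.
  - by have := rc 3%N; rewrite (gap0 q) // (gap0 r) // !addr0.
have r_zero i : ((i < 5) || (6 <= i < 10))%N -> cf r i = 0.
  by case: i => [|[|[|[|[|[|[|[|[|[|i]]]]]]]]]] // _; exact: gap0.
have [b2 b2E] : exists b2, a * r = x * b2.
  apply: div_x => n n0; apply: (cf_mul0 (cf_m am) r_zero) => i le_in.
  by move: n0; rewrite /m_zeros !inE; lia.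
have [b1 b1E] : exists b1, a * p = y * b1.
  apply: div_y => n n0; apply: (cf_mul0 (cf_m am) p_zero) => i le_in.
  by move: n0; rewrite /m_zeros !inE; lia.
exists (- b1), (- b2); split.
- by rewrite b1E; ring.
- apply: (mulfI (mulf_neq0 gx_neq0 gy_neq0)).
  have -> : x * y * (a * q) = a * (p * x ^+ 2 + q * (x * y) + r * y ^+ 2)
     - (a * p) * x ^+ 2 - (a * r) * y ^+ 2 by ring.
  by rewrite rel b1E b2E; ring.
- by rewrite b2E; ring.
Qed.

(** The equations say that (p, q, r) |-> al p + be q + ga r takes the syzygies (-y, x, 0) and (0, y,
    -x) to a u and a v. *)
Lemma syzygy_extension a u v : a \in m -> u \in m -> v \in m ->
  exists al be ga, x * be = a * u + al * y /\ x * ga = be * y - a * v.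
Proof.
move=> am um vm.
(* Products of two elements of m have exponents 10, 11, 12 and at least 15, so division by x leaves
   R only through t^12 / x = t^7. The y-term of [al] clears this coefficient for [be], the x-term
   clears it for [ga]. *)
pose al := scal R (cf (a * v) 12 - cf (a * u) 11) * x - scal R (cf (a * u) 12) * y.
have low b f n : b \in m -> f \in m ->
    ((n < 10) || (12 < n < 15))%N -> cf (b * f) n = 0.
  move=> bm fm nz; apply: (cf_mul0 (cf_m bm) (cf_m fm)) => i le_in.
  by move: nz; rewrite /m_zeros; lia.
have alE n : cf (al * y) n = (cf (a * v) 12 - cf (a * u) 11) * (n == 11)%:R
    - cf (a * u) 12 * (n == 12)%:R.
  rewrite mulrBl cfB -!mulrA !cfZ ser_xy coefs_Xn.
  by rewrite -expr2 ser_yy coefs_Xn.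
have [be beE] : exists be, a * u + al * y = x * be.
  apply: div_x => n n0; rewrite cfD alE.
  have [->|n12] := eqVneq n 12%N; first by rewrite mulr0 mulr1 add0r subrr.
  rewrite low //; last by move: n0 n12; rewrite !inE; lia.
  have [n11|_] := eqVneq n 11%N; first by move: n0; rewrite n11.
  by rewrite !mulr0 subr0 addr0.
have beyE n : (6 <= n)%N -> cf (be * y) n = cf (a * u + al * y) n.-1.
  move=> n6; rewrite beE mulrC cf_yM n6 cf_xM ifT; last by lia.
  by congr (cf _ _); lia.
have [ga gaE] : exists ga, be * y - a * v = x * ga.
  apply: div_x => n n0; rewrite cfB.
  have [n6|n6] := ltnP n 6.
    rewrite (low a v) //; last by lia.
    by rewrite subr0 mulrC cf_yM ifF //; lia.
  have [e11 e12] : (n.-1 == 11)%N = (n == 12)%N /\ (n.-1 == 12)%N = (n == 13)%N.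
    by split; lia.
  rewrite beyE // cfD alE e11 e12.
  have [->|n12] := eqVneq n 12%N.
    rewrite (_ : (12 == 13)%N = false) // mulr0 mulr1 subr0.
    by rewrite [_ + (_ - _)]addrC subrK subrr.
  rewrite (low a v n) //; last by move: n0 n12; rewrite !inE; lia.
  have [->|n13] := eqVneq n 13%N; first by rewrite mulr0 mulr1 add0r subrr subr0.
  rewrite (low a u n.-1) //; last by move: n0 n12 n13; rewrite !inE; lia.
  by rewrite !mulr0 !subr0 addr0.
by exists al, be, ga.
Qed.

(** Evaluation at a (p, q, r) gives a times this identity. Cancelling x^2 instead of a covers a = 0
    as well. *)
Lemma syzygy_eval a u v p q r al be ga b1 b2 :
  x * be = a * u + al * y -> x * ga = be * y - a * v ->
  p * x ^+ 2 + q * (x * y) + r * y ^+ 2 = 0 ->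
  a * p = - (b1 * y) -> a * q = b1 * x + b2 * y -> a * r = - (b2 * x) ->
  al * p + be * q + ga * r = b1 * u + b2 * v.
Proof.
move=> beE gaE rel ap aq ar; apply: (mulfI (mulf_neq0 gx_neq0 gx_neq0)).
have -> : x * x * (al * p + be * q + ga * r) =
  al * p * x ^+ 2 + (x * be) * q * x + x * r * (x * ga) by ring.
rewrite gaE mulrBr [x * r * (be * y)](_ : _ = (x * be) * r * y); last by ring.
rewrite beE.
have -> : al * p * x ^+ 2 + (a * u + al * y) * q * x +
    ((a * u + al * y) * r * y - x * r * (a * v)) =
  al * (p * x ^+ 2 + q * (x * y) + r * y ^+ 2) + (a * q) * u * x
    + (a * r) * u * y - (a * r) * x * v by ring.
by rewrite rel aq ar; ring.
Qed.

End ExtCanonical.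

(** * Syzygies of a module with three generators in the standard cover *)

Section ThreeGenerators.
Variables (R : comNzRingType) (M : lmodType R) (e1 e2 e3 : M).
Hypothesis gen_e : forall u : M, exists pqr : R * R * R,
  u = pqr.1.1 *: e1 + pqr.1.2 *: e2 + pqr.2 *: e3.
Local Notation F0 := (free_cover M).
Local Notation Z1 := (submod (kernel (@augment R M))).
Implicit Types (a p q r : R) (s : Z1).

Definition coordinates : M -> R * R * R := projT1 (choice gen_e).
Lemma coordinatesE u : u = (coordinates u).1.1 *: e1 +
  (coordinates u).1.2 *: e2 + (coordinates u).2 *: e3.
Proof. exact: projT2 (choice gen_e) u. Qed.

Definition tau1 : {linear F0 -> R^o} := flift (fun u => (coordinates u).1.1 : R^o).
Definition tau2 : {linear F0 -> R^o} := flift (fun u => (coordinates u).1.2 : R^o).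
Definition tau3 : {linear F0 -> R^o} := flift (fun u => (coordinates u).2 : R^o).
Definition sigma p q r : F0 := p *: fgen e1 + q *: fgen e2 + r *: fgen e3.

Lemma augment_sigma p q r :
  augment (sigma p q r) = p *: e1 + q *: e2 + r *: e3.
Proof. by rewrite /sigma !linearD !linearZ /= !augment_fgen. Qed.

Lemma sigma_linear b p q r p' q' r' :
  sigma (b * p + p') (b * q + q') (b * r + r') = b *: sigma p q r + sigma p' q' r'.
Proof.
rewrite /sigma !scalerDl -!scalerA !scalerDr -!addrA; congr (_ + _).
by rewrite addrCA; congr (_ + _); rewrite [RHS]addrCA; congr (_ + _);
  rewrite [RHS]addrCA.
Qed.

Lemma sigmaZ b p q r : sigma (b * p) (b * q) (b * r) = b *: sigma p q r.
Proof. by rewrite /sigma !scalerDr !scalerA. Qed.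

Lemma sigma_syz p q r : p *: e1 + q *: e2 + r *: e3 = 0 ->
  sigma p q r \in kernel (@augment R M).
Proof. by move=> rel; apply/eqP; rewrite [LHS]augment_sigma. Qed.

Lemma augment_tau e :
  tau1 e *: e1 + tau2 e *: e2 + tau3 e *: e3 = augment e.
Proof.
rewrite -augment_sigma.
have lin : linear (fun e => augment (sigma (tau1 e) (tau2 e) (tau3 e))).
  move=> b f1 f2; rewrite (linearP tau1) (linearP tau2) (linearP tau3).
  by rewrite sigma_linear linearP.
rewrite -[LHS](mk_linearE lin); apply: free_cover_eq => u.
rewrite mk_linearE /= augment_fgen augment_sigma.
by rewrite /tau1 /tau2 /tau3 !flift_fgen -coordinatesE.
Qed.

Lemma augment_syz s : augment (val s) = 0.
Proof. by apply/eqP; case: s. Qed.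

Fact rho_sub e : e - sigma (tau1 e) (tau2 e) (tau3 e) \in kernel (@augment R M).
Proof. by apply/eqP; rewrite linearB /= augment_sigma augment_tau subrr. Qed.

Fact rho_linear : linear (fun e => Submod (rho_sub e) : Z1).
Proof.
move=> b f1 f2; apply: val_inj => /=.
rewrite (linearP tau1) (linearP tau2) (linearP tau3) sigma_linear.
by rewrite scalerBr opprD addrACA.
Qed.

(** The error made when a formal combination of elements of M is rewritten over e1, e2, e3. A syzygy
    is its [rho] plus a relation among the three generators, and the [rho] part is defined on all of
    F_0. *)
Definition rho : {linear F0 -> Z1} := mk_linear rho_linear.

Lemma rhoE e : val (rho e) = e - sigma (tau1 e) (tau2 e) (tau3 e).
Proof. by rewrite /rho mk_linearE. Qed.

Lemma tau_syz s : tau1 (val s) *: e1 + tau2 (val s) *: e2 + tau3 (val s) *: e3 = 0.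
Proof. by rewrite augment_tau augment_syz. Qed.

Variables (a : R) (s1 s2 : Z1) (b1 b2 : {linear Z1 -> R^o}).
Hypothesis bE : forall s,
  a *: sigma (tau1 (val s)) (tau2 (val s)) (tau3 (val s)) =
  b1 s *: val s1 + b2 s *: val s2.

Lemma syz_decompose s : a *: s = a *: rho (val s) + (b1 s *: s1 + b2 s *: s2).
Proof.
apply: val_inj; rewrite [val (a *: s)]linearZ [RHS]linearD !linearD !linearZ /=.
by rewrite -bE -scalerDr -[submod_val (rho _)]/(val (rho _)) rhoE subrK.
Qed.

(** Both summands of a s pass through free modules: the first through F_0 by [rho], the second
    through the generators on [s1] and [s2]. *)
Lemma contracts_three : contracts a Z1.
Proof.
apply: contracts_syz.
have [l lE] := free_cover_projective (f := rho) (p := @augment R Z1)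
  (fun u => augment_surj (rho (fgen u))).
have lin : linear (fun s => a *: l (val s) + (b1 s *: fgen s1 + b2 s *: fgen s2)).
  apply: linear_add; last by apply: linear_add; apply: linear_scalel; apply: linearP.
  by apply: linear_scale => c u v; rewrite !linearP.
exists (mk_linear lin) => s; rewrite mk_linearE [RHS]syz_decompose.
by rewrite !linearD !linearZ /= lE !augment_fgen.
Qed.

Lemma extend_three (h : {linear Z1 -> R^o}) (al be ga : R) :
  (forall s, al * tau1 (val s) + be * tau2 (val s) + ga * tau3 (val s) =
     b1 s * h s1 + b2 s * h s2) ->
  exists g : {linear F0 -> R^o}, forall s, g (val s) = a *: h s.
Proof.
move=> ext.
have lin : linear (fun e : F0 => a * h (rho e) +
    (al * tau1 e + be * tau2 e + ga * tau3 e) : R^o).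
  apply: linear_add.
    by apply: (@linear_scale R F0 R^o) => c u v; rewrite !linearP.
  by apply: linear_add; [apply: linear_add|];
    apply: (@linear_scale R F0 R^o); apply: linearP.
exists (mk_linear lin) => s; rewrite mk_linearE ext.
transitivity (h (a *: s)); last by rewrite linearZ.
by rewrite syz_decompose !linearD !linearZ.
Qed.

End ThreeGenerators.

Section ExtThree.
Variables (k : fieldType) (R : model k).
Local Notation x := (gx R).
Local Notation y := (gy R).
Local Notation z := (gz R).
Local Notation w := (gw R).
Local Notation cf f n := (coefs (ser R f) n).
Local Notation m := (ideal [:: x; y; z; w]).
Variables (M : lmodType R) (e1 e2 e3 : M).
Hypothesis gen_e : forall u : M, exists pqr : R * R * R,
  u = pqr.1.1 *: e1 + pqr.1.2 *: e2 + pqr.2 *: e3.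
Hypothesis rel_e : forall p q r, p *: e1 + q *: e2 + r *: e3 = 0 <->
  p * x ^+ 2 + q * (x * y) + r * y ^+ 2 = 0.
Local Notation F0 := (free_cover M).
Local Notation Z1 := (submod (kernel (@augment R M))).
Implicit Types (p q r : R).

Local Notation sig := (sigma e1 e2 e3).
Local Notation t1 := (tau1 gen_e).
Local Notation t2 := (tau2 gen_e).
Local Notation t3 := (tau3 gen_e).

Lemma rel1 : - y * x ^+ 2 + x * (x * y) + 0 * y ^+ 2 = 0. Proof. by ring. Qed.
Lemma rel2 : 0 * x ^+ 2 + y * (x * y) + - x * y ^+ 2 = 0. Proof. by ring. Qed.
Definition syz1 : Z1 := Submod (sigma_syz ((rel_e _ _ _).2 rel1)).
Definition syz2 : Z1 := Submod (sigma_syz ((rel_e _ _ _).2 rel2)).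

Lemma tau_rel (s : Z1) :
  t1 (val s) * x ^+ 2 + t2 (val s) * (x * y) + t3 (val s) * y ^+ 2 = 0.
Proof. by apply/rel_e; apply: tau_syz. Qed.

Section Fixed.
Variable a : R.
Hypothesis am : a \in m.

Lemma ex_syz_coef (s : Z1) : exists b : R * R,
  [/\ a * t1 (val s) = - (b.1 * y), a * t2 (val s) = b.1 * x + b.2 * y &
      a * t3 (val s) = - (b.2 * x)].
Proof. by have [b1 [b2 bE]] := syzygy_coef am (tau_rel s); exists (b1, b2). Qed.

Definition syz_coef : Z1 -> R * R := projT1 (choice ex_syz_coef).
Lemma syz_coefE s : [/\ a * t1 (val s) = - ((syz_coef s).1 * y),
   a * t2 (val s) = (syz_coef s).1 * x + (syz_coef s).2 * y &
   a * t3 (val s) = - ((syz_coef s).2 * x)].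
Proof. exact: projT2 (choice ex_syz_coef) s. Qed.

(** The coefficients were chosen pointwise, but they are unique because y can be cancelled; hence
    they are linear in s. *)
Fact syz_coef1_linear : linear (fun s => (syz_coef s).1 : R^o).
Proof.
move=> c u v; apply: (mulIf (gy_neq0 R)); apply: oppr_inj.
have [<- _ _] := syz_coefE (c *: u + v).
have [uE _ _] := syz_coefE u; have [vE _ _] := syz_coefE v.
rewrite (linearP (val : Z1 -> F0)) (linearP t1).
transitivity (c * (a * t1 (val u)) + a * t1 (val v)).
  by rewrite mulrDr mulrCA.
by rewrite uE vE mulrDl opprD -mulrA mulrN.
Qed.

Fact syz_coef2_linear : linear (fun s => (syz_coef s).2 : R^o).
Proof.
move=> c u v; apply: (mulIf (gx_neq0 R)); apply: oppr_inj.
have [_ _ <-] := syz_coefE (c *: u + v).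
have [_ _ uE] := syz_coefE u; have [_ _ vE] := syz_coefE v.
rewrite (linearP (val : Z1 -> F0)) (linearP t3).
transitivity (c * (a * t3 (val u)) + a * t3 (val v)).
  by rewrite mulrDr mulrCA.
by rewrite uE vE mulrDl opprD -mulrA mulrN.
Qed.

Definition sc1 : {linear Z1 -> R^o} := mk_linear syz_coef1_linear.
Definition sc2 : {linear Z1 -> R^o} := mk_linear syz_coef2_linear.

Lemma sc1E s : sc1 s = (syz_coef s).1. Proof. exact: mk_linearE. Qed.
Lemma sc2E s : sc2 s = (syz_coef s).2. Proof. exact: mk_linearE. Qed.

Lemma sc_sigma (s : Z1) : a *: sig (t1 (val s)) (t2 (val s)) (t3 (val s)) =
  sc1 s *: val syz1 + sc2 s *: val syz2.
Proof.
transitivity (sig (a * t1 (val s)) (a * t2 (val s)) (a * t3 (val s))).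
  by rewrite sigmaZ.
have [-> -> ->] := syz_coefE s; rewrite sc1E sc2E.
rewrite -[val syz1]/(sig (- y) x 0) -[val syz2]/(sig 0 y (- x)).
rewrite -[_ *: sig 0 _ _]sigmaZ -sigma_linear.
by rewrite !mulrN !mulr0 addr0 add0r.
Qed.

(* In exponents: t^7 maps syz1 and syz2 into the first syzygy module, so it
   multiplies their images under h into R, which forces these into m. *)
Lemma hom_syz_m (h : {linear Z1 -> R^o}) : h syz1 \in m /\ h syz2 \in m.
Proof.
have [yyy yz yw zz [zw ww]] := gens_rel R.
have r1 : - z * x ^+ 2 + y ^+ 2 * (x * y) + 0 * y ^+ 2 = 0.
  transitivity (x * (y ^+ 3 - x * z)); first by ring.
  by rewrite yyy subrr mulr0.
have r2 : 0 * x ^+ 2 + z * (x * y) + - y ^+ 2 * y ^+ 2 = 0.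
  transitivity (y * (x * z - y ^+ 3)); first by ring.
  by rewrite yyy subrr mulr0.
have key (s s' : Z1) : y ^+ 2 *: s = x *: s' -> h s \in m.
  move=> /(congr1 h); rewrite !linearZ => ss'.
  have {}ss' : y ^+ 2 * h s = x * h s' by [].
  (* At t^12 this compares the constant term of h s with the coefficient of h s' at the gap 7. *)
  move/(congr1 (fun f => cf f 12)): ss'; rewrite cf_yyM cf_xM /= => e.
  by rewrite mem_m e; apply/eqP; apply: ser_gap.
split.
  apply: (key syz1 (Submod (sigma_syz ((rel_e _ _ _).2 r1)))); apply: val_inj.
  rewrite /= -!sigmaZ; congr (sig _ _ _); [|by ring|by ring].
  by transitivity (- y ^+ 3); [ring|rewrite yyy; ring].
apply: (key syz2 (Submod (sigma_syz ((rel_e _ _ _).2 r2)))); apply: val_inj.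
rewrite /= -!sigmaZ; congr (sig _ _ _); [by ring| |by ring].
by rewrite -yyy; ring.
Qed.

Lemma ext1_extension (h : {linear Z1 -> R^o}) :
  exists g : {linear F0 -> R^o}, forall s : Z1, g (val s) = a *: h s.
Proof.
have [h1 h2] := hom_syz_m h.
have [al [be [ga [beE gaE]]]] := syzygy_extension am h1 h2.
apply: (extend_three sc_sigma (al := al) (be := be) (ga := ga)) => s.
rewrite sc1E sc2E; have [p1 p2 p3] := syz_coefE s.
exact: (syzygy_eval beE gaE (tau_rel s) p1 p2 p3).
Qed.

End Fixed.

Lemma ext_three_annihilated i a : (0 < i)%N -> a \in m ->
  forall e : Ext M R^o i, a *: e = 0.
Proof.
case: i => // i _ am; case: i => [|i].
  by apply: ext_annihilated => h; apply: ext1_extension.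
apply: ext_contracts.
apply: contracts_syzygy.
exact: (contracts_three (sc_sigma am)).
Qed.

End ExtThree.

Section CanonicalIdeal.
Variables (k : fieldType) (R : model k).
Local Notation x := (gx R).
Local Notation y := (gy R).
Local Notation z := (gz R).
Local Notation w := (gw R).
Local Notation m := (ideal [:: x; y; z; w]).
Local Notation I := (ideal [:: x ^+ 2; x * y; y ^+ 2]).
Local Notation MI := (submod I).
Implicit Types (p q r : R).

Lemma mem_I_xx : x ^+ 2 \in I.
Proof. by apply: mem_linspan; rewrite !inE eqxx. Qed.
Lemma mem_I_xy : x * y \in I.
Proof. by apply: mem_linspan; rewrite !inE eqxx orbT. Qed.
Lemma mem_I_yy : y ^+ 2 \in I.
Proof. by apply: mem_linspan; rewrite !inE eqxx !orbT. Qed.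
Definition I_xx : MI := Submod mem_I_xx.
Definition I_xy : MI := Submod mem_I_xy.
Definition I_yy : MI := Submod mem_I_yy.

Lemma I_gen (u : MI) : exists pqr : R * R * R,
  u = pqr.1.1 *: I_xx + pqr.1.2 *: I_xy + pqr.2 *: I_yy.
Proof.
have [c uE] := linspan_seqP (valP u).
exists (c 0%N, c 1%N, c 2%N); apply: val_inj; rewrite uE.
by rewrite !big_ord_recl big_ord0 addr0 /= addrA.
Qed.

Lemma val_I p q r : val (p *: I_xx + q *: I_xy + r *: I_yy) =
  p * x ^+ 2 + q * (x * y) + r * y ^+ 2.
Proof. by []. Qed.

Lemma I_rel p q r : p *: I_xx + q *: I_xy + r *: I_yy = 0 <->
  p * x ^+ 2 + q * (x * y) + r * y ^+ 2 = 0.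
Proof.
rewrite -val_I; split=> [-> //|rel].
by apply: val_inj; rewrite rel.
Qed.

Theorem ext_I_annihilated i a : (0 < i)%N -> a \in m ->
  forall e : Ext MI R^o i, a *: e = 0.
Proof. exact: (ext_three_annihilated I_gen I_rel). Qed.

End CanonicalIdeal.

(** * Ext^1(k, I) is a line *)

Section ExtClass.
Variables (R : comNzRingType) (M N : lmodType R).
Local Notation Z1 := (submod (kernel (@augment R M))).
Local Notation F0 := (free_cover M).

Fact ext1_class_cocycle (h : {linear Z1 -> N}) :
  (fun e : resol M 1 => h (augment e)) \in @cocycle R M N 1.
Proof.
apply/asboolP; split=> [a u v|e]; first by rewrite linearP /= linearP.
by rewrite /resol_diff; case: (augment e) => d /= /eqP ->; rewrite linear0.
Qed.

Definition ext1_class (h : {linear Z1 -> N}) : Ext M N 1 :=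
  quot_proj _ (Submod (ext1_class_cocycle h)).

Lemma ext1_class_surj (e : Ext M N 1) : exists h, e = ext1_class h.
Proof.
rewrite -[e]quot_projK; move: (repr _) => f.
have [h fE] := cocycle_factor (valP f); exists h; congr quot_proj.
by apply: val_inj; apply: funext => d; rewrite [LHS]fE.
Qed.

Lemma ext1_class_eq0 h : ext1_class h = 0 <->
  exists g : {linear F0 -> N}, forall s : Z1, g (val s) = h s.
Proof.
rewrite /ext1_class; split=> [/quot_proj_eq0/asboolP[g gE]|[g gE]].
  exists g => s; rewrite -[s in RHS]augment_fgen.
  by rewrite [RHS]gE /resol_diff augment_fgen.
by apply/quot_proj_eq0/asboolP; exists g => d /=; rewrite -gE.
Qed.

Lemma ext1_classP a (h h1 h2 : {linear Z1 -> N}) : (forall s, h s = a *: h1 s + h2 s) ->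
  ext1_class h = a *: ext1_class h1 + ext1_class h2.
Proof.
move=> hE; rewrite /ext1_class -[_ *: _]/(quot_scale _ _) quot_scale_proj.
rewrite -quot_projD; congr quot_proj; apply: val_inj; apply: funext => e.
exact: hE.
Qed.

End ExtClass.

Section CyclicModule.
Variables (R : comNzRingType) (M : lmodType R) (pi : {linear R^o -> M}).
Hypothesis pi_surj : forall u, exists r : R, pi r = u.
Local Notation Z1 := (submod (kernel (@augment R M))).
Local Notation F0 := (free_cover M).
Implicit Types (r : R) (s : Z1).

Definition lift1 : M -> R := projT1 (choice pi_surj).
Lemma lift1K u : pi (lift1 u) = u. Proof. exact: projT2 (choice pi_surj) u. Qed.

Definition cyc_coef : {linear F0 -> R^o} := flift (lift1 : M -> R^o).
Definition cyc_gen : F0 := fgen (pi 1).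

Lemma pi_scale r : pi r = r *: pi 1.
Proof. by rewrite -linearZ; congr (pi _); rewrite [RHS]mulr1. Qed.

Lemma pi_coef e : pi (cyc_coef e) = augment e.
Proof.
rewrite -[LHS]/((pi \o cyc_coef) e); apply: free_cover_eq => u.
by rewrite /= /cyc_coef flift_fgen lift1K augment_fgen.
Qed.

Lemma coef_cyc_gen : cyc_coef cyc_gen = lift1 (pi 1).
Proof. exact: flift_fgen. Qed.

Fact cyc_rho_sub e : e - cyc_coef e *: cyc_gen \in kernel (@augment R M).
Proof.
by apply/eqP; rewrite linearB linearZ /= augment_fgen -pi_scale pi_coef subrr.
Qed.

Fact cyc_rho_linear : linear (fun e => Submod (cyc_rho_sub e) : Z1).
Proof.
move=> b f1 f2; apply: val_inj => /=.
rewrite (linearP cyc_coef) scalerDl -scalerA.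
by rewrite scalerBr opprD addrACA.
Qed.

Definition cyc_rho : {linear F0 -> Z1} := mk_linear cyc_rho_linear.

Lemma cyc_rhoE e : val (cyc_rho e) = e - cyc_coef e *: cyc_gen.
Proof. by rewrite /cyc_rho mk_linearE. Qed.

Fact cyc_syz_sub r : pi r = 0 -> r *: cyc_gen \in kernel (@augment R M).
Proof. by move=> r0; apply/eqP; rewrite linearZ /= augment_fgen -pi_scale. Qed.

Definition cyc_syz r (r0 : pi r = 0) : Z1 := Submod (cyc_syz_sub r0).

Lemma pi_coef_syz s : pi (cyc_coef (val s)) = 0.
Proof. by rewrite pi_coef; apply/eqP; case: s. Qed.

Lemma cyc_syzE s : s = cyc_rho (val s) + cyc_syz (pi_coef_syz s).
Proof.
apply: val_inj; rewrite [RHS]linearD /= -[submod_val (cyc_rho _)]/(val _).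
by rewrite cyc_rhoE subrK.
Qed.

End CyclicModule.

Section TypeOfI.
Variables (k : fieldType) (R : model k).
Local Notation x := (gx R).
Local Notation y := (gy R).
Local Notation z := (gz R).
Local Notation w := (gw R).
Local Notation cf f n := (coefs (ser R f) n).
Local Notation m := (ideal [:: x; y; z; w]).
Local Notation I := (ideal [:: x ^+ 2; x * y; y ^+ 2]).
Implicit Types (f a p q : R).

(* t^19 spans the socle of k((t)) / I. *)
Definition socle : R := high R (serX k ^+ 9).

Lemma cf_socle n : cf socle n = (n == 19)%:R.
Proof.
rewrite cf_high coefs_Xn; have [n10|n10] := ltnP n 10.
  by rewrite (_ : (n == 19)%N = false) //; lia.
by rewrite (_ : (n - 10 == 9)%N = (n == 19)%N) //; lia.
Qed.

Lemma socle_notin : socle \notin I.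
Proof.
apply/negP => /mem_I/(_ 19%N isT)/eqP.
by rewrite cf_socle oner_eq0.
Qed.

Lemma ser_socle : ser R socle = serX k ^+ 19.
Proof. by rewrite ser_high -exprD. Qed.

Lemma socle_m a : a \in m -> socle * a \in I.
Proof.
move=> am; apply/mem_I => n n0; rewrite rmorphM ser_socle coefsMXn.
case: leqP => // n19; apply: (cf_m am).
by move: n0; rewrite !inE /m_zeros; lia.
Qed.

Lemma sub_scal_m f : f - scal R (cf f 0) \in m.
Proof. by rewrite mem_m cfB ser_scal subrr. Qed.

Lemma scalV c : c != 0 -> scal R c^-1 * scal R c = 1.
Proof.
move=> c0; apply: (@ser_inj _ R).
by rewrite rmorphM !ser_scal rmorph1 -rmorphM mulVf // rmorph1.
Qed.

(** A homomorphism from m to I with values p, p1, p2, p3 at x, y, z, w is multiplication by p / x.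
    So the lemma computes (I : m) = I + k t^19 in the fraction field. *)
Lemma colon_I p p1 p2 p3 : p \in I -> p1 \in I -> p2 \in I -> p3 \in I ->
  y * p = x * p1 -> z * p = x * p2 -> w * p = x * p3 ->
  exists c i, i \in I /\ p = x * (scal R c * socle + i).
Proof.
move=> /mem_I pI /mem_I p1I /mem_I p2I /mem_I p3I yp zp wp.
have p_shift g n e : ser R g = serX k ^+ (e + 5) -> forall p', g * p = x * p' ->
    cf p' (n + e) = cf p n.
  move=> gE p' /(congr1 (fun f => cf f (n + e + 5))).
  rewrite rmorphM gE coefsMXn cf_xM ifT ?[in RHS]ifT; try lia.
  by move=> E; rewrite (_ : n + e = n + e + 5 - 5)%N -1?E; [congr coefs|]; lia.
(* Multiplication by y / x = t moves 12 and 18 to 13 and 19, z / x = t^8 moves 11 to 19, and w / x =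
   t^9 moves 10 to 19; the elements of I have no such exponents. *)
have p12 : cf p 12 = 0 by rewrite -(p_shift y 12%N 1%N _ _ yp) ?ser_y ?p1I.
have p18 : cf p 18 = 0 by rewrite -(p_shift y 18%N 1%N _ _ yp) ?ser_y ?p1I.
have p11 : cf p 11 = 0 by rewrite -(p_shift z 11%N 8%N _ _ zp) ?ser_z ?p2I.
have p10 : cf p 10 = 0 by rewrite -(p_shift w 10%N 9%N _ _ wp) ?ser_w ?p3I.
have [q qE] : exists q, p = x * q.
  apply: div_x => n n0; have [->//|n12] := eqVneq n 12%N.
  by apply: pI; move: n0 n12; rewrite !inE; lia.
have cf_q n : cf q n = cf p (n + 5).
  by rewrite qE cf_xM ifT ?addnK //; lia.
exists (cf q 19), (q - scal R (cf q 19) * socle); split; last first.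
  by rewrite addrCA subrr addr0.
apply/mem_I => n n0; rewrite cfB cfZ cf_socle.
have [->|n19] := eqVneq n 19%N; first by rewrite mulr1 subrr.
rewrite mulr0 subr0 cf_q.
have : ((n + 5 \in [:: 10; 11; 12; 18; 19]) || (n + 5 < 10) ||
   (n + 5 \in [:: 13; 14]))%N by move: n0 n19; rewrite !inE; lia.
move: (n + 5)%N => j; rewrite !inE -!orbA.
case/or4P=> [/eqP->//|/eqP->//|/eqP->//|].
case/or4P=> [/eqP->//|/eqP->|lt|/orP[]/eqP->]; rewrite pI //.
by rewrite lt.
Qed.

End TypeOfI.

Section TypeOne.
Variables (k : fieldType) (R : model k).
Local Notation x := (gx R).
Local Notation y := (gy R).
Local Notation z := (gz R).
Local Notation w := (gw R).
Local Notation cf f n := (coefs (ser R f) n).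
Local Notation m := (ideal [:: x; y; z; w]).
Local Notation I := (ideal [:: x ^+ 2; x * y; y ^+ 2]).
Variables (M N : lmodType R) (pi : {linear R^o -> M}) (iota : {linear N -> R^o}).
Hypothesis pi_surj : forall u, exists r : R, pi r = u.
Hypothesis pi_ker : forall r : R, pi r = 0 <-> r \in m.
Hypothesis iota_inj : injective iota.
Hypothesis iota_im : forall r : R, r \in I <-> exists n, iota n = r.
Local Notation Z1 := (submod (kernel (@augment R M))).
Local Notation F0 := (free_cover M).
Local Notation tau := (cyc_coef pi_surj).
Local Notation rho := (cyc_rho pi_surj).
Implicit Types (r a : R) (s : Z1).

Lemma tau_syz_m s : tau (val s) \in m.
Proof. by apply/pi_ker; apply: pi_coef_syz. Qed.

Lemma ex_socle_hom s : exists n, iota n = socle R * tau (val s).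
Proof. by apply/iota_im; apply: socle_m; apply: tau_syz_m. Qed.

(** Multiplication by t^19 as a homomorphism from m to I; [tau] reads the element of m off a
    syzygy. *)
Definition socle_fun : Z1 -> N := projT1 (choice ex_socle_hom).
Lemma iota_socle_fun s : iota (socle_fun s) = socle R * tau (val s).
Proof. exact: projT2 (choice ex_socle_hom) s. Qed.

Fact socle_fun_linear : linear socle_fun.
Proof.
move=> a u v; apply: iota_inj; rewrite iota_socle_fun (linearP iota) !iota_socle_fun.
rewrite (linearP (val : Z1 -> F0)) (linearP tau) mulrDr.
by congr (_ + _); exact: mulrCA.
Qed.

Definition socle_hom : {linear Z1 -> N} := mk_linear socle_fun_linear.

Lemma iota_socle_hom s : iota (socle_hom s) = socle R * tau (val s).
Proof. by rewrite /socle_hom mk_linearE iota_socle_fun. Qed.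

Definition socle_class : Ext M N 1 := ext1_class socle_hom.

Lemma tau_linear_scale (n : N) : linear (fun e : F0 => (tau e : R) *: n).
Proof. by apply: linear_scalel; apply: linearP. Qed.

Lemma ext1_class0 : ext1_class (\0 : {linear Z1 -> N}) = 0.
Proof. by apply/ext1_class_eq0; exists (\0 : {linear F0 -> N}). Qed.

(** For a in m the multiplier a t^19 is itself in I, so a [socle_hom] extends to F_0 by the same
    formula. *)
Lemma socle_class_m a : a \in m -> a *: socle_class = 0.
Proof.
move=> am; have [n nE] := (iota_im _).1 (socle_m am).
have lin : linear (fun s => a *: socle_hom s).
  by apply: linear_scale; apply: linearP.
transitivity (ext1_class (mk_linear lin)).
  rewrite (@ext1_classP _ _ _ a _ socle_hom \0) ?ext1_class0 ?addr0 //.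
  by move=> s; rewrite mk_linearE addr0.
apply/ext1_class_eq0; exists (mk_linear (tau_linear_scale n)) => s.
rewrite [LHS]mk_linearE [RHS]mk_linearE; apply: iota_inj; rewrite !linearZ /= nE iota_socle_hom.
by rewrite -[LHS]/(_ * (_ * _)) -[RHS]/(_ * (_ * _)); ring.
Qed.

Lemma pi_congr r r' : pi r = pi r' -> r - r' \in m.
Proof. by move=> rr'; apply/pi_ker; rewrite linearB rr' subrr. Qed.

Definition type_fun (u : M) : Ext M N 1 := lift1 pi_surj u *: socle_class.

Lemma type_fun_pi r : type_fun (pi r) = r *: socle_class.
Proof.
apply/eqP; rewrite -subr_eq0 -scalerBl; apply/eqP; apply: socle_class_m.
by apply: pi_congr; rewrite lift1K.
Qed.

Lemma type_fun_linear : linear type_fun.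
Proof.
move=> a u v; have [r <-] := pi_surj u; have [r' <-] := pi_surj v.
by rewrite -linearP !type_fun_pi scalerDl -scalerA.
Qed.

Lemma socle_class_neq0 : socle_class <> 0.
Proof.
move=> /ext1_class_eq0[g gE]; have xm := (pi_ker _).2 (gx_in_m R).
have := congr1 iota (gE (cyc_syz xm)); rewrite iota_socle_hom /=.
rewrite linearZ linearZ /= linearZ /= coef_cyc_gen => E.
case/negP: (socle_notin R); have {E} : socle R * lift1 pi_surj (pi 1) \in I.
  apply/iota_im; exists (g (cyc_gen pi)); apply: (mulfI (gx_neq0 R)).
  by rewrite mulrCA.
(* The chosen lift of [pi 1] is only congruent to 1 modulo m; the error is harmless because t^19 m
   lies in I. *)
have m1 : lift1 pi_surj (pi 1) - 1 \in m by apply: pi_congr; rewrite lift1K.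
move=> sI; have := rpredB sI (socle_m m1).
by rewrite mulrBr mulr1 opprB addrC subrK.
Qed.

Lemma type_fun_inj : injective type_fun.
Proof.
move=> u v uv; apply/eqP; rewrite -subr_eq0; apply/eqP.
have : type_fun (u - v) = 0.
  rewrite -[type_fun _](mk_linearE type_fun_linear) linearB.
  by rewrite !(mk_linearE type_fun_linear) uv subrr.
have [r <-] := pi_surj (u - v); rewrite type_fun_pi => r0; apply/pi_ker.
rewrite mem_m; apply: contra_notT socle_class_neq0 => r_neq0.
rewrite -[LHS]scale1r -(scalV R r_neq0) -scalerA.
rewrite -{1}[scal R (cf r 0)](subKr r) scalerBl r0 socle_class_m ?subr0 ?scaler0 //.
exact: sub_scal_m.
Qed.

Lemma type_fun_surj (e : Ext M N 1) : exists u, type_fun u = e.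
Proof.
have [h ->] := ext1_class_surj e.
have syz_scale g (g_m : pi g = 0) (x0 : pi x = 0) :
    x *: cyc_syz g_m = g *: cyc_syz x0.
  by apply: val_inj; rewrite /= !scalerA; congr (_ *: _); apply: mulrC.
have gen_m g : g \in [:: x; y; z; w] -> pi g = 0.
  by move=> gm; apply/pi_ker; apply: mem_linspan.
have x0 := gen_m x (mem_head _ _).
pose p := iota (h (cyc_syz x0)) : R.
have iI (n : N) : iota n \in I by apply/iota_im; exists n.
have pE (g : R) (g_m : pi g = 0) : g * p = x * iota (h (cyc_syz g_m)).
  have := congr1 (iota \o h) (syz_scale g g_m x0).
  by rewrite /= !linearZ => /esym.
have y0 : pi y = 0 by apply: gen_m; rewrite !inE eqxx orbT.
have z0 : pi z = 0 by apply: gen_m; rewrite !inE eqxx !orbT.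
have w0 : pi w = 0 by apply: gen_m; rewrite !inE eqxx !orbT.
have [c [i [/iota_im[n nE] pE']]] :=
  colon_I (iI _) (iI _) (iI _) (iI _) (pE y y0) (pE z z0) (pE w w0).
exists (pi (scal R c)); rewrite type_fun_pi.
(* What is left of h after removing c times the socle map: h after [rho], plus multiplication by i.
   Both make sense on all of F_0, so its class is zero. *)
have lin : linear (fun s => h (rho (val s)) + (tau (val s) : R) *: n).
  apply: linear_add; first by move=> a u v; rewrite !linearP.
  by apply: linear_scalel => a u v; rewrite !linearP.
rewrite (@ext1_classP _ _ _ (scal R c) h socle_hom (mk_linear lin)).
  rewrite [X in _ + X](_ : _ = 0) ?addr0 //; apply/ext1_class_eq0.
  have lin' : linear (fun e : F0 => h (rho e) + (tau e : R) *: n).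
    apply: linear_add; first by move=> a u v; rewrite !linearP.
    by apply: linear_scalel; apply: linearP.
  by exists (mk_linear lin') => s; rewrite [LHS]mk_linearE [RHS]mk_linearE.
move=> s; rewrite (mk_linearE lin) {1}(cyc_syzE pi_surj s) linearD addrCA.
congr (_ + _); apply: iota_inj; rewrite linearD !linearZ /= iota_socle_hom nE.
apply: (mulfI (gx_neq0 R)); rewrite -pE /p pE'.
by rewrite -[scal R c *: _]/(_ * _) -[_ *: i]/(_ * _); ring.
Qed.

Theorem type_one : exists f : {linear M -> Ext M N 1}, bijective f.
Proof.
exists (mk_linear type_fun_linear).
have [g gE] := choice type_fun_surj; exists g => u; rewrite mk_linearE //.
by apply: type_fun_inj; rewrite gE.
Qed.

End TypeOne.

(** * The injective dimension of I *)

Section Baer.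
Variables (R : comNzRingType) (E : lmodType R).

Lemma baer_criterion :
  (forall (J : R -> Prop) (phi : R -> E), J 0 ->
     (forall a u v, J u -> J v -> J (a * u + v)) ->
     (forall a u v, J u -> J v -> phi (a * u + v) = a *: phi u + phi v) ->
     exists e, forall j, J j -> phi j = j *: e) ->
  injective_module E.
Proof.
move=> baer U V h f h_inj.
(* A partial extension of f is encoded by its graph. By linearity, being single-valued at 0 makes it
   single-valued everywhere. *)
pose valid (G : V -> E -> Prop) := [/\ forall u, G (h u) (f u),
  forall a u e v e', G u e -> G v e' -> G (a *: u + v) (a *: e + e') &
  forall e, G 0 e -> e = 0].
pose T := {G | valid G}.
pose le (G H : T) := `[< forall v e, sval G v e -> sval H v e >].
have valid0 : valid (fun v e => exists u, v = h u /\ e = f u).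
  split=> [u|a _ _ _ _ [u [-> ->]] [v [-> ->]]|e [u [/esym hu ->]]].
  - by exists u.
  - by exists (a *: u + v); rewrite !linearP.
  - by rewrite (h_inj u 0) ?linear0.
have G00 (G : T) : sval G 0 0.
  by case: (svalP G) => /(_ 0); rewrite !linear0.
have fun_G (G : T) v e e' : sval G v e -> sval G v e' -> e = e'.
  case: (svalP G) => _ linG G0 Ge Ge'; apply/eqP; rewrite -subr_eq0; apply/eqP.
  by apply: G0; have := linG (-1) _ _ _ _ Ge' Ge; rewrite !scaleN1r !addNr addrC.
have [||A totA|G Gmax] := classical_sets.ZL_preorder (exist _ _ valid0 : T) (R := le).
- by move=> G; apply/asboolP.
- move=> G H K /asboolP HG /asboolP GK; apply/asboolP => v e Hv.
  by apply: GK; apply: HG.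
(* A nonempty chain is bounded by its union; the empty one needs a separate bound, the graph of
   f. *)
- have [[G0 AG0]|noA] := pselect (exists G, A G); last first.
    by exists (exist _ _ valid0) => G AG; case: noA; exists G.
  suff valA : valid (fun v e => exists2 G, A G & sval G v e).
    by exists (exist _ _ valA) => G AG; apply/asboolP => v e Gv; exists G.
  split=> [u|a u e v e' [G AG Gu] [H AH Hv]|e [G AG]].
  - by exists G0 => //; case: (svalP G0).
  - have [/asboolP GH|/asboolP HG] := totA _ _ AG AH.
      by exists H => //; case: (svalP H) => _ linH _; apply: linH => //; apply: GH.
    by exists G => //; case: (svalP G) => _ linG _; apply: linG => //; apply: HG.
  - by case: (svalP G) => _ _; apply.
have [Gh Glin G0] := svalP G.
have dom v : exists e, sval G v e.
  (* The ideal of multipliers that bring v into the domain of the maximal G. The hypothesis supplies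
     a value e0 at v consistent with it, and maximality then puts v into the domain. *)
  pose J r := exists e, sval G (r *: v) e.
  have ex_phi r : exists e, J r -> sval G (r *: v) e.
    by have [[e Ge]|noJ] := pselect (J r); [exists e|exists 0 => /noJ].
  have [phi phiE] := choice ex_phi.
  have J_lin a u u' : J u -> J u' -> J (a * u + u').
    move=> [e Ge] [e' Ge']; exists (a *: e + e').
    by rewrite scalerDl -scalerA; apply: Glin.
  have [||a u u' Ju Ju'|e0 e0E] := baer J phi.
  - by exists 0; rewrite scale0r; apply: G00.
  - exact: J_lin.
  - apply: (fun_G G) (phiE _ (J_lin a _ _ Ju Ju')) _.
    by rewrite scalerDl -scalerA; apply: Glin; apply: phiE.
  pose G' u e := exists r u' e', [/\ sval G u' e', u = u' + r *: v & e = e' + r *: e0].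
  have valid' : valid G'.
    split=> [u|a _ _ _ _ [r [u [e [Gu -> ->]]]] [r' [u' [e' [Gu' -> ->]]]]|_ [r [u [e [Gu uE ->]]]]].
    - by exists 0, (h u), (f u); rewrite !scale0r !addr0.
    - exists (a * r + r'), (a *: u + u'), (a *: e + e').
      split; first exact: Glin.
        by rewrite scalerDl scalerDr scalerA addrACA.
      by rewrite scalerDl scalerDr scalerA addrACA.
    have rvE : r *: v = - u by apply/eqP; rewrite -addr_eq0 addrC -uE.
    have GNu : sval G (r *: v) (- e).
      by have := Glin (-1) _ _ _ _ Gu (G00 G); rewrite !scaleN1r !addr0 rvE.
    have Jr : J r by exists (- e).
    by rewrite -(e0E _ Jr) (fun_G G _ _ _ (phiE _ Jr) GNu) subrr.
  have /asboolP : le (exist _ _ valid') G.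
    apply: Gmax; apply/asboolP => u e Ge /=.
    by exists 0, u, e; rewrite !scale0r !addr0.
  move=> /(_ v e0) leG; exists e0; apply: leG => /=.
  by exists 1, 0, 0; rewrite !scale1r !add0r; split=> //; apply: G00.
have [g gE] := choice dom.
have g_lin : linear g.
  by move=> a u v; apply: (fun_G G) (gE _) _; apply: Glin.
exists (mk_linear g_lin) => u; rewrite mk_linearE.
exact: (fun_G G) (gE _) (Gh u).
Qed.

End Baer.

(** * The fraction field as an injective module *)

Section FractionModule.
Variable R : idomainType.
Local Notation tofrac := (@FracField.tofrac R).

Lemma fraction_rep (q : {fraction R}) :
  exists u v : R, v != 0 /\ tofrac v * q = tofrac u.
Proof.
elim/quotW: q => r; exists (\n_r), (\d_r); split; first exact: denom_ratioP.
unlock FracField.tofrac.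
rewrite !piE /=; apply/eqP; rewrite piE /= FracField.equivfE /FracField.mulf.
rewrite !numden_Ratio ?oner_eq0 ?mulf_neq0 ?denom_ratioP ?oner_eq0 //.
by rewrite !mulr1 !mul1r.
Qed.

Lemma tofrac_inj : injective tofrac.
Proof. by move=> a b /eqP; rewrite tofrac_eq => /eqP. Qed.

Definition fracmod := {fraction R}.
HB.instance Definition _ := GRing.Zmodule.on fracmod.

Definition frac_scale (a : R) (q : fracmod) : fracmod := tofrac a * q.

Fact frac_scaleA a b q : frac_scale a (frac_scale b q) = frac_scale (a * b) q.
Proof. by rewrite /frac_scale mulrA -tofracM. Qed.
Fact frac_scale1 : left_id 1 frac_scale.
Proof. by move=> q; rewrite /frac_scale tofrac1 mul1r. Qed.
Fact frac_scaleDr : right_distributive frac_scale +%R.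
Proof. by move=> a p q; rewrite /frac_scale mulrDr. Qed.
Fact frac_scaleDl q : {morph frac_scale^~ q : a b / a + b}.
Proof. by move=> a b; rewrite /frac_scale tofracD mulrDl. Qed.

HB.instance Definition _ := GRing.Zmodule_isLmodule.Build R fracmod
  frac_scaleA frac_scale1 frac_scaleDr frac_scaleDl.

Lemma fracZ a (q : fracmod) : a *: q = tofrac a * q. Proof. by []. Qed.

(** Since j0 phi(j) = j phi(j0), a homomorphism on an ideal with a nonzero element j0 is
    multiplication by phi(j0) / j0. *)
Lemma fraction_injective : injective_module fracmod.
Proof.
apply: baer_criterion => J phi J0 J_lin phi_lin.
have phi0 : phi 0 = 0.
  by have := phi_lin (-1) 0 0 J0 J0; rewrite mulr0 addr0 scaleN1r addNr.
have phiZ a u : J u -> phi (a * u) = a *: phi u.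
  by move=> Ju; have := phi_lin a u 0 Ju J0; rewrite !addr0 phi0 addr0.
have [[j0 [Jj0 j0_neq0]]|noj] := pselect (exists j, J j /\ j != 0); last first.
  exists 0 => j Jj; rewrite scaler0; have [->//|j_neq0] := eqVneq j 0.
  by case: noj; exists j.
have t0 : tofrac j0 != 0 by rewrite tofrac_eq0.
exists ((tofrac j0)^-1 * phi j0 : {fraction R}) => j Jj; apply: (mulfI t0).
rewrite -[LHS]/(j0 *: phi j) -phiZ // mulrC phiZ //.
by rewrite !fracZ [RHS]mulrCA [tofrac j0 * _]mulrA divff // mul1r.
Qed.

Section Image.
Variable S : submodClosed R^o.

Definition frac_image : {pred fracmod} :=
  [pred q | `[< exists2 i : R, i \in S & q = tofrac i >]].

Fact frac_image_submod_closed : submod_closed frac_image.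
Proof.
split=> [|a u v /asboolP[i iS ->] /asboolP[j jS ->]]; apply/asboolP.
  by exists 0; rewrite ?tofrac0 // (@rpred0 _ S).
exists (a * i + j); last by rewrite fracZ tofracD tofracM.
by apply: (@rpredD _ S) => //; apply: (@rpredZ _ _ S).
Qed.

HB.instance Definition _ := GRing.isSubmodClosed.Build R fracmod frac_image
  frac_image_submod_closed.

End Image.

End FractionModule.

Section InjectiveDimension.
Variables (R : idomainType) (S : submodClosed R^o).

(** The resolution is 0 -> S -> K -> K / S -> 0 with K the fraction field; row vectors of length 0
    serve as the zero module. *)
Lemma finite_inj_dim_ideal :
  injective_module (quotmod (frac_image S)) -> finite_inj_dim (submod S).
Proof.
move=> inj1.
pose E i : lmodType R := match i with
  | 0 => fracmod R | 1 => quotmod (frac_image S) | _ => 'rV[R]_0 end.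
have zero i (e : E i.+2) : e = 0 by apply: thinmx0.
have h_lin : linear (fun u : submod S => FracField.tofrac (val u : R) : fracmod R).
  by move=> a u v; rewrite fracZ -tofracM -tofracD.
pose d i : {linear E i -> E i.+1} := match i with
  | 0 => mk_linear (@quot_proj_linear R _ (frac_image S))
  | i'.+1 => \0 end.
exists 1%N, E, (mk_linear h_lin), d; split.
- move=> [|[|i]]; [exact: fraction_injective|exact: inj1|].
  by move=> U V h f _; exists (\0 : {linear V -> E i.+2}) => u; apply/esym/zero.
- by move=> [|[|i]] // _ e; apply: zero.
- by move=> u v; rewrite ![mk_linear _ _]mk_linearE => /tofrac_inj /val_inj.
- move=> e; rewrite /d [mk_linear _ _]mk_linearE quot_proj_eq0.
  split=> [/asboolP[i iS ->]|[u ->]].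
    by exists (Submod iS); rewrite mk_linearE.
  by apply/asboolP; exists (val u); [exact: valP|rewrite mk_linearE].
- move=> [|i] e; split=> // _; last by exists 0; rewrite linear0; apply: zero.
  by exists (repr (e : Quotient.quot _)); rewrite [RHS]mk_linearE quot_projK.
Qed.

End InjectiveDimension.

Section SeriesOrder.
Variable K : fieldType.
Implicit Types f g : series K.

Lemma series_factor f : f != 0 ->
  exists d u, f = serX K ^+ d * u /\ u \is a GRing.unit.
Proof.
move=> f0; have ex : exists n, coefs f n != 0.
  apply: contrapT => no; case/eqP: f0; apply: seriesP => n.
  by apply/eqP; apply/negPn/negP => fn; apply: no; exists n.
case: (ex_minnP ex) => d fd dmin; exists d, (shift d f); split.
  rewrite shiftK // => i id; apply/eqP; apply: contraLR id => /dmin.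
  by rewrite -leqNgt.
by rewrite -[_ \is a _]/(coefs (shift d f) 0 \is a _) unitfE coefs_shift.
Qed.

Lemma coefs_low_mul D f g : (forall i, (i < D)%N -> coefs f i = 0) ->
  forall i, (i < D)%N -> coefs (f * g) i = 0.
Proof.
by move=> f0 i iD; rewrite -(shiftK f0) -mulrA coefsMXn leqNgt iD.
Qed.

End SeriesOrder.

(** * The residue at t^19 *)

Section Residue.
Variables (k : fieldType) (R : model k).
Local Notation x := (gx R).
Local Notation y := (gy R).
Local Notation z := (gz R).
Local Notation w := (gw R).
Local Notation cf f n := (coefs (ser R f) n).
Local Notation I := (ideal [:: x ^+ 2; x * y; y ^+ 2]).
Local Notation tofrac := (@FracField.tofrac R).
Implicit Types (f g r v : R) (q : {fraction R}).

(** With d the order of v, the series f / v has order at least D, and there are no gaps from 10 on,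
    so it lies in R. *)
Lemma high_divides v : v != 0 -> exists d, forall D f, (10 <= D)%N ->
  (forall n, (n < d + D)%N -> cf f n = 0) ->
  exists r, f = v * r /\ forall n, (n < D)%N -> cf r n = 0.
Proof.
move=> v0; have sv0 : ser R v != 0.
  by apply: contraNneq v0 => sv; apply/eqP/(@ser_inj _ R); rewrite sv rmorph0.
have [d [e [vE e_unit]]] := series_factor sv0; exists d => D f D10 f0.
have low n : (n < D)%N -> coefs (shift d (ser R f) * e^-1) n = 0.
  by apply: coefs_low_mul => i iD; rewrite coefs_shift f0 // addnC ltn_add2l.
have rE : ser R (unser R (shift d (ser R f) * e^-1)) = shift d (ser R f) * e^-1.
  by apply: unserK => n ng; apply: low; move: ng; rewrite !inE; lia.
exists (unser R (shift d (ser R f) * e^-1)); split=> [|n nD]; last by rewrite rE low.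
apply: (@ser_inj _ R); rewrite rmorphM rE vE -mulrA [e * _]mulrCA divrr // mulr1.
by rewrite shiftK // => i id; apply: f0; lia.
Qed.

Lemma cf_xnM n f i : cf (x ^+ n * f) i = if (5 * n <= i)%N then cf f (i - 5 * n) else 0.
Proof. by rewrite rmorphM rmorphXn ser_x -exprM coefsMXn. Qed.

Lemma xn_neq0 n : x ^+ n != 0. Proof. by rewrite expf_neq0 ?gx_neq0. Qed.

Lemma frac_rep q : exists ng : nat * R, tofrac (x ^+ ng.1) * q = tofrac ng.2.
Proof.
have [u [v [v0 vq]]] := fraction_rep q; have [d div_v] := high_divides v0.
have [|n nd|r [xr _]] := div_v 10%N (x ^+ (d + 10)) => //.
  by rewrite -[x ^+ _]mulr1 cf_xnM leqNgt ifN //; lia.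
by exists ((d + 10)%N, r * u); rewrite xr !tofracM mulrAC vq mulrC.
Qed.

(** With q = g / x^n and x = t^5, the coefficient of t^19 in q is that of t^(5n+19) in g; [residueE]
    makes it independent of the chosen representation. *)
Definition residue q : k :=
  let ng := projT1 (cid (frac_rep q)) in cf ng.2 (5 * ng.1 + 19).

Lemma residueE n g q : tofrac (x ^+ n) * q = tofrac g ->
  residue q = cf g (5 * n + 19).
Proof.
rewrite /residue; case: cid => -[n' g'] /= gE' gE.
have : x ^+ n * g' = x ^+ n' * g.
  by apply: tofrac_inj; rewrite !tofracM -gE -gE' mulrCA.
move/(congr1 (fun f => cf f (5 * n + 5 * n' + 19))); rewrite !cf_xnM !ifT; try lia.
by move=> E; rewrite (_ : 5 * n' + 19 = 5 * n + 5 * n' + 19 - 5 * n)%N ?E;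
  [congr coefs|]; lia.
Qed.

Lemma residue_tofrac f : residue (tofrac f) = cf f 19.
Proof. by rewrite (@residueE 0%N f) // expr0 tofrac1 mul1r. Qed.

Lemma residueP c q q' :
  residue (tofrac (scal R c) * q + q') = c * residue q + residue q'.
Proof.
have [[n g] /= gE] := frac_rep q; have [[n' g'] /= gE'] := frac_rep q'.
rewrite (@residueE (n + n') (scal R c * (x ^+ n' * g) + x ^+ n * g')); last first.
  rewrite tofracD mulrDr exprD !tofracM; congr (_ + _); last by rewrite -mulrA gE'.
  by rewrite -gE; ring.
rewrite cfD cfZ !cf_xnM !ifT; try lia.
rewrite (residueE gE) (residueE gE').
by congr (_ * coefs _ _ + coefs _ _); lia.
Qed.

Lemma residueB q q' : residue (q - q') = residue q - residue q'.
Proof.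
have E : tofrac (scal R (-1)) = -1.
  rewrite -tofrac1 -tofracN; congr tofrac; apply: (@ser_inj _ R).
  by rewrite ser_scal !rmorphN !rmorph1.
by have := residueP (-1) q' q; rewrite E !mulN1r addrC [RHS]addrC.
Qed.

(** Testing with r = t^s for s in the semigroup kills the coefficient of t^(19-s) in q. What
    survives are the exponents of I. *)
Lemma residue_I q : (forall r, residue (tofrac r * q) = 0) ->
  exists2 i, i \in I & q = tofrac i.
Proof.
have [[n g] /= gE] := frac_rep q => res0.
have g0 i : (i <= 5 * n + 19)%N -> ((5 * n + 19 - i)%N \notin gaps) -> cf g i = 0.
  move=> le_i ng; pose r := unser R (serX k ^+ (5 * n + 19 - i)).
  have rE : ser R r = serX k ^+ (5 * n + 19 - i).
    apply: unserK => j jg; rewrite coefs_Xn.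
    by case: eqP => // ji; move: ng; rewrite -ji jg.
  have := res0 r; rewrite (@residueE n (r * g)); last first.
    by rewrite tofracM -gE mulrCA.
  rewrite rmorphM rE coefsMXn ifT; last by lia.
  by rewrite (_ : _ - _ = i)%N //; lia.
have iE : ser R (unser R (shift (5 * n) (ser R g))) = shift (5 * n) (ser R g).
  apply: unserK => j jg; rewrite coefs_shift g0 //.
    by move: jg; rewrite !inE; lia.
  by move: jg; rewrite !inE; lia.
exists (unser R (shift (5 * n) (ser R g))).
  apply/mem_I => j j0; rewrite iE coefs_shift g0 //; move: j0; rewrite !inE; lia.
apply: (@mulfI _ (tofrac (x ^+ n))); first by rewrite tofrac_eq0 xn_neq0.
rewrite gE -tofracM; congr tofrac; apply: (@ser_inj _ R).
rewrite rmorphM iE rmorphXn ser_x -exprM shiftK // => i i5; apply: g0; first lia.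
by rewrite !inE; lia.
Qed.

End Residue.

(** * Injectivity of the fraction field modulo I *)

Section InjectiveQuotient.
Variables (k : fieldType) (R : model k).
Local Notation x := (gx R).
Local Notation y := (gy R).
Local Notation z := (gz R).
Local Notation w := (gw R).
Local Notation cf f n := (coefs (ser R f) n).
Local Notation I := (ideal [:: x ^+ 2; x * y; y ^+ 2]).
Local Notation tofrac := (@FracField.tofrac R).
Implicit Types (r j : R).

(** Such a functional factors through the truncation of J below t^c, a finite-dimensional space. The
    induction removes the last coefficient with the help of an element of J of order exactly c, if
    there is one. *)
Lemma functional_coefs c (J : R -> Prop) (lam : R -> k) :
  (forall a u v, J u -> J v -> J (scal R a * u + v)) ->
  (forall a u v, J u -> J v -> lam (scal R a * u + v) = a * lam u + lam v) ->
  (forall j, J j -> (forall v, (v < c)%N -> cf j v = 0) -> lam j = 0) ->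
  exists gam : nat -> k, forall j, J j -> lam j = \sum_(v < c) cf j v * gam v.
Proof.
move=> J_lin; elim: c lam => [|c IHc] lam lam_lin lam0.
  by exists (fun=> 0) => j Jj; rewrite big_ord0 lam0.
have [gc gcE] : exists gc, forall j, J j -> (forall v, (v < c)%N -> cf j v = 0) ->
    lam j = cf j c * gc.
  have [[j1 [Jj1 j1v j1c]]|noj] := pselect (exists j,
      [/\ J j, forall v, (v < c)%N -> cf j v = 0 & cf j c != 0]).
    exists (lam j1 / cf j1 c) => j Jj jv.
    pose a := - (cf j c / cf j1 c).
    have := lam0 _ (J_lin a _ _ Jj1 Jj) _; rewrite lam_lin // => lam_eq0.
    apply/eqP; rewrite -subr_eq0 -[X in _ == X]lam_eq0 => [|v].
      by apply/eqP; rewrite /a; ring.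
    rewrite ltnS leq_eqVlt cfD cfZ => /predU1P[->|vc].
      by rewrite /a mulNr divfK // addNr.
    by rewrite j1v // jv // mulr0 addr0.
  exists 0 => j Jj jv; rewrite mulr0; apply: lam0 => // v.
  rewrite ltnS leq_eqVlt => /predU1P[->|]; last exact: jv.
  by apply/eqP; apply: contra_notT noj => jc; exists j.
have [||gam gamE] := IHc (fun j => lam j - cf j c * gc).
- by move=> a u v Ju Jv; rewrite lam_lin // cfD cfZ; ring.
- by move=> j Jj jv; rewrite gcE // subrr.
exists (fun v => if v == c then gc else gam v) => j Jj.
rewrite big_ord_recr /= eqxx -[LHS](subrK (cf j c * gc)) gamE //.
by congr (_ + _); apply: eq_bigr => v _; rewrite ltn_eqF.
Qed.

Lemma quotient_injective (S : submodClosed R^o) : S =i I ->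
  injective_module (quotmod (frac_image S)).
Proof.
move=> SI.
apply: baer_criterion => J phi J0 J_lin phi_lin.
pose prj := quot_proj (frac_image S).
have prj_lin : linear prj by exact: quot_proj_linear.
have prj0 : prj 0 = 0 by exact: quot_proj0.
have prjD q q' : prj (q + q') = prj q + prj q' by exact: quot_projD.
have prjZ a (q : fracmod R) : prj (a *: q) = a *: prj q.
  by have := prj_lin a q 0; rewrite addr0 prj0 addr0.
pose rep (e : quotmod (frac_image S)) : fracmod R :=
  repr (e : Quotient.quot (quot_pred (frac_image S))).
have repK e : prj (rep e) = e by exact: quot_projK.
have res_eq q q' : prj q = prj q' -> residue q = residue q'.
  move=> /quot_proj_eq/asboolP[i iS qE].
  have /mem_I iI : i \in I by rewrite -SI.
  by apply/eqP; rewrite -subr_eq0 -residueB qE residue_tofrac iI.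
have phi0 : phi 0 = 0.
  by have := phi_lin (-1) 0 0 J0 J0; rewrite mulr0 addr0 scaleN1r addNr.
have phiZ a u : J u -> phi (a * u) = a *: phi u.
  by move=> Ju; have := phi_lin a u 0 Ju J0; rewrite !addr0 phi0 addr0.
have JZ a u : J u -> J (a * u).
  by move=> Ju; have := J_lin a u 0 Ju J0; rewrite addr0.
have [[j0 [Jj0 j0_neq0]]|noj] := pselect (exists j, J j /\ j != 0); last first.
  exists (prj 0) => j Jj; rewrite prj0 scaler0; have [->//|j_neq0] := eqVneq j 0.
  by case: noj; exists j.
pose lam j := residue (rep (phi j)).
have lam_prj j q : phi j = prj q -> lam j = residue q.
  by move=> jq; apply: res_eq; rewrite repK.
have [d div_j0] := high_divides j0_neq0.
have [[n0 g0] /= g0E] := frac_rep (rep (phi j0)).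
(* If j has order at least d + D, then j = j0 r with r of order at least D, so phi(j) is represented
   by r g0 / x^n0. This has order at least 30 and lies in I, which contains everything from t^20
   on. *)
pose D := (5 * n0 + 30)%N.
have phi_high j : (forall v, (v < d + D)%N -> cf j v = 0) -> phi j = 0.
  move=> jv; have [|//|r [-> rv]] := div_j0 D j; first by rewrite /D; lia.
  have r'E : ser R (unser R (shift (5 * n0) (ser R r))) = shift (5 * n0) (ser R r).
    by apply: unserK => v vg; rewrite coefs_shift rv //; move: vg; rewrite /D !inE; lia.
  have rE : r = unser R (shift (5 * n0) (ser R r)) * x ^+ n0.
    apply: (@ser_inj _ R); rewrite mulrC rmorphM rmorphXn ser_x -exprM r'E.
    by rewrite shiftK // => v v5; apply: rv; rewrite /D; lia.
  rewrite [j0 * r]mulrC phiZ // -[phi j0]repK -prjZ fracZ rE tofracM -mulrA g0E -tofracM.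
  apply/quot_proj_eq0/asboolP; eexists; last by [].
  rewrite SI; apply/mem_I => v v0; rewrite rmorphM r'E.
  apply: (@coefs_low_mul _ 30) => [i i30|]; last by move: v0; rewrite !inE; lia.
  by rewrite coefs_shift rv // /D; lia.
pose c := (d + D)%N.
have [|a u v Ju Jv|j Jj /phi_high jv|gam gamE] := @functional_coefs c J lam.
- by move=> a u v Ju Jv; apply: J_lin.
- rewrite -residueP; apply: lam_prj.
  by rewrite phi_lin // -[phi u in LHS]repK -[phi v in LHS]repK -prjZ -prjD.
- by rewrite /lam jv -prj0 (res_eq _ 0) ?repK // -tofrac0 residue_tofrac cf0.
(* The multiplier is q = g / x^c, where g carries [gam] in reverse order: the residue of j q is the
   coefficient of t^L in j g, which is the sum of j_v gam_v over v < c. The exponents of g exceed L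
   - c = 4c + 19, so they avoid the gaps. *)
pose L := (5 * c + 19)%N.
pose h : series k := Series (fun n => if (L - c < n <= L)%N then gam (L - n)%N else 0).
have hE n : coefs h n = if (L - c < n <= L)%N then gam (L - n)%N else 0 by [].
have gE : ser R (unser R h) = h.
  apply: unserK => n ng; rewrite hE ifF //; move: ng; rewrite !inE /L; lia.
set g := unser R h in gE.
pose q : fracmod R := ((tofrac (x ^+ c))^-1 * tofrac g : {fraction R}).
have qE j : tofrac (x ^+ c) * (tofrac j * q) = tofrac (j * g).
  rewrite /q mulrCA [tofrac (x ^+ c) * _]mulrA divff ?tofrac_eq0 ?xn_neq0 //.
  by rewrite mul1r tofracM.
have res_q j : J j -> residue (tofrac j * q) = lam j.
  move=> Jj; rewrite (residueE (qE j)) gamE // cfM gE -/L.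
  have cL : (c <= L.+1)%N by rewrite /L; lia.
  rewrite (big_ord_widen _ (fun v => cf j v * gam v) cL) [RHS]big_mkcond.
  apply: eq_bigr => v _; have := ltn_ord v; rewrite ltnS => vL.
  rewrite hE leq_subr andbT subKn //; case: ltnP => vc.
    by rewrite ifT //; lia.
  by rewrite ifF ?mulr0 //; lia.
exists (prj q) => j Jj; rewrite -prjZ -[LHS]repK.
apply/quot_proj_eq/asboolP.
suff [i iI iE] : exists2 i, i \in I & rep (phi j) - j *: q = tofrac i.
  by exists i => //; rewrite SI.
(* The two sides have the same residue against every r because r j is again in J, where [lam] is the
   residue of phi. *)
apply: residue_I => r.
rewrite mulrBr residueB; apply/eqP; rewrite subr_eq0; apply/eqP.
transitivity (lam (r * j)); last first.
  by rewrite fracZ mulrA -tofracM res_q //; apply: JZ.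
by symmetry; apply: lam_prj; rewrite phiZ // -[phi j in LHS]repK -prjZ.
Qed.


End InjectiveQuotient.

(** * Dimension and depth *)

Section LocalRing.
Variables (k : fieldType) (R : model k).
Local Notation x := (gx R).
Local Notation y := (gy R).
Local Notation z := (gz R).
Local Notation w := (gw R).
Local Notation cf f n := (coefs (ser R f) n).
Local Notation m := (ideal [:: x; y; z; w]).
Local Notation I := (ideal [:: x ^+ 2; x * y; y ^+ 2]).
Implicit Types (f g r a : R).

(** After scaling, f is 1 - a with a in m, and 1 / (1 - a) = (1 + a) / (1 - a^2). As a^2 has order
    at least 10, so has h = a^2 / (1 - a^2); hence h is in R and 1 / (1 - a^2) = 1 + h. *)
Lemma ex_inverse f : cf f 0 != 0 -> exists g, f * g = 1.
Proof.
move=> f0; set c := scal R (cf f 0)^-1.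
pose a := 1 - f * c; have am : a \in m.
  by rewrite mem_m cfB cf1 mulrC cfZ mulVf ?subrr.
have aa0 n : (n < 10)%N -> cf (a ^+ 2) n = 0.
  move=> n10; rewrite expr2; apply: (cf_mul0 (cf_m am) (cf_m am)) => i le_in.
  by rewrite /m_zeros; lia.
pose A := ser R (a ^+ 2); have uA : 1 - A \is a GRing.unit.
  rewrite -[_ \is a _]/(coefs (1 - A) 0 \is a _) unitfE coefsD coefsN aa0 // subr0.
  exact: oner_neq0.
pose h := high R (shift 10 A * (1 - A)^-1).
have hE : (1 - a ^+ 2) * (1 + h) = 1.
  apply: (@ser_inj _ R); rewrite rmorphM rmorphB rmorphD rmorph1 ser_high mulrA.
  by rewrite shiftK // -/A mulrDr mulr1 mulrCA divrr // mulr1 subrK.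
exists (c * (1 + a) * (1 + h)).
have fcE : f * c = 1 - a by rewrite /a subKr.
by rewrite -[RHS]hE !mulrA fcE; ring.
Qed.

Lemma idealr_closed_m (J : {pred R}) : idealr_closed J -> {subset J <= m}.
Proof.
move=> [J0 J1 J_lin] f fJ; rewrite mem_m; apply: contraNT J1 => /ex_inverse[g fg].
by rewrite -fg mulrC -[g * f]addr0; apply: J_lin.
Qed.

Lemma m_idealr_closed : idealr_closed m.
Proof.
split=> [||a u v]; rewrite !mem_m ?cf0 ?cf1 ?oner_eq0 //.
move=> /eqP u0 /eqP v0.
by rewrite cfD v0 addr0 cfM big_ord_recl big_ord0 subn0 u0 mulr0 addr0.
Qed.

Lemma maximal_idealP (J : {pred R}) : maximal_ideal J <-> J =i m.
Proof.
split=> [[Jcl Jmax] f|Jm].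
  by rewrite (Jmax _ m_idealr_closed (idealr_closed_m Jcl)).
split=> [|J' J'cl JJ' f].
  have [m0 m1 m_lin] := m_idealr_closed; split; rewrite ?Jm //.
  by move=> a u v; rewrite !Jm; apply: m_lin.
by apply/idP/idP => [/(idealr_closed_m J'cl)|/JJ' //]; rewrite Jm.
Qed.

Lemma cf_exp_m a n i : a \in m -> (i < n)%N -> cf (a ^+ n) i = 0.
Proof.
rewrite mem_m => /eqP a0 lt_in; rewrite rmorphXn -(@shiftK _ 1 (ser R a)).
  by rewrite exprMn expr1 coefsMXn leqNgt lt_in.
by case.
Qed.

(** The order of a^n is at least n, while that of f is finite. Both the dimension and the bound on
    regular sequences rest on this. *)
Lemma exp_divides f a : f != 0 -> a \in m -> exists n r, a ^+ n = f * r.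
Proof.
move=> f0 am; have [d div_f] := high_divides f0.
have [//|i id|r [aE _]] := div_f 10%N (a ^+ (d + 10)); first exact: cf_exp_m.
by exists (d + 10)%N, r.
Qed.

Lemma prime_m (P : {pred R}) f : prime_ideal P -> f \in P -> f != 0 ->
  {subset m <= P}.
Proof.
move=> [[P0 P1 P_lin] P_prime] fP f0 a am.
have [n [r aE]] := exp_divides f0 am.
have : a ^+ n \in P by rewrite aE mulrC -[r * f]addr0; apply: P_lin.
elim: n {aE} => [|n IHn]; first by rewrite expr0 (negPf P1).
by rewrite exprS => /P_prime/orP[].
Qed.

Lemma m_prime : prime_ideal m.
Proof.
split; first exact: m_idealr_closed.
move=> u v; rewrite !mem_m cfM big_ord_recl big_ord0 subn0 addr0.
by rewrite mulf_eq0.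
Qed.

Lemma krull_dim_one : krull_dim R 1.
Proof.
split.
  exists (fun i => if i is 0 then (pred1 (0 : R) : {pred R}) else m); split=> [[|i] _|[|//] _].
  - split; last by move=> u v; rewrite !inE mulf_eq0.
    split; rewrite ?inE ?eqxx ?oner_eq0 //.
    by move=> a u v; rewrite !inE => /eqP -> /eqP ->; rewrite mulr0 addr0.
  - exact: m_prime.
  - split=> [f|/(_ x (gx_in_m R))]; first by rewrite inE => /eqP ->; rewrite mem_m cf0.
    by rewrite inE (negPf (gx_neq0 R)).
move=> [P [P_prime P_chain]].
have [_ P10] := P_chain 0%N isT; have [_ P21] := P_chain 1%N isT.
have [f [fP1 f0]] : exists f, f \in P 1%N /\ f != 0.
  apply: contrapT => no_f; apply: P10 => f fP1.
  have [->|f0] := eqVneq f 0; first by have [[]] := P_prime 0%N isT.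
  by case: no_f; exists f.
apply: P21 => g gP2; apply: (prime_m (P_prime 1%N isT) fP1 f0).
by apply: idealr_closed_m gP2; case: (P_prime 2%N isT).
Qed.

Section Depth.
Variable M : lmodType R.

Lemma ideal_mul_nil (u : M) : u \in ideal_mul [::] -> u = 0.
Proof.
elim/linspan_ind: u / => // a u v /asboolP[b].
by rewrite in_nil.
Qed.

Lemma ideal_mul_cons b (s : seq R) (u : M) :
  u \in ideal_mul [:: b] -> u \in ideal_mul (b :: s).
Proof.
elim/linspan_ind: u / => [|a u v /asboolP[c]]; first exact: rpred0.
rewrite inE => /eqP -> [u' ->] vs; apply: rpredD => //; apply: rpredZ.
by apply: mem_linspan; apply/asboolP; exists b; [rewrite inE eqxx|exists u'].
Qed.

Lemma ideal_mul_seq1 b (u : M) : u \in ideal_mul [:: b] <-> exists v, u = b *: v.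
Proof.
split=> [|[v ->]].
  elim/linspan_ind: u / => [|a u v /asboolP[c]]; first by exists 0; rewrite scaler0.
  rewrite inE => /eqP -> [u' ->] [v' ->]; exists (a *: u' + v').
  by rewrite scalerDr !scalerA mulrC.
by apply: mem_linspan; apply/asboolP; exists b; [rewrite inE eqxx|exists v].
Qed.

(** Some power of b is a multiple of a and so kills M / a M. If b were regular on this quotient, the
    quotient would vanish. *)
Lemma regular_seq_size (s : seq R) : {subset s <= m} -> regular_seq M s ->
  (size s <= 1)%N.
Proof.
case: s => [|a [|b s]] // sm [[u uN] reg]; exfalso.
have a0 : a != 0.
  apply/eqP => a0; have /(_ isT) := reg 0%N u; rewrite /= a0 scale0r.
  by move=> /(_ (rpred0 _))/ideal_mul_nil u0; case/negP: uN; rewrite u0; apply: rpred0.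
case/negP: uN.
have bm : b \in m by apply: sm; rewrite !inE eqxx orbT.
have [n [r bE]] := exp_divides a0 bm.
apply: ideal_mul_cons; have : b ^+ n *: u \in ideal_mul [:: a].
  by rewrite bE -scalerA; apply/ideal_mul_seq1; exists (r *: u).
elim: n {bE} => [|n IHn]; first by rewrite expr0 scale1r.
by rewrite exprS -scalerA => bu; apply: IHn; apply: (reg 1%N _ isT bu).
Qed.

Lemma depth_one : (forall u : M, x *: u = 0 -> u = 0) ->
  (exists u : M, forall v, u <> x *: v) -> depth m M 1.
Proof.
move=> x_reg [u uN]; split; last by move=> s; apply: regular_seq_size.
exists [:: x]; split=> //; first by move=> f; rewrite inE => /eqP ->; apply: (gx_in_m R).
split; first by exists u; apply/negP => /ideal_mul_seq1[v /uN].
move=> [|//] v _ /= /ideal_mul_nil/x_reg ->; exact: rpred0.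
Qed.

End Depth.

Lemma depth_ring : depth m R^o 1.
Proof.
apply: depth_one => [u /eqP|].
  by rewrite mulf_eq0 (negPf (gx_neq0 R)) => /eqP.
exists 1 => v /(congr1 (fun f => cf f 0)).
by rewrite cf1 cf_xM => /eqP; rewrite oner_eq0.
Qed.

Lemma depth_I : depth m (submod I) 1.
Proof.
apply: depth_one => [u xu|].
  apply: val_inj; have /eqP : x * val u = 0 by rewrite -[LHS]/(val (x *: u)) xu.
  by rewrite mulf_eq0 (negPf (gx_neq0 R)) => /eqP.
exists (I_xx R) => v /(congr1 val) /= xv.
have vx : val v = x by apply: (mulfI (gx_neq0 R)); exact: esym xv.
have /mem_I/(_ 5%N isT)/eqP := valP v.
by rewrite vx ser_x coefs_Xn oner_eq0.
Qed.

Lemma finitely_generated_I : finitely_generated (submod I).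
Proof.
exists [:: I_xx R; I_xy R; I_yy R] => u; have [[[p q] r] ->] := I_gen u.
by do ?apply: rpredD; apply: rpredZ; apply: mem_linspan; rewrite !inE eqxx ?orbT.
Qed.

End LocalRing.

(** * Trace and conductor *)

Section Trace.
Variables (k : fieldType) (R : model k).
Local Notation x := (gx R).
Local Notation y := (gy R).
Local Notation z := (gz R).
Local Notation w := (gw R).
Local Notation cf f n := (coefs (ser R f) n).
Local Notation I := (ideal [:: x ^+ 2; x * y; y ^+ 2]).
Local Notation C := (ideal [:: x ^+ 2; x * y; y ^+ 2; z; w]).
Implicit Types (f g r a b : R).

Lemma mem_C_gaps f :
  f \in C <-> [/\ cf f 0 = 0, cf f 5 = 0 & cf f 6 = 0].
Proof.
rewrite mem_C; split=> [f0|[f0 f5 f6] n n10]; first by rewrite !f0.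
have [ng|] := boolP (n \in gaps); first exact: ser_gap.
by case: n n10 => [|[|[|[|[|[|[|[|[|[|n]]]]]]]]]].
Qed.

(** As y / x = t, the element p2 is t^2 p. It lies in R, and the exponents 0, 5, 6 of p would become
    the gaps 2, 7, 8. *)
Lemma stable_C p p1 p2 : y * p = x * p1 -> y * p1 = x * p2 -> p \in C.
Proof.
move=> e1 e2.
have s1 n : cf p1 n.+1 = cf p n.
  move/(congr1 (fun f => cf f (n + 6))): e1; rewrite cf_yM cf_xM !ifT; try lia.
  by rewrite addnK => ->; congr coefs; lia.
have s2 n : cf p2 n.+1 = cf p1 n.
  move/(congr1 (fun f => cf f (n + 6))): e2; rewrite cf_yM cf_xM !ifT; try lia.
  by rewrite addnK => ->; congr coefs; lia.
by apply/mem_C_gaps; split; rewrite -s1 -?s2 ser_gap.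
Qed.

Variables (N : lmodType R) (iota : {linear N -> R^o}).
Hypothesis iota_inj : injective iota.
Hypothesis iota_im : forall r : R, r \in I <-> exists n, iota n = r.

Lemma iota_C u : (iota u : R) \in C.
Proof.
have /mem_I uI : (iota u : R) \in I by apply/iota_im; exists u.
by apply/mem_C => n n10; apply: uI; rewrite n10.
Qed.

Lemma hom_C (f : {linear N -> R^o}) u : (f u : R) \in C.
Proof.
have [e1 e1E] := (iota_im _).1 (mem_I_xx R).
have [e2 e2E] := (iota_im _).1 (mem_I_xy R).
have [e3 e3E] := (iota_im _).1 (mem_I_yy R).
have scal (a b : R) v v' : a * iota v = b * iota v' -> a * f v = b * f v'.
  move=> E; have -> : a * f v = f (a *: v) by rewrite linearZ.
  have -> : b * f v' = f (b *: v') by rewrite linearZ.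
  by congr (f _); apply: iota_inj; rewrite !linearZ.
have pC : (f e1 : R) \in C.
  by apply: (@stable_C _ (f e2) (f e3)); apply: scal; rewrite ?e1E ?e2E ?e3E; ring.
(* That is, f u = u p / t^10 with p the image of x^2; both u and p have order at least 10, hence so
   has f u. *)
have E : x ^+ 2 * f u = iota u * f e1 by apply: scal; rewrite e1E mulrC.
apply/mem_C => n n10; have := congr1 (fun g => cf g (n + 10)) E.
rewrite cf_xxM ifT ?addnK; last by lia.
move=> ->; apply: (@cf_mul0 _ R _ _ (fun i => i < 10)%N (fun i => i < 10)%N).
- exact/mem_C/iota_C.
- exact/mem_C.
- by move=> i le_in; lia.
Qed.

(** The homomorphism is multiplication by a / t^10, which is in k[[t]] and so maps I into t^10
    k[[t]]; it takes x^2 to a. *)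
Lemma ex_hom_C a : a \in C -> exists (f : {linear N -> R^o}) u, a = f u.
Proof.
move=> /mem_C aC.
have fE u : ser R (unser R (shift 10 (ser R a) * ser R (iota u))) =
    shift 10 (ser R a) * ser R (iota u).
  apply: unserK => n ng; rewrite mulrC (@coefs_low_mul _ 10) //.
    by have /mem_C := iota_C u.
  by move: ng; rewrite !inE; lia.
have lin : linear (fun u => unser R (shift 10 (ser R a) * ser R (iota u)) : R^o).
  move=> c u v; apply: (@ser_inj _ R); rewrite fE (linearP iota).
  set A := shift 10 (ser R a) in fE *.
  transitivity (ser R (c * unser R (A * ser R (iota u)) + unser R (A * ser R (iota v)))) => //.
  have -> : ser R (c *: iota u + iota v) = ser R c * ser R (iota u) + ser R (iota v).
    transitivity (ser R (c * iota u + iota v)) => //.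
    by rewrite rmorphD rmorphM.
  by rewrite rmorphD rmorphM !fE; ring.
have [e1 e1E] := (iota_im _).1 (mem_I_xx R).
exists (mk_linear lin), e1; rewrite mk_linearE; apply: (@ser_inj _ R).
by rewrite fE e1E ser_xx mulrC shiftK.
Qed.

Lemma trace_C : trace N =i C.
Proof.
move=> a; apply/idP/idP => [|aC].
  elim/linspan_ind: a / => [|a u v /asboolP[f [n ->]] vC]; first exact: rpred0.
  by apply: rpredD => //; apply: ideal_mulr; apply: hom_C.
apply: mem_linspan; apply/asboolP.
by have [f [u ->]] := ex_hom_C aC; exists f, u.
Qed.

End Trace.

(** * The conductor *)

Section Conductor.
Variables (k : fieldType) (R : model k).
Local Notation x := (gx R).
Local Notation y := (gy R).
Local Notation z := (gz R).
Local Notation w := (gw R).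
Local Notation cf f n := (coefs (ser R f) n).
Local Notation C := (ideal [:: x ^+ 2; x * y; y ^+ 2; z; w]).
Local Notation tofrac := (@FracField.tofrac R).
Implicit Types (f a b u v : R).

Lemma integral_root n (q : {fraction R}) c : (0 < n)%N -> q ^+ n = tofrac c ->
  integralOver tofrac q.
Proof.
move=> n0 qc; exists ('X^n - c%:P); first exact: monicXnsubC.
by rewrite rootE rmorphB /= map_polyXn map_polyC hornerD hornerN hornerXn hornerC qc subrr.
Qed.

Lemma conductor_sub a : a \in conductor R -> a \in C.
Proof.
move=> /asboolP cond.
have tx0 : tofrac x != 0 by rewrite tofrac_eq0 gx_neq0.
(* This q is t. It is integral because t^5 = x, so a, a t and a t^2 all lie in R and [stable_C]
   applies. *)
pose q := tofrac y / tofrac x.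
have qx : q * tofrac x = tofrac y by rewrite divfK.
have y5 : y ^+ 5 = x * x ^+ 5.
  apply: (@ser_inj _ R); rewrite rmorphM !rmorphXn ser_x ser_y -!exprM -exprD.
  by congr (_ ^+ _).
have q5 : q ^+ 5 = tofrac x.
  apply: (@mulIf _ (tofrac x ^+ 5)); first by rewrite expf_neq0.
  by rewrite -exprMn qx -!tofracXn -tofracM y5.
have [b bE] := cond q (integral_root (isT : 0 < 5)%N q5).
have [|b' b'E] := cond (q ^+ 2) (@integral_root 5 _ (x ^+ 2) isT _).
  by rewrite -exprM mulnC exprM q5 tofracXn.
apply: (@stable_C _ _ _ b b'); apply: tofrac_inj; rewrite !tofracM.
  by rewrite -bE -qx; ring.
by rewrite -bE -b'E -qx; ring.
Qed.

(* k[[t]] is integrally closed. *)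
Lemma integral_divides u v (q : {fraction R}) : v != 0 -> tofrac v * q = tofrac u ->
  integralOver tofrac q -> exists h, ser R u = ser R v * h.
Proof.
move=> v0 vq [p p_monic /eqP p_root].
have [->|u0] := eqVneq u 0; first by exists 0; rewrite rmorph0 mulr0.
have ser_neq0 f : f != 0 -> ser R f != 0.
  by apply: contraNneq => sf; apply/eqP/(@ser_inj _ R); rewrite sf rmorph0.
have [d [e [vE e_unit]]] := series_factor (ser_neq0 _ v0).
have [d' [e' [uE e'_unit]]] := series_factor (ser_neq0 _ u0).
have [dd'|d'd] := leqP d d'.
  exists (serX k ^+ (d' - d) * e^-1 * e'); rewrite uE vE.
  rewrite -(subnKC dd') exprD addKn.
  have -> : serX k ^+ d * e * (serX k ^+ (d' - d) * e^-1 * e') =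
    serX k ^+ d * serX k ^+ (d' - d) * (e / e) * e' by ring.
  by rewrite divrr // mulr1.
(* When u has smaller order than v, the term u^n of the cleared equation has strictly smaller order
   than all the others and cannot cancel. *)
exfalso; pose n := (size p).-1.
have sp : size p = n.+1 by rewrite prednK // size_poly_gt0 monic_neq0.
have rel : \sum_(i < n.+1) p`_i * u ^+ i * v ^+ (n - i) = 0.
  apply: tofrac_inj; rewrite tofrac0 rmorph_sum /=.
  transitivity (tofrac v ^+ n * (map_poly tofrac p).[q]); last by rewrite p_root mulr0.
  rewrite (@horner_coef_wide _ n.+1); last by rewrite -sp size_poly.
  rewrite mulr_sumr; apply: eq_bigr => i _; rewrite coef_map /=.
  have le_in : (i <= n)%N by rewrite -ltnS.
  have -> : tofrac v ^+ n = tofrac v ^+ i * tofrac v ^+ (n - i).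
    by rewrite -exprD subnKC.
  rewrite tofracM [tofrac (p`_i * _)]tofracM !tofracXn -vq exprMn.
  by ring.
move/(congr1 (fun f => cf f (n * d'))): rel.
rewrite cf0 rmorph_sum /= coefs_sum big_ord_recr /= big1 => [|i _].
  rewrite add0r subnn expr0 mulr1 rmorphM rmorphXn uE exprMn.
  have -> : p`_n = 1 by have /monicP := p_monic; rewrite lead_coefE.
  rewrite rmorph1 mul1r -exprM mulnC coefsMXn leqnn subnn => /eqP.
  have : e' ^+ n \is a GRing.unit by rewrite unitrX.
  by rewrite -[_ \is a _]/(coefs (e' ^+ n) 0 \is a _) unitfE => /negPf ->.
rewrite !rmorphM !rmorphXn uE vE !exprMn -!exprM.
have -> : ser R p`_i * (serX k ^+ (d' * i) * e' ^+ i) *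
    (serX k ^+ (d * (n - i)) * e ^+ (n - i)) =
  serX k ^+ (d' * i + d * (n - i)) * (ser R p`_i * e' ^+ i * e ^+ (n - i)).
  by rewrite exprD; ring.
rewrite coefsMXn ifF //; have := ltn_ord i; nia.
Qed.

Lemma conductor_C : conductor R =i C.
Proof.
move=> a; apply/idP/idP => [|/mem_C aC]; first exact: conductor_sub.
apply/asboolP => q q_int; have [u [v [v0 vq]]] := fraction_rep q.
have [h uE] := integral_divides v0 vq q_int.
have bE : ser R (unser R (ser R a * h)) = ser R a * h.
  by apply: unserK => n ng; rewrite (@coefs_low_mul _ 10) //; move: ng; rewrite !inE; lia.
exists (unser R (ser R a * h)); apply: (@mulfI _ (tofrac v)).
  by rewrite tofrac_eq0.
rewrite mulrCA vq -!tofracM; congr tofrac; apply: (@ser_inj _ R).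
by rewrite !rmorphM bE uE mulrCA.
Qed.

End Conductor.

(** * The presentation *)

Section FourVariables.
Variable k : fieldType.
Local Notation S4 := (series4 k).
Local Notation x := (x4 k).
Local Notation y := (y4 k).
Local Notation z := (z4 k).
Local Notation w := (w4 k).
Implicit Types (F G r : S4) (a b c d n e : nat).

Definition coef4 F a b c d : k := coefs (coefs (coefs (coefs F d) c) b) a.
Fact mk4_key : unit. Proof. exact: tt. Qed.
Definition mk4 (s : nat -> nat -> nat -> nat -> k) : S4 := locked_with mk4_key
  (Series (fun d => Series (fun c => Series (fun b => Series (fun a => s a b c d))))).

Lemma coef4_mk s a b c d : coef4 (mk4 s) a b c d = s a b c d.
Proof. by rewrite /mk4 unlock. Qed.

Lemma coef4P F G : (forall a b c d, coef4 F a b c d = coef4 G a b c d) -> F = G.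
Proof.
by move=> FG; do 4![apply: seriesP => ?]; apply: FG.
Qed.

Lemma coef4B F G a b c d : coef4 (F - G) a b c d = coef4 F a b c d - coef4 G a b c d.
Proof. by []. Qed.
Lemma coef4_0 a b c d : coef4 (0 : S4) a b c d = 0.
Proof. by []. Qed.
Lemma coef4_sum (J : Type) (s : seq J) (P : pred J) (f : J -> S4) a b c d :
  coef4 (\sum_(j <- s | P j) f j) a b c d = \sum_(j <- s | P j) coef4 (f j) a b c d.
Proof. by rewrite /coef4 !coefs_sum. Qed.

Definition weight a b c d : nat := (5 * a + 6 * b + 13 * c + 14 * d)%N.

Definition part n F : S4 :=
  mk4 (fun a b c d => if weight a b c d == n then coef4 F a b c d else 0).

Lemma coef4_part n F a b c d :
  coef4 (part n F) a b c d = if weight a b c d == n then coef4 F a b c d else 0.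
Proof. exact: coef4_mk. Qed.

Lemma part_part n F : part n (part n F) = part n F.
Proof. by apply: coef4P => a b c d; rewrite !coef4_part; case: (_ == n). Qed.

Lemma partB n F G : part n (F - G) = part n F - part n G.
Proof.
apply: coef4P => a b c d; rewrite coef4_part !coef4B !coef4_part.
by case: ifP; rewrite ?subr0.
Qed.

Lemma part_sum n (J : Type) (s : seq J) (P : pred J) (f : J -> S4) :
  part n (\sum_(j <- s | P j) f j) = \sum_(j <- s | P j) part n (f j).
Proof.
apply: coef4P => a b c d; rewrite coef4_part !coef4_sum.
by case: ifP => e; [apply: eq_bigr|rewrite big1 //] => j _; rewrite coef4_part e.
Qed.

Lemma part_eq F G : (forall n, part n F = part n G) -> F = G.
Proof.
move=> FG; apply: coef4P => a b c d.
have := congr1 (fun H => coef4 H a b c d) (FG (weight a b c d)).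
by rewrite !coef4_part eqxx.
Qed.

(** Stated as a shift of the grading under multiplication by r, which composes along products
    without expanding r into monomials. *)
Definition homogeneous e r : Prop := forall n F,
  part n (F * r) = if (e <= n)%N then part (n - e) F * r else 0.

Lemma homogeneousM e r e' r' :
  homogeneous e r -> homogeneous e' r' -> homogeneous (e + e') (r * r').
Proof.
move=> hr hr' n F; rewrite mulrA hr'.
have [e'n|ne'] := leqP e' n; last by rewrite ifF //; lia.
rewrite hr; have [en|ne] := leqP e (n - e').
  by rewrite ifT ?mulrA ?(addnC e) ?subnDA //; lia.
by rewrite ifF ?mul0r //; lia.
Qed.

Lemma homogeneousX e r i : homogeneous e r -> homogeneous (e * i) (r ^+ i).
Proof.
move=> hr; elim: i => [|i IHi]; last by rewrite exprS mulnS; apply: homogeneousM.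
by move=> n F; rewrite muln0 leq0n subn0 !mulr1.
Qed.

Lemma homogeneousB e r r' :
  homogeneous e r -> homogeneous e r' -> homogeneous e (r - r').
Proof.
move=> hr hr' n F; rewrite mulrBr partB hr hr'.
by case: ifP; rewrite ?mulrBr ?subr0.
Qed.

Lemma coefsMC (A : comNzRingType) (f : series A) u i :
  coefs (f * serC u) i = coefs f i * u.
Proof. by rewrite mulrC coefsCM mulrC. Qed.
Lemma coefsMX (A : comNzRingType) (f : series A) i :
  coefs (f * serX A) i = if i is j.+1 then coefs f j else 0.
Proof.
rewrite mulrC -[serX A]expr1 coefsMXn; case: i => //= i.
by rewrite subSS subn0.
Qed.

Lemma coef4_x F a b c d :
  coef4 (F * x) a b c d = if a is a'.+1 then coef4 F a' b c d else 0.
Proof. by rewrite /coef4 !coefsMC coefsMX. Qed.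
Lemma coef4_y F a b c d :
  coef4 (F * y) a b c d = if b is b'.+1 then coef4 F a b' c d else 0.
Proof. by rewrite /coef4 !coefsMC coefsMX; case: b. Qed.
Lemma coef4_z F a b c d :
  coef4 (F * z) a b c d = if c is c'.+1 then coef4 F a b c' d else 0.
Proof. by rewrite /coef4 !coefsMC coefsMX; case: c. Qed.
Lemma coef4_w F a b c d :
  coef4 (F * w) a b c d = if d is d'.+1 then coef4 F a b c d' else 0.
Proof. by rewrite /coef4 coefsMX; case: d. Qed.

Lemma homogeneous_var : [/\ homogeneous 5 x, homogeneous 6 y, homogeneous 13 z &
  homogeneous 14 w].
Proof.
split=> n F; apply: coef4P => a b c d.
- have [ne|ne] := leqP 5 n; last (rewrite coef4_0 coef4_part coef4_x).
    rewrite (coef4_x (part _ F)) coef4_part (coef4_x F); case: a => [|a]; first by rewrite if_same.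
    by rewrite coef4_part /weight; congr (if _ then _ else _); lia.
  by case: a => [|a]; rewrite ?if_same // /weight ifF //; lia.
- have [ne|ne] := leqP 6 n; last (rewrite coef4_0 coef4_part coef4_y).
    rewrite (coef4_y (part _ F)) coef4_part (coef4_y F); case: b => [|b]; first by rewrite if_same.
    by rewrite coef4_part /weight; congr (if _ then _ else _); lia.
  by case: b => [|b]; rewrite ?if_same // /weight ifF //; lia.
- have [ne|ne] := leqP 13 n; last (rewrite coef4_0 coef4_part coef4_z).
    rewrite (coef4_z (part _ F)) coef4_part (coef4_z F); case: c => [|c]; first by rewrite if_same.
    by rewrite coef4_part /weight; congr (if _ then _ else _); lia.
  by case: c => [|c]; rewrite ?if_same // /weight ifF //; lia.
- have [ne|ne] := leqP 14 n; last (rewrite coef4_0 coef4_part coef4_w).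
    rewrite (coef4_w (part _ F)) coef4_part (coef4_w F); case: d => [|d]; first by rewrite if_same.
    by rewrite coef4_part /weight; congr (if _ then _ else _); lia.
  by case: d => [|d]; rewrite ?if_same // /weight ifF //; lia.
Qed.

Definition rel_weight (i : nat) : nat := nth 0%N [:: 18; 19; 20; 26; 27; 28] i.

Lemma homogeneous_rel i : (i < 6)%N -> homogeneous (rel_weight i) (relators k)`_i.
Proof.
have [hx hy hz hw] := homogeneous_var.
case: i => [|[|[|[|[|[|//]]]]]] _; apply: homogeneousB.
- exact: (homogeneousX 3 hy).
- exact: (homogeneousM hx hz).
- exact: (homogeneousM hy hz).
- exact: (homogeneousM hx hw).
- exact: (homogeneousX 4 hx).
- exact: (homogeneousM hy hw).
- exact: (homogeneousX 2 hz).
- exact: (homogeneousM (homogeneousX 2 hy) hw).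
- exact: (homogeneousM (homogeneousX 3 hx) (homogeneousX 2 hy)).
- exact: (homogeneousM hz hw).
- exact: (homogeneousM (homogeneousX 3 hx) hz).
- exact: (homogeneousX 2 hw).
Qed.

(* Homogeneity of the relators makes the infinite sum over n of the
   coefficients of the parts locally finite. *)
Lemma relations_parts F : (forall n, part n F \in @relations k) -> F \in @relations k.
Proof.
move=> rel; have [q qE] := choice (fun n => linspan_seqP (rel n)).
(* In [Q i * r_i] the part of weight n depends only on the part of [Q i] of weight n - e_i, with e_i
   the weight of r_i. So [Q i] may copy a different [q n i] in each weight. *)
pose Q i : S4 := mk4 (fun a b c d => coef4 (q (weight a b c d + rel_weight i)%N i) a b c d).
suff -> : F = \sum_(i < 6) Q i * (relators k)`_i.
  apply: (@rpred_sum _ (@relations k)) => i _; apply: (@rpredZ _ _ (ideal (relators k))).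
  by apply: mem_linspan; apply: mem_nth.
apply: part_eq => n.
have qE' : part n F = \sum_(i < 6) q n i * (relators k)`_i by exact: qE.
have E : part n F = part n (\sum_(i < 6) q n i * (relators k)`_i).
  by rewrite -qE' part_part.
apply: (etrans E); apply: (etrans (part_sum _ _ _ _)).
apply/esym; apply: (etrans (part_sum _ _ _ _)); apply/esym; apply: eq_bigr => i _.
have hom := homogeneous_rel (ltn_ord i).
apply: (etrans (hom n (q n i))); apply/esym; apply: (etrans (hom n (Q i))).
case le_n: (rel_weight i <= n)%N; last by [].
apply: (congr1 (fun G => G * (relators k)`_i)); apply: coef4P => a b c d.
apply: (etrans (coef4_part _ _ _ _ _ _)); apply/esym.
apply: (etrans (coef4_part _ _ _ _ _ _)); case: eqP => [wE|_]; last by [].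
by apply/esym; apply: (etrans (coef4_mk _ _ _ _ _)); rewrite wE subnK.
Qed.

Definition mono4 (u : k) a b c d : S4 :=
  serC (serC (serC (serC u * serX _ ^+ a) * serX _ ^+ b) * serX _ ^+ c) * serX _ ^+ d.

Lemma coefs_CXn (A : comNzRingType) (u : A) i j :
  coefs (serC u * serX A ^+ i) j = if j == i then u else 0.
Proof. by rewrite coefsCM coefs_Xn; case: eqP; rewrite ?mulr1 ?mulr0. Qed.

Lemma coef4_mono u a b c d a' b' c' d' : coef4 (mono4 u a b c d) a' b' c' d' =
  if [&& a' == a, b' == b, c' == c & d' == d] then u else 0.
Proof.
rewrite /coef4 coefs_CXn; case: (d' == d); last by rewrite !andbF.
rewrite coefs_CXn; case: (c' == c); last by rewrite !andbF.
rewrite coefs_CXn; case: (b' == b); last by rewrite !andbF.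
by rewrite coefs_CXn !andbT.
Qed.

Lemma mono4E u a b c d :
  mono4 u a b c d = const4 u * (x ^+ a * y ^+ b * z ^+ c * w ^+ d).
Proof.
rewrite /mono4 !rmorphM !rmorphXn /= -/(const4 u).
rewrite -[serC (serC (serC (serX _)))]/(x4 k) -[serC (serC (serX _))]/(y4 k).
by rewrite -[serC (serX _)]/(z4 k) -[serX _]/(w4 k) !mulrA.
Qed.

Lemma part_sum_mono n F : part n F =
  \sum_(q : 'I_n.+1 * 'I_n.+1 * 'I_n.+1 * 'I_n.+1 |
      weight q.1.1.1 q.1.1.2 q.1.2 q.2 == n)
    mono4 (coef4 F q.1.1.1 q.1.1.2 q.1.2 q.2) q.1.1.1 q.1.1.2 q.1.2 q.2.
Proof.
apply: coef4P => a b c d; rewrite coef4_part coef4_sum; case: ifP => [/eqP wn|wn].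
  have [an bn cn dn] : [/\ (a < n.+1)%N, (b < n.+1)%N, (c < n.+1)%N & (d < n.+1)%N].
    by move: wn; rewrite /weight; split; lia.
  rewrite (bigD1 (Ordinal an, Ordinal bn, Ordinal cn, Ordinal dn)) /=; last first.
    by rewrite wn.
  rewrite coef4_mono !eqxx big1 ?addr0 // => -[[[a' b'] c'] d'] /= /andP[_ ne].
  rewrite coef4_mono ifF //; apply: contraNF ne => /and4P[/eqP ea /eqP eb /eqP ec /eqP ed].
  by rewrite !xpair_eqE -!val_eqE /= -ea -eb -ec -ed !eqxx.
rewrite big1 // => -[[[a' b'] c'] d'] /= /eqP wn'.
rewrite coef4_mono ifF //; apply: contraFF wn => /and4P[/eqP-> /eqP-> /eqP-> /eqP->].
by rewrite wn'.
Qed.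

End FourVariables.

(** * Normal forms of monomials modulo the relators *)

Section NormalForms.
Variables (Q : comNzRingType) (x y z w : Q).
Hypothesis rels : [/\ y ^+ 3 = x * z, y * z = x * w, y * w = x ^+ 4,
  z ^+ 2 = y ^+ 2 * w & z * w = x ^+ 3 * y ^+ 2 /\ w ^+ 2 = x ^+ 3 * z].

Definition apery : seq nat := [:: 0; 6; 12; 13; 14]%N.
Definition apery_mono : seq Q := [:: 1; y; y ^+ 2; z; w].

(** The five basis monomials have weights in distinct classes modulo 5, so n determines j and then
    i; this makes normal forms of the same weight equal. *)
Definition normal n (u : Q) : Prop :=
  exists i j, [/\ (j < 5)%N, u = x ^+ i * apery_mono`_j &
                  n = (5 * i + nth 0 apery j)%N].

Lemma normal_y n u : normal n u -> normal (6 + n) (y * u).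
Proof.
have [yyy yz yw _ _] := rels; move=> [i [j [j5 -> ->]]].
case: j j5 => [|[|[|[|[|//]]]]] _.
- by exists i, 1%N; split; [by []|rewrite /=; ring|rewrite /=; lia].
- by exists i, 2%N; split; [by []|rewrite /=; ring|rewrite /=; lia].
- exists i.+1, 3%N; split; [by []|rewrite /=|rewrite /=; lia].
  rewrite (exprS x); transitivity (x ^+ i * y ^+ 3); last by rewrite yyy; ring.
  by ring.
- exists i.+1, 4%N; split; [by []|rewrite /=|rewrite /=; lia].
  by rewrite (exprS x) mulrCA yz; ring.
- exists (i + 4)%N, 0%N; split; [by []|rewrite /=|rewrite /=; lia].
  by rewrite (exprD x) mulrCA yw; ring.
Qed.

Lemma normal_z n u : normal n u -> normal (13 + n) (z * u).
Proof.
have [yyy yz yw zz [zw ww]] := rels; move=> [i [j [j5 -> ->]]].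
case: j j5 => [|[|[|[|[|//]]]]] _.
- by exists i, 3%N; split; [by []|rewrite /=; ring|rewrite /=; lia].
- exists i.+1, 4%N; split; [by []|rewrite /=|rewrite /=; lia].
  by rewrite (exprS x) mulrCA [z * y]mulrC yz; ring.
- exists (i + 5)%N, 0%N; split; [by []|rewrite /=|rewrite /=; lia].
  transitivity (x ^+ i * (x * (y * w))); last by rewrite yw (exprD x); ring.
  transitivity (x ^+ i * (y * (y * z))); first by ring.
  by rewrite yz; ring.
- exists (i + 4)%N, 1%N; split; [by []|rewrite /=|rewrite /=; lia].
  transitivity (x ^+ i * (y * (y * w))); last by rewrite yw (exprD x); ring.
  by transitivity (x ^+ i * z ^+ 2); [ring|rewrite zz; ring].
- exists (i + 3)%N, 2%N; split; [by []|rewrite /=|rewrite /=; lia].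
  by rewrite (exprD x) mulrCA zw; ring.
Qed.

Lemma normal_w n u : normal n u -> normal (14 + n) (w * u).
Proof.
have [yyy yz yw zz [zw ww]] := rels; move=> [i [j [j5 -> ->]]].
case: j j5 => [|[|[|[|[|//]]]]] _.
- by exists i, 4%N; split; [by []|rewrite /=; ring|rewrite /=; lia].
- exists (i + 4)%N, 0%N; split; [by []|rewrite /=|rewrite /=; lia].
  by rewrite (exprD x) mulrCA [w * y]mulrC yw; ring.
- exists (i + 4)%N, 1%N; split; [by []|rewrite /=|rewrite /=; lia].
  transitivity (x ^+ i * (y * (y * w))); last by rewrite yw (exprD x); ring.
  by ring.
- exists (i + 3)%N, 2%N; split; [by []|rewrite /=|rewrite /=; lia].
  by rewrite (exprD x) mulrCA [w * z]mulrC zw; ring.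
- exists (i + 3)%N, 3%N; split; [by []|rewrite /=|rewrite /=; lia].
  by rewrite (exprD x) mulrCA -expr2 ww; ring.
Qed.

Lemma normal_mono a b c d :
  normal (weight a b c d) (x ^+ a * y ^+ b * z ^+ c * w ^+ d).
Proof.
rewrite /weight; elim: d => [|d IHd].
  elim: c => [|c IHc].
    elim: b => [|b IHb].
      by exists a, 0%N; split=> //=; rewrite ?muln0 ?addn0 // !mulr1.
    rewrite (_ : 5 * a + _ + _ + _ = 6 + (5 * a + 6 * b + 13 * 0 + 14 * 0))%N; last by lia.
    rewrite exprS (_ : _ * _ = y * (x ^+ a * y ^+ b * z ^+ 0 * w ^+ 0)); last by ring.
    exact: normal_y.
  rewrite (_ : 5 * a + _ + _ + _ = 13 + (5 * a + 6 * b + 13 * c + 14 * 0))%N; last by lia.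
  rewrite exprS (_ : _ * _ = z * (x ^+ a * y ^+ b * z ^+ c * w ^+ 0)); last by ring.
  exact: normal_z.
rewrite (_ : 5 * a + _ + _ + _ = 14 + (5 * a + 6 * b + 13 * c + 14 * d))%N; last by lia.
rewrite exprS (_ : _ * _ = w * (x ^+ a * y ^+ b * z ^+ c * w ^+ d)); last by ring.
exact: normal_w.
Qed.

Lemma normal_uniq n u v : normal n u -> normal n v -> u = v.
Proof.
move=> [i [j [j5 -> ->]]] [i' [j' [j'5 -> E]]].
have [-> ->] : i = i' /\ j = j' by move: j j' j5 j'5 E;
  case=> [|[|[|[|[|//]]]]]; case=> [|[|[|[|[|//]]]]] _ _ /=; lia.
by [].
Qed.

End NormalForms.

Lemma subst_coef0 (A B : comNzRingType) (g : {rmorphism A -> series B}) d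
    (f : series A) n :
  (forall i, (d.+1 * i <= n)%N -> coefs (g (coefs f i)) (n - d.+1 * i) = 0) ->
  coefs (subst g d f) n = 0.
Proof.
move=> f0; rewrite coefs_subst big1 // => i _.
by rewrite coefsMXn; case: leqP => // /f0.
Qed.

Lemma subst_const (A : comNzRingType) d (f : series A) :
  subst (@serC A) d f = expand d.+1 f.
Proof.
apply: seriesP => n; rewrite coefs_subst -[RHS]/(if _ then _ else _).
have cE i : coefs (serX A ^+ (d.+1 * i) * serC (coefs f i)) n =
    if n == (d.+1 * i)%N then coefs f i else 0.
  by rewrite mulrC coefs_CXn.
under eq_bigr do rewrite cE.
case: ifP => [/dvdnP[q nE]|nd]; last first.
  rewrite big1 // => i _; case: eqP => // nE; case/negP: (negbT nd).
  by rewrite nE dvdn_mulr.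
have qn : (q < n.+1)%N by rewrite nE ltnS leq_pmulr.
rewrite (bigD1 (Ordinal qn)) //= [in X in if X then _ else _]nE mulnC eqxx.
rewrite big1 ?addr0 => [|i]; first by rewrite nE mulnK.
rewrite -val_eqE /= => iq; case: eqP => // nE'; case/eqP: iq.
by apply/eqP; rewrite -(@eqn_pmul2l d.+1) // -nE' nE mulnC.
Qed.

(** * Evaluation of four variables at powers of t *)

Section Evaluation.
Variable k : fieldType.

(** The last clause replaces continuity: the coefficient of t^n in an evaluation depends only on the
    coefficients of weight n. *)
Lemma ex_evaluation : exists ev : {rmorphism series4 k -> series k},
  [/\ forall u, ev (const4 u) = serC u,
      [/\ ev (x4 k) = serX k ^+ 5, ev (y4 k) = serX k ^+ 6,
          ev (z4 k) = serX k ^+ 13 & ev (w4 k) = serX k ^+ 14],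
      forall f, ev (serC (serC (serC f))) = expand 5 f &
      forall n F, (forall a b c d, weight a b c d = n -> coef4 F a b c d = 0) ->
        coefs (ev F) n = 0].
Proof.
(* The variable goes to the power one above the second argument of [subst], hence 4, 5, 12, 13 for
   the exponents 5, 6, 13, 14. *)
pose ev1 : {rmorphism series k -> series k} := subst (@serC k) 4.
pose ev2 : {rmorphism series (series k) -> series k} := subst ev1 5.
pose ev3 : {rmorphism series (series (series k)) -> series k} := subst ev2 12.
pose ev4 : {rmorphism series4 k -> series k} := subst ev3 13.
have ev4C f : ev4 (serC f) = ev3 f by exact: subst_serC.
have ev3C f : ev3 (serC f) = ev2 f by exact: subst_serC.
have ev2C f : ev2 (serC f) = ev1 f by exact: subst_serC.
have ev1C f : ev1 (serC f) = serC f by exact: subst_serC.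
exists ev4; split.
- by move=> u; rewrite ev4C ev3C ev2C ev1C.
- by split; rewrite ?ev4C ?ev3C ?ev2C; apply: subst_serX.
- by move=> f; rewrite ev4C ev3C ev2C; apply: subst_const.
move=> n F F0; apply: subst_coef0 => d dn; apply: subst_coef0 => c cn.
apply: subst_coef0 => b bn; apply: subst_coef0 => a an.
case E: (_ - 5 * a)%N => [|j]; last by [].
by apply: (F0 a b c d); rewrite /weight; lia.
Qed.

End Evaluation.

Section Presentation.
Variables (k : fieldType) (R : model k).
Local Notation S4 := (series4 k).
Variable ev : {rmorphism S4 -> series k}.
Hypothesis ev_const : forall u, ev (const4 u) = serC u.
Hypothesis ev_x : ev (x4 k) = serX k ^+ 5.
Hypothesis ev_y : ev (y4 k) = serX k ^+ 6.
Hypothesis ev_z : ev (z4 k) = serX k ^+ 13.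
Hypothesis ev_w : ev (w4 k) = serX k ^+ 14.
Hypothesis ev_x_series : forall f, ev (serC (serC (serC f))) = expand 5 f.
Hypothesis ev_coef0 : forall n F,
  (forall a b c d, weight a b c d = n -> coef4 F a b c d = 0) ->
  coefs (ev F) n = 0.
Implicit Types (F G : S4).

Lemma ev_gap F n : n \in gaps -> coefs (ev F) n = 0.
Proof.
move=> ng; apply: ev_coef0 => a b c d wn; exfalso.
by move: ng; rewrite -wn /weight !inE; lia.
Qed.

Lemma unser_ev F : ser R (unser R (ev F)) = ev F.
Proof. by apply: unserK => n; apply: ev_gap. Qed.

Lemma ev_mono u a b c d :
  ev (mono4 u a b c d) = serC u * serX k ^+ weight a b c d.
Proof.
rewrite mono4E rmorphM ev_const !rmorphM !rmorphXn /= ev_x ev_y ev_z ev_w.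
by rewrite /weight 3!exprD 4!exprM.
Qed.

Lemma ev_relators : {in relators k, forall r, ev r = 0}.
Proof.
have ev_gens : [/\ ev (x4 k) = ser R (gx R), ev (y4 k) = ser R (gy R),
    ev (z4 k) = ser R (gz R) & ev (w4 k) = ser R (gw R)].
  split; [exact: etrans ev_x (esym (ser_x R))|exact: etrans ev_y (esym (ser_y R))|
    exact: etrans ev_z (esym (ser_z R))|exact: etrans ev_w (esym (ser_w R))].
rewrite /relators; move: (x4 k) (y4 k) (z4 k) (w4 k) ev_gens => x y z w [ex ey ez ew].
have [e1 e2 e3 e4 [e5 e6]] := gens_rel R.
have evB F G : ev F = ev G -> ev (F - G) = 0 by move=> FG; rewrite rmorphB /= FG subrr.
move=> r; rewrite !inE => /or4P[/eqP->|/eqP->|/eqP->|/or3P[]/eqP->]; apply: evB.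
- by rewrite rmorphXn rmorphM /= ex ey ez -rmorphXn -rmorphM e1.
- by rewrite !rmorphM /= ex ey ez ew -!rmorphM e2.
- by rewrite rmorphXn rmorphM /= ex ey ew -rmorphXn -rmorphM e3.
- by rewrite rmorphXn [RHS]rmorphM rmorphXn /= ey ez ew -!rmorphXn -rmorphM e4.
- by rewrite rmorphM [RHS]rmorphM !rmorphXn /= ex ey ez ew -!rmorphXn -!rmorphM e5.
- by rewrite rmorphM !rmorphXn /= ex ez ew -!rmorphXn -rmorphM e6.
Qed.

Lemma ev_relations : {in @relations k, forall F, ev F = 0}.
Proof.
move=> F; elim/linspan_ind: F / => [|a u v uR v0]; first exact: rmorph0.
transitivity (ev (a * u + v)); first by [].
by rewrite rmorphD rmorphM v0 (ev_relators uR) mulr0 addr0.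
Qed.

Local Notation X := (presented_proj (x4 k)).
Local Notation Y := (presented_proj (y4 k)).
Local Notation Z := (presented_proj (z4 k)).
Local Notation W := (presented_proj (w4 k)).

Lemma presented_projB F G :
  presented_proj (F - G) = presented_proj F - presented_proj G.
Proof. exact: (rmorphB (\pi_(Quotient.quot (@relations k)))). Qed.
Lemma presented_projD F G :
  presented_proj (F + G) = presented_proj F + presented_proj G.
Proof. exact: (rmorphD (\pi_(Quotient.quot (@relations k)))). Qed.
Lemma presented_projM F G :
  presented_proj (F * G) = presented_proj F * presented_proj G.
Proof. exact: (rmorphM (\pi_(Quotient.quot (@relations k)))). Qed.
Lemma presented_projXn F n :
  presented_proj (F ^+ n) = presented_proj F ^+ n.
Proof. exact: (rmorphXn (\pi_(Quotient.quot (@relations k)))). Qed.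
Lemma presented_proj0 : presented_proj (0 : S4) = 0.
Proof. exact: (rmorph0 (\pi_(Quotient.quot (@relations k)))). Qed.
Lemma presented_proj1 : presented_proj (1 : S4) = 1.
Proof. exact: (rmorph1 (\pi_(Quotient.quot (@relations k)))). Qed.

Lemma presented_proj_eq F G :
  presented_proj F = presented_proj G <-> F - G \in @relations k.
Proof. by rewrite Quotient.idealrBE; split=> [/eqP|/eqP]. Qed.

Lemma presented_proj_surj (q : presented k) : exists F, q = presented_proj F.
Proof. by exists (repr q); rewrite /presented_proj reprK. Qed.

Lemma presented_rels : [/\ Y ^+ 3 = X * Z, Y * Z = X * W, Y * W = X ^+ 4,
  Z ^+ 2 = Y ^+ 2 * W & Z * W = X ^+ 3 * Y ^+ 2 /\ W ^+ 2 = X ^+ 3 * Z].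
Proof.
have rel F G : F - G \in relators k -> presented_proj F = presented_proj G.
  by move=> FG; apply/presented_proj_eq; apply: mem_linspan.
have reli i : (i < 6)%N -> (relators k)`_i \in relators k by move=> i6; apply: mem_nth.
have E1 := rel (y4 k ^+ 3) (x4 k * z4 k) (reli 0%N isT).
have E2 := rel (y4 k * z4 k) (x4 k * w4 k) (reli 1%N isT).
have E3 := rel (x4 k ^+ 4) (y4 k * w4 k) (reli 2%N isT).
have E4 := rel (z4 k ^+ 2) (y4 k ^+ 2 * w4 k) (reli 3%N isT).
have E5 := rel (x4 k ^+ 3 * y4 k ^+ 2) (z4 k * w4 k) (reli 4%N isT).
have E6 := rel (x4 k ^+ 3 * z4 k) (w4 k ^+ 2) (reli 5%N isT).
pose pM := presented_projM; pose pX := presented_projXn.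
split; [| | | |split].
- exact: etrans (esym (pX _ _)) (etrans E1 (pM _ _)).
- exact: etrans (esym (pM _ _)) (etrans E2 (pM _ _)).
- exact: etrans (esym (pM _ _)) (etrans (esym E3) (pX _ _)).
- apply: etrans (esym (pX _ _)) (etrans E4 (etrans (pM _ _) _)).
  exact: (congr1 (fun q => q * W) (pX _ _)).
- apply: etrans (esym (pM _ _)) (etrans (esym E5) (etrans (pM _ _) _)).
  exact: congr2 (pX _ _) (pX _ _).
- apply: etrans (esym (pX _ _)) (etrans (esym E6) (etrans (pM _ _) _)).
  exact: (congr1 (fun q => q * Z) (pX _ _)).
Qed.

Lemma presented_proj_mono u a b c d : presented_proj (mono4 u a b c d) =
  presented_proj (const4 u) * (X ^+ a * Y ^+ b * Z ^+ c * W ^+ d).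
Proof.
rewrite mono4E presented_projM; congr (_ * _).
by rewrite 3!presented_projM !presented_projXn.
Qed.

Lemma presented_proj_sum (J : finType) (P : pred J) (f : J -> S4) :
  presented_proj (\sum_(j | P j) f j) = \sum_(j | P j) presented_proj (f j).
Proof. exact: (big_morph _ presented_projD presented_proj0). Qed.

Lemma const4_sum (J : finType) (P : pred J) (f : J -> k) :
  const4 (\sum_(j | P j) f j) = \sum_(j | P j) const4 (f j).
Proof.
apply: (big_morph (@const4 k)) => [u v|]; last by rewrite /const4 !rmorph0.
by rewrite /const4 !rmorphD.
Qed.

Lemma coefs_ev_part n F : coefs (ev (part n F)) n = coefs (ev F) n.
Proof.
apply/esym/eqP; rewrite -subr_eq0 -coefsN -coefsD -rmorphB; apply/eqP.
apply: ev_coef0 => a b c d wn.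
by rewrite coef4B coef4_part wn eqxx subrr.
Qed.

(** All monomials of weight n have the same class in the quotient, so the class of [part n F] is
    that of one monomial times the sum of the coefficients of weight n. This sum is the coefficient
    of t^n in [ev F]. *)
Lemma ev_kernel F : ev F = 0 -> F \in @relations k.
Proof.
move=> F0; apply: relations_parts => n; rewrite -[part n F]subr0.
apply/presented_proj_eq; rewrite presented_proj0.
have := coefs_ev_part n F; rewrite F0 coefs0 part_sum_mono.
rewrite rmorph_sum /= coefs_sum => sum0; rewrite presented_proj_sum.
have [q0 wq0|no_q] := pickP (fun q : 'I_n.+1 * 'I_n.+1 * 'I_n.+1 * 'I_n.+1 =>
  weight q.1.1.1 q.1.1.2 q.1.2 q.2 == n); last by rewrite big_pred0.
rewrite (eq_bigr (fun q : 'I_n.+1 * 'I_n.+1 * 'I_n.+1 * 'I_n.+1 =>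
  presented_proj (const4 (coef4 F q.1.1.1 q.1.1.2 q.1.2 q.2)) *
  (X ^+ q0.1.1.1 * Y ^+ q0.1.1.2 * Z ^+ q0.1.2 * W ^+ q0.2))) => [|q wq]; last first.
  rewrite presented_proj_mono; congr (_ * _).
  have N a b c d : weight a b c d = n ->
      normal X Y Z W n (X ^+ a * Y ^+ b * Z ^+ c * W ^+ d).
    by move=> <-; apply: normal_mono presented_rels _ _ _ _.
  exact: normal_uniq (N _ _ _ _ (eqP wq)) (N _ _ _ _ (eqP wq0)).
rewrite -mulr_suml -presented_proj_sum -const4_sum.
suff -> : \sum_(q : 'I_n.+1 * 'I_n.+1 * 'I_n.+1 * 'I_n.+1 |
    weight q.1.1.1 q.1.1.2 q.1.2 q.2 == n) coef4 F q.1.1.1 q.1.1.2 q.1.2 q.2 = 0.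
  by rewrite /const4 !rmorph0 presented_proj0 mul0r.
rewrite -[RHS]sum0; apply: eq_bigr => q /eqP wq.
by rewrite ev_mono wq coefsCM coefs_Xn eqxx mulr1.
Qed.

Lemma ser_emb h : ser R (emb R h) = expand 5 h.
Proof. by apply: seriesP => n; rewrite cf_emb. Qed.

Definition pres_fun (q : presented k) : R := unser R (ev (repr q)).

Lemma ser_pres_fun F : ser R (pres_fun (presented_proj F)) = ev F.
Proof.
rewrite /pres_fun unser_ev; apply/eqP; rewrite -subr_eq0 -rmorphB; apply/eqP.
by apply: ev_relations; apply/presented_proj_eq; rewrite /presented_proj reprK.
Qed.

Fact pres_fun_zmod : zmod_morphism pres_fun.
Proof.
move=> p q; have [F ->] := presented_proj_surj p; have [G ->] := presented_proj_surj q.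
by apply: (@ser_inj _ R); rewrite -presented_projB rmorphB !ser_pres_fun rmorphB.
Qed.

Fact pres_fun_monoid : monoid_morphism pres_fun.
Proof.
split=> [|p q]; apply: (@ser_inj _ R).
  by rewrite -presented_proj1 ser_pres_fun !rmorph1.
have [F ->] := presented_proj_surj p; have [G ->] := presented_proj_surj q.
by rewrite -presented_projM rmorphM !ser_pres_fun rmorphM.
Qed.

Definition pres : {rmorphism presented k -> R} := HB.pack pres_fun
  (GRing.isZmodMorphism.Build (presented k) R pres_fun pres_fun_zmod)
  (GRing.isMonoidMorphism.Build (presented k) R pres_fun pres_fun_monoid).

Lemma pres_bij : bijective pres.
Proof.
have inj : injective pres_fun.
  move=> p q; have [F ->] := presented_proj_surj p.
  have [G ->] := presented_proj_surj q => /(congr1 (ser R)).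
  rewrite !ser_pres_fun => FG; apply/presented_proj_eq; apply: ev_kernel.
  by rewrite rmorphB FG subrr.
have surj r : exists q, pres_fun q = r.
  (* A preimage is read off the decomposition of r over k[[x]]; [c3] regards a series in x as a
     series in four variables. *)
  pose c3 h : S4 := serC (serC (serC h)).
  exists (presented_proj (c3 (slice 0 r) + y4 k * c3 (slice 6 r) +
    y4 k ^+ 2 * c3 (slice 12 r) + z4 k * c3 (slice 13 r) + w4 k * c3 (slice 14 r))).
  apply: (@ser_inj _ R); apply: etrans (ser_pres_fun _) _.
  have -> : ser R r = expand 5 (slice 0 r) + serX k ^+ 6 * expand 5 (slice 6 r) +
      serX k ^+ 12 * expand 5 (slice 12 r) + serX k ^+ 13 * expand 5 (slice 13 r) +
      serX k ^+ 14 * expand 5 (slice 14 r).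
    rewrite {1}(decompose r) 4!rmorphD (rmorphM _ (gy R ^+ 2)) (rmorphM _ (gy R)).
    by rewrite (rmorphM _ (gz R)) (rmorphM _ (gw R)) !ser_emb ser_yy ser_y ser_z ser_w.
  have evD F G f g : ev F = f -> ev G = g -> ev (F + G) = f + g.
    by move=> <- <-; apply: rmorphD.
  have evM F f h : ev F = f -> ev (F * c3 h) = f * expand 5 h.
    by move=> <-; rewrite -ev_x_series; apply: rmorphM.
  have ev_yy : ev (y4 k ^+ 2) = serX k ^+ 12.
    by rewrite -[12%N]/(6 * 2)%N exprM -ev_y; apply: rmorphXn.
  exact: (evD _ _ _ _ (evD _ _ _ _ (evD _ _ _ _ (evD _ _ _ _ (ev_x_series _)
    (evM _ _ _ ev_y)) (evM _ _ _ ev_yy)) (evM _ _ _ ev_z)) (evM _ _ _ ev_w)).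
have [g gE] := choice surj; exists g => [q|r]; last exact: gE.
by apply: inj; apply: gE.
Qed.

End Presentation.

Theorem presentation (k : fieldType) (R : model k) :
  exists phi : {rmorphism presented k -> R},
     [/\ bijective phi,
         forall c : k, phi (presented_proj (const4 c)) = scal R c &
         [/\ phi (presented_proj (x4 k)) = gx R, phi (presented_proj (y4 k)) = gy R,
             phi (presented_proj (z4 k)) = gz R & phi (presented_proj (w4 k)) = gw R]].
Proof.
have [ev [ev_c [ev_x ev_y ev_z ev_w] ev_s ev_0]] := ex_evaluation k.
exists (pres R ev_x ev_y ev_z ev_w ev_0).
have E := ser_pres_fun R ev_x ev_y ev_z ev_w ev_0.
split; first exact: pres_bij.
  by move=> c; apply: (@ser_inj _ R); apply: etrans (E _) _; rewrite ev_c ser_scal.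
split; apply: (@ser_inj _ R).
- exact: etrans (E _) (etrans ev_x (esym (ser_x R))).
- exact: etrans (E _) (etrans ev_y (esym (ser_y R))).
- exact: etrans (E _) (etrans ev_z (esym (ser_z R))).
- exact: etrans (E _) (etrans ev_w (esym (ser_w R))).
Qed.

(** * The theorem *)

Section Canonical.
Variables (k : fieldType) (R : model k).
Local Notation x := (gx R).
Local Notation y := (gy R).
Local Notation z := (gz R).
Local Notation w := (gw R).
Local Notation m := (ideal [:: x; y; z; w]).
Local Notation I := (ideal [:: x ^+ 2; x * y; y ^+ 2]).
Local Notation C := (ideal [:: x ^+ 2; x * y; y ^+ 2; z; w]).

Fact val_I_linear : linear (fun u : submod I => val u : R^o).
Proof. by []. Qed.
Definition I_incl : {linear submod I -> R^o} := mk_linear val_I_linear.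

Lemma I_incl_inj : injective I_incl.
Proof. by move=> u v; rewrite !mk_linearE => /val_inj. Qed.

Lemma I_incl_im (r : R) : r \in I <-> exists u, I_incl u = r.
Proof.
split=> [rI|[u <-]]; first by exists (Submod rI); rewrite mk_linearE.
by rewrite mk_linearE; apply: valP.
Qed.

Lemma canonical_module_I : canonical_module m (submod I).
Proof.
exists 1%N; split.
- exact: krull_dim_one.
- exact: depth_ring.
- by split; [apply: finitely_generated_I|apply: depth_I].
- apply: (type_one (pi := mk_linear (@quot_proj_linear R R^o m)) _ _
    I_incl_inj I_incl_im) => [u|r]; last by rewrite mk_linearE quot_proj_eq0.
  by exists (repr (u : Quotient.quot _)); rewrite mk_linearE quot_projK.
- by apply: finite_inj_dim_ideal; apply: quotient_injective.
Qed.

Lemma canonical_ideal_I : canonical_ideal m I.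
Proof.
exists (submod I); first exact: canonical_module_I.
by exists (@idfun (submod I)); exists id.
Qed.

Lemma trace_I : trace (submod I) =i C.
Proof. exact: (trace_C I_incl_inj I_incl_im). Qed.

Lemma not_nearly_gorenstein : ~ nearly_gorenstein m.
Proof.
move=> [_ /(_ _ canonical_module_I)/(_ _ (gx_in_m R))].
rewrite trace_I => /mem_C/(_ 5%N isT)/eqP.
by rewrite ser_x coefs_Xn oner_eq0.
Qed.

End Canonical.

Section SgringModel.
Variable k : fieldType.
Local Notation S := [:: 5; 6; 13; 14]%N.
Local Notation R := (sgring k S).

Fact sgring_gap (f : R) n : n \in gaps -> coefs (val f) n = 0.
Proof.
move=> ng; case: f => f fS /=; move/asboolP: fS => fS.
by apply/eqP; apply: contraTT ng => /fS /in_semigroupP.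
Qed.

Fact sgring_unserK (h : series k) : (forall n, n \in gaps -> coefs h n = 0) ->
  val (insubd (0 : R) h) = h.
Proof.
move=> h0; apply: insubdK; apply/asboolP => n hn; apply/in_semigroupP.
by apply: contra_neqN hn; apply: h0.
Qed.

Definition sgring_model : model k :=
  @Model k R (val : {rmorphism R -> series k}) val_inj sgring_gap
    (insubd (0 : R)) sgring_unserK
    (sgring_gen k S 0) erefl (sgring_gen k S 1) erefl
    (sgring_gen k S 2) erefl (sgring_gen k S 3) erefl.

Lemma sgring_const_scal c : sgring_const S c = scal sgring_model c.
Proof. by apply: val_inj; apply: esym (ser_scal (sgring_model) c). Qed.

End SgringModel.

Theorem theorem5p3 (k : fieldType) :
  let S := [:: 5; 6; 13; 14]%N in
  let R : idomainType := sgring k S in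
  let x : R := sgring_gen k S 0 in
  let y : R := sgring_gen k S 1 in
  let z : R := sgring_gen k S 2 in
  let w : R := sgring_gen k S 3 in
  let m := ideal [:: x; y; z; w] in
  let I := ideal [:: x ^+ 2; x * y; y ^+ 2] in
  (exists phi : {rmorphism presented k -> R},
     [/\ bijective phi,
         forall c : k,
           phi (presented_proj (const4 c)) = sgring_const S c &
         [/\ phi (presented_proj (x4 k)) = x, phi (presented_proj (y4 k)) = y,
             phi (presented_proj (z4 k)) = z & phi (presented_proj (w4 k)) = w]])
  /\ (forall J : {pred R}, maximal_ideal J <-> J =i m)
  /\ canonical_ideal m I
  /\ (forall i : nat, (0 < i)%N ->
        forall a : R, a \in m -> forall e : Ext (submod I) R^o i, a *: e = 0)
  /\ trace (submod I) =i conductor R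
  /\ conductor R =i ideal [:: x ^+ 2; x * y; y ^+ 2; z; w]
  /\ ~ nearly_gorenstein m.
Proof.
move=> S R x y z w m I; pose M := sgring_model k.
split.
  have [phi [phi_bij phi_c phi_gens]] := presentation M.
  by exists phi; split=> // c; rewrite phi_c [RHS]sgring_const_scal.
split; first exact: (@maximal_idealP k M).
split; first exact: (@canonical_ideal_I k M).
split; first by move=> i i0 a am; apply: (@ext_I_annihilated k M i a i0 am).
split; first by move=> a; rewrite (@trace_I k M) (@conductor_C k M).
split; first exact: (@conductor_C k M).
exact: (@not_nearly_gorenstein k M).
Qed.
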